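(* Assume $\nu(E)<\infty$ and let $N$ be a Cox process on $[0,T]\times E$, $T<\infty$, with stochastic intensity $\{\lambda_{(t,x)}\}_{(t,x)\in[0,T]\times E}$ such that, for some non-negative functions $\alpha,\beta\in L^1([0,T]\times E,\mathrm dt\,\nu(\mathrm dx))$, $$\alpha(t,x)\le\lambda_{(t,x)}\le\beta(t,x),\quad\mathrm dt\,\nu(\mathrm dx)\,\mathbb P(\mathrm d\omega)\text{-almost everywhere},$$ and $$\gamma:=\|\beta\|_{L^1([0,T]\times E,\mathrm dt\,\nu(\mathrm dx))}-\|\alpha\|_{L^1([0,T]\times E,\mathrm dt\,\nu(\mathrm dx))}<1.$$ Then, for any square-integrable functional $G$ of $N$, $$\mathrm{Var}(G)\le\bigl(1-\sqrt\gamma\bigr)^{-2}\,\mathbb E\biggl[\int_{[0,T]\times E}\pi_{(t,x)}\,|D_{(t,x)}G|^2\,\mathrm dt\,\nu(\mathrm dx)\biggr],$$ where the Papangelou conditional intensity $\pi$ of $N$ is given, for fixed configuration $\omega$, by $\pi_{(t,x)}(\omega):=\mathbb E[\mathcal R(\lambda,\omega)\lambda_{(t,x)}]$ with $$\mathcal R(\lambda,\omega):=\frac{\exp\bigl(-\int_{[0,T]\times E}\lambda_{(s,z)}\,\mathrm ds\,\nu(\mathrm dz)\bigr)\prod_{(s,z)\in\mathrm{Supp}(\omega)}\lambda_{(s,z)}}{\mathbb E\Bigl[\exp\bigl(-\int_{[0,T]\times E}\lambda_{(s,z)}\,\mathrm ds\,\nu(\mathrm dz)\bigr)\prod_{(s,z)\in\mathrm{Supp}(\omega)}\lambda_{(s,z)}\Bigr]}.$$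 In particular, $\pi_{(t,x)}(\omega)\le\beta(t,x)$, $\mathrm dt\,\mathbb P(\mathrm d\omega)\,\nu(\mathrm dx)$-almost everywhere.
   Context: $E$ is a complete separable metric space with Borel $\sigma$-field $\mathcal E$ and $\nu$ a locally finite measure on it. A Cox process on $[0,T]\times E$ with (random, non-negative, measurable) intensity $\lambda$ is a point process which, conditionally on $\lambda$, is Poisson with intensity $\lambda_{(t,x)}$ with respect to $\mathrm dt\,\nu(\mathrm dx)$. In the definition of $\pi$ the configuration $\omega$ is fixed and the expectations are over the random field $\lambda$. $N$ is regarded as a random element of the space of integer-valued measures $\omega$ on $[0,T]\times E$ with $\omega(\{0\}\times E)=0$, $\omega(\{t\}\times E)\le1$ for all $t$, and $\omega([0,T]\times E)<\infty$. A functional $G$ of $N$ is a measurable function on that space, square-integrable if $\mathbb E[G(N)^2]<\infty$; $D_{(t,x)}G(\omega):=G(\omega+\varepsilon_{(t,x)})-G(\omega)$, where $\varepsilon_{(t,x)}$ is the Dirac measure and $\omega+\varepsilon_{(t,x)}$ is replaced by $\omega$ if $(t,x)\in\mathrm{Supp}(\omega)$. A non-negative jointly measurable process $\pi$ is a Papangelou conditional intensity of $N$ if $\mathbb E\bigl[\int X_{(t,x)}(N-\varepsilon_{(t,x)})\,N(\mathrm dt\times\mathrm dx)\bigr]=\mathbb E\bigl[\int_{[0,T]\times E}X_{(t,x)}(N)\,\pi_{(t,x)}(N)\,\mathrm dt\,\nu(\mathrm dx)\bigr]$ for every non-negative measurable process $X$. Convention: $0/0:=0$. *)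

(* Defs.v *)
From HB Require Import structures.
From mathcomp Require Import all_boot all_order all_algebra.
From mathcomp Require Import all_classical all_reals all_analysis.
From mathcomp Require Import measurable_realfun.

Set Implicit Arguments.
Unset Strict Implicit.
Unset Printing Implicit Defensive.
Import Order.TTheory GRing.Theory Num.Theory.
Import numFieldNormedType.Exports.
Local Open Scope classical_set_scope.
Local Open Scope ring_scope.

(* Measurable types are pointed in the library, hence a metric space carrying
   a sigma-field has to be nonempty. *)
#[short(type="completeMetricType")]
HB.structure Definition CompleteMetric (R : numDomainType) :=
  {E of Metric R E & Complete E & isPointed E}.

Definition separable (E : topologicalType) : Prop :=
  exists2 S : set E, countable S & dense S.

Notation borel E := (g_sigma_algebraType (@open E)).

Notation space_time R E := (measurableTypeR R * borel E)%type.

Section marked_point_processes.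
Context {R : realType} (E : completeMetricType R) (T : R).
Local Open Scope ereal_scope.

Definition window : set (space_time R E) := `[0%R, T]%classic `*` [set: borel E].

Definition is_configuration (w : {measure set (space_time R E) -> \bar R}) : Prop :=
  [/\ forall A, measurable A -> w A = +oo \/ exists n : nat, w A = n%:R%:E,
      w (~` window) = 0,
      w ([set 0%R] `*` [set: borel E]) = 0,
      forall t : R, w ([set t] `*` [set: borel E]) <= 1
    & w window < +oo].

Record configuration := Configuration {
  configuration_measure :> {measure set (space_time R E) -> \bar R};
  configurationP : is_configuration configuration_measure }.

Lemma mzero_is_configuration : is_configuration mzero.
Proof. by split=> [A _|||t|] //; by [right; exists 0%N | exact: lee01 | exact: ltry]. Qed.

HB.instance Definition _ := gen_eqMixin configuration.
HB.instance Definition _ := gen_choiceMixin configuration.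
HB.instance Definition _ :=
  isPointed.Build configuration (Configuration mzero_is_configuration).

(* The sigma-field on configurations is generated by the evaluation maps. *)
Definition evaluation_events : set_system configuration :=
  \bigcup_(A in measurable)
    preimage_set_system [set: configuration]
      (fun w : configuration => w A) measurable.

Definition configuration_measurable : set_system configuration :=
  <<s evaluation_events >>.

Fact configuration_measurable0 : configuration_measurable set0.
Proof. exact: sigma_algebra0. Qed.

Fact configuration_measurableC (U : set configuration) :
  configuration_measurable U -> configuration_measurable (~` U).
Proof. exact: sigma_algebraC. Qed.

Fact configuration_measurableU (F : (set configuration)^nat) :
  (forall i, configuration_measurable (F i)) ->
  configuration_measurable (\bigcup_i F i).
Proof. exact: sigma_algebra_bigcup. Qed.

HB.instance Definition _ :=
  @isMeasurable.Build (sigma_display evaluation_events) configuration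
    configuration_measurable configuration_measurable0
    configuration_measurableC configuration_measurableU.

Definition supp (w : configuration) : set (R * E) :=
  [set p | forall U : set (R * E), open U -> U p -> 0 < w U].

(* When w + delta_p is not a configuration although p is outside supp w (p has
   the time coordinate 0, or that of an atom of w, or lies outside the window),
   xget returns w. For fixed w these p in the window form a dt nu(dx)-null
   set. *)
Definition add_point (w : configuration) (p : space_time R E) : configuration :=
  if `[< supp w p >] then w
  else xget w [set w' : configuration |
         forall A, measurable A -> w' A = w A + \d_p A].

(* w - delta_p when p is an atom of w, and w otherwise. *)
Definition remove_point (w : configuration) (p : space_time R E) : configuration :=
  xget w [set w' : configuration |
    forall A, measurable A -> w A = w' A + \d_p A].

Definition add_one_cost (G : configuration -> R) (p : space_time R E)
    (w : configuration) : R :=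
  (G (add_point w p) - G w)%R.

Section cox_processes.
Context (nu : {finite_measure set (borel E) -> \bar R}).
Context {d : measure_display} {Omega : measurableType d} (P : probability Omega R).
Context (lambda : space_time R E -> Omega -> R) (N : Omega -> configuration).

Definition ref_measure : {measure set (space_time R E) -> \bar R} :=
  lebesgue_measure \x nu.

Definition cumulative_intensity (o : Omega) (A : set (space_time R E)) : \bar R :=
  \int[ref_measure]_(p in A) (lambda p o)%:E.

Definition intensity_events : set_system Omega :=
  \bigcup_(p in window)
    preimage_set_system [set: Omega] (lambda p) measurable.

(* For L = +oo this is 0, since expeR (- +oo) = 0 and 0 * +oo = 0. *)
Definition poisson_weight (L : \bar R) (k : nat) : \bar R :=
  expeR (- L) * L ^+ k * (k`!%:R^-1)%:E.

(* Conditionally on sigma(lambda), the counts of N on disjoint sets are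
   independent Poisson variables with means the integrals of lambda;
   conditional probabilities are spelled out by integrating over the events
   of sigma(lambda). *)
Definition is_cox_process : Prop :=
  forall (n : nat) (A : 'I_n -> set (space_time R E)) (k : 'I_n -> nat)
         (F : set Omega),
    (forall i, measurable (A i)) -> (forall i, A i `<=` window) ->
    trivIset [set: 'I_n] A -> <<s intensity_events >> F ->
    P (F `&` [set o | forall i, N o (A i) = (k i)%:R%:E]) =
    \int[P]_(o in F)
      \prod_(i < n) poisson_weight (cumulative_intensity o (A i)) (k i).

(* exp (- int lambda) * prod_(p in supp w) lambda_p *)
Definition likelihood (w : configuration) (o : Omega) : \bar R :=
  expeR (- cumulative_intensity o window)
  * (\big[ *%R/1%R]_(p \in supp w) lambda p o)%:E.

(* The division of extended reals satisfies 0 / 0 = 0. *)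
Definition likelihood_ratio (w : configuration) (o : Omega) : \bar R :=
  likelihood w o / \int[P]_o' likelihood w o'.

Definition cox_papangelou (p : space_time R E) (w : configuration) : \bar R :=
  \int[P]_o (likelihood_ratio w o * (lambda p o)%:E).

Definition is_papangelou (pi : space_time R E -> configuration -> \bar R) : Prop :=
  [/\ forall p w, window p -> 0 <= pi p w,
      measurable_fun (window `*` [set: configuration])
        (fun z : space_time R E * configuration => pi z.1 z.2)
    & forall X : space_time R E -> configuration -> \bar R,
        (forall p w, window p -> 0 <= X p w) ->
        measurable_fun (window `*` [set: configuration])
          (fun z : space_time R E * configuration => X z.1 z.2) ->
        \int[P]_o \int[N o]_(p in window) X p (remove_point (N o) p) =
        \int[P]_o \int[ref_measure]_(p in window) (X p (N o) * pi p (N o))].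

End cox_processes.
End marked_point_processes.

Arguments window {R} E T.
Arguments configuration {R} E T.

(* Main.v *)
Require Import Defs.
From HB Require Import structures.
From mathcomp Require Import all_boot all_order all_algebra finmap.
From mathcomp Require Import all_classical all_reals all_analysis.
From mathcomp Require Import measurable_realfun.
From mathcomp Require Import ring lra.
Set Implicit Arguments.
Unset Strict Implicit.
Unset Printing Implicit Defensive.
Import Order.TTheory GRing.Theory Num.Theory.
Import numFieldNormedType.Exports.
Local Open Scope classical_set_scope.
Local Open Scope ring_scope.

(** Conditionally on its intensity a Cox process is Poisson, and a Poisson
process satisfies the Poincare inequality with constant 1. The conditional
variances are bounded in this way; the conditional means are compared with the
total variance by a Doeblin argument.

Let Pi_f be the law of the Poisson process of intensity f. When f >= alpha,
this process is the superposition of a process of intensity alpha and of an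
independent one, which is empty with probability exp (int alpha - int f). For
alpha <= lambda <= beta it follows that Pi_lambda >= e Pi_alpha where
e = exp (- gamma), so that Pi_lambda = e Pi_alpha + (1 - e) Q for some
probability Q depending on lambda. Put m = E G and
b = e Pi_alpha G + (1 - e) m. The Jensen inequality for Q gives
(Pi_lambda G - b)^2 <= (1 - e) Pi_lambda (G - m)^2 ([pmean_variation]). Adding
the Poincare inequality of Pi_lambda ([poisson_poincare]) and averaging over
lambda,
  Var G <= E (G - b)^2 <= (1 - e) Var G + E (int lambda_x |D_x G|^2 dx),
that is, e Var G is at most the mean energy ([mixed_poincare]). Since
e >= 1 - gamma >= (1 - sqrt gamma)^2, the variance bound follows once the mean
energy is written with the Papangelou intensity pi ([papangelou_mixture]), and
once bounded functionals are replaced by square-integrable ones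
([variance_truncation]).

Poisson processes are handled without being constructed. If K_f F (w) is the
integral of f x F (w + x), where w + x is w with the point x added, the mean of
F under Pi_f is exp (- int f) times the sum over n of K_f^n F (0) / n!, a series
called [exp_add] here. A Cox process has the law given by averaging these series
over lambda ([mixed_poisson_law]): both laws give the same probabilities to the
counts on disjoint sets ([poisson_counts]), and these events determine a law on
configurations. Three facts about the series carry the rest.
 - If S X (w) is the sum of X p (w - p) over the atoms p of w, then
   K_1 S - S K_1 is the integration of X against the reference measure. Hence
   the formula of Mecke for unit intensity ([exp_add_atom_sum]).
 - Conjugating K_1 by the product of f over the atoms yields K_f
   ([exp_add_weight]), so that the law of N has the density
   l (w) = E (exp (- int lambda) prod_(p in w) lambda_p) with respect to the
   series of unit intensity. Since pi_x (w) = l (w + x) / l (w), the formula of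
   Mecke becomes the identity that defines pi ([papangelou_identity]).
 - (1 + K_f / n)^n tends to exp K_f. One step of the walk that adds a point with
   weight f / n has a variance bounded by the energy, and its gradient commutes
   with the walk up to the Jensen inequality, which gives the Poincare
   inequality in the limit ([step_iter_variance]).

The bound pi <= beta holds because pi_x (w) is a mean of lambda_x for a
probability that is absolutely continuous with respect to the law of lambda. *)

(** * Open sets and the diagonal of space-time *)

Section dense_sequences.
Context {R : realType} (E : completeMetricType R).

Lemma metric_ball_open (x : E) (r : R) : open (ball x r).
Proof.
rewrite openE => y; rewrite /interior ballEmdist/= => xy.
apply/nbhs_ballP; exists (r - mdist x y); first by rewrite /= subr_gt0.
move=> z; rewrite !ballEmdist/= => yz.
by rewrite (le_lt_trans (metric_triangle _ y _))// addrC -ltrBrDr.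
Qed.

Definition st_ball (p : R * E) (r : R) : set (space_time R E) :=
  ball p.1 r `*` ball p.2 r.

Lemma st_ball_open (p : R * E) r : open (st_ball p r : set (R * E)).
Proof.
rewrite openE => q [q1 q2]; exists (ball p.1 r, ball p.2 r) => //=.
by split; apply: open_nbhs_nbhs; split => //;
  [exact: ball_open | exact: metric_ball_open].
Qed.

Lemma measurable_st_ball (p : R * E) r : measurable (st_ball p r).
Proof.
apply: measurableX; first exact: measurable_ball.
by apply: sub_sigma_algebra; exact: metric_ball_open.
Qed.

Lemma open_st_ball (U : set (R * E)) p : open U -> U p ->
  exists2 r, 0 < r & st_ball p r `<=` U.
Proof.
move=> oU Up; have /nbhs_ballP[r r0 rU] : nbhs p U by apply: open_nbhs_nbhs.
by exists r => // q [q1 q2]; apply: rU.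
Qed.

(** With a dense sequence z, these balls form a countable base of the product
topology. *)
Definition st_cell (z : nat -> R * E) (nm : nat * nat) : set (space_time R E) :=
  st_ball (z nm.1) nm.2.+1%:R^-1.

Definition st_dense (z : nat -> R * E) :=
  forall p r, 0 < r -> exists n, st_ball p r (z n).

Lemma separable_st_dense : separable E -> exists z, st_dense z.
Proof.
move=> [S cS dS].
have [e he] : exists e : nat -> E, forall x r, 0 < r -> exists n, ball x r (e n).
  have S0 : S !=set0.
    by have [|x [_ Sx]] := dS setT _ openT; [exists point | exists x].
  have [f Sf] : exists f : nat -> E, S `<=` range f.
    move: cS => /countable_injP[g ginj].
    pose h n := xget point [set x | S x /\ g x = n].
    exists h => x Sx; exists (g x) => //; rewrite /h.
    case: xgetP => [y _ /= [Sy]|/(_ x) /= []//].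
    by move/ginj; rewrite !inE; apply.
  exists f => x r r0.
  have [|y [xy Sy]] := dS (ball x r) _ (metric_ball_open x r).
    by exists x; exact: ballxx.
  by have [n _ ny] := Sf _ Sy; exists n; rewrite ny.
pose z n : R * E := if choice.unpickle n is Some (q, k) then (ratr (q : rat), e k) else point.
exists z => -[t x] r r0.
have [k hk] := he x r r0.
have [|u [hu [q _ qu]]] := @dense_rat R (ball t r) _ (ball_open t r).
  by exists t; exact: ballxx.
by exists (choice.pickle (q, k)); rewrite /z choice.pickleK qu.
Qed.

Lemma st_cell_subset z p r : st_dense z -> 0 < r ->
  exists nm, st_cell z nm p /\ st_cell z nm `<=` st_ball p r.
Proof.
move=> dz r0; have r20 : 0 < r / 2 by rewrite divr_gt0.
have [m hm] : exists m, m.+1%:R^-1 < r / 2.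
  exists (Num.truncn (r / 2)^-1).
  by rewrite invf_plt ?posrE// truncnS_gt.
have [|n [h1 h2]] := dz p m.+1%:R^-1; first by rewrite invr_gt0.
exists (n, m); split; first by split; apply: ball_sym.
have rm : m.+1%:R^-1 + m.+1%:R^-1 <= r :> R by rewrite [r]splitr lerD// ltW.
move=> q [q1 q2]; split.
  by apply: le_ball rm _ _; exact: ball_triangle h1 q1.
by apply: le_ball rm _ _; exact: ball_triangle h2 q2.
Qed.

Lemma st_separate (p q : R * E) : p <> q -> exists2 r, 0 < r & ~ st_ball p r q.
Proof.
case: p q => [t x] [s y] pq.
have [ts|/eqP ts] := eqVneq t s; last first.
  exists `|t - s|; first by rewrite normr_gt0 subr_eq0; apply/eqP.
  by move=> [] /=; rewrite /ball/= ltxx.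
have xy : x <> y by move=> xy; apply: pq; rewrite ts xy.
exists (mdist x y); first by rewrite mdist_gt0; apply/eqP.
by move=> [] /= _; rewrite ballEmdist/= ltxx.
Qed.

(** The sigma-field of space-time is a product of Borel sigma-fields; separability
makes it contain the open sets of the product, as countable unions of cells. *)
Lemma measurable_st_open (U : set (R * E)) : separable E -> open U ->
  measurable (U : set (space_time R E)).
Proof.
move=> /separable_st_dense[z dz] oU.
have -> : U = \bigcup_n (if choice.unpickle n is Some nm then
    if `[< st_cell z nm `<=` U >] then st_cell z nm else set0 else set0).
  apply/seteqP; split => [p Up|p [n _]].
    have [r r0 rU] := open_st_ball oU Up.
    have [nm [nmp nmr]] := st_cell_subset p dz r0.
    exists (choice.pickle nm) => //; rewrite choice.pickleK; case: asboolP => //.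
    by case; exact: subset_trans rU.
  by case: choice.unpickle => // nm; case: asboolP => // nmU; exact: nmU.
apply: bigcup_measurable => n _; case: choice.unpickle => // nm.
by case: asboolP => // _; exact: measurable_st_ball.
Qed.

(** Two distinct points are separated by a cell around the first one, hence the
complement of the diagonal is a countable union of rectangles. *)
Lemma measurable_st_diag : separable E ->
  measurable [set pq : space_time R E * space_time R E | pq.1 = pq.2].
Proof.
move=> /separable_st_dense[z dz]; rewrite -[X in measurable X]setCK; apply: measurableC.
have -> : ~` [set pq : space_time R E * space_time R E | pq.1 = pq.2] =
   \bigcup_n (if choice.unpickle n is Some nm then
     st_cell z nm `*` ~` st_cell z nm else set0).
  apply/seteqP; split => [[p q] /= pq|[p q] [n _]].
    have [r r0 rq] := st_separate pq.
    have [nm [nmp nmr]] := st_cell_subset p dz r0.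
    by exists (choice.pickle nm) => //; rewrite choice.pickleK; split => //= /nmr.
  case: choice.unpickle => // nm [/= np nq] pq; apply: nq.
  by rewrite -pq.
apply: bigcup_measurable => n _; case: choice.unpickle => // nm.
by apply: measurableX; [|apply: measurableC]; exact: measurable_st_ball.
Qed.

Lemma measurable_st_set1 (p : space_time R E) : separable E -> measurable [set p].
Proof.
move=> sE.
have := measurable_xsection p (measurable_st_diag sE).
congr (measurable _); apply/seteqP; split => [q|q ->]; rewrite /xsection/= ?inE//=.
Qed.

Lemma measurable_slice (t : R) : measurable ([set t] `*` [set: borel E]).
Proof. by apply: measurableX. Qed.

End dense_sequences.

(** * Configurations are finite sets of atoms *)

Section configuration_structure.
Context {R : realType} (E : completeMetricType R) (T : R).
Hypothesis sE : separable E.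
Local Open Scope ereal_scope.
Implicit Types (w : configuration E T) (p : space_time R E).

Lemma measurable_window : measurable (window E T).
Proof. by apply: measurableX. Qed.

Lemma configuration_lty w (A : set (space_time R E)) : measurable A -> w A < +oo.
Proof.
move=> mA; have [_ w0 _ _ wfin] := configurationP w.
have wT : w setT <= w (window E T) + w (~` window E T).
  rewrite -(setUv (window E T)); apply: measureU2; first exact: measurable_window.
  by apply: measurableC; exact: measurable_window.
rewrite (@le_lt_trans _ _ (w setT))//; first by apply: le_measure; rewrite ?inE.
by rewrite (le_lt_trans wT)// [X in _ + X]w0 adde0.
Qed.

Lemma configuration_nat w (A : set (space_time R E)) : measurable A ->
  exists n : nat, w A = n%:R%:E.
Proof.
move=> mA; have [/(_ A mA)[wA|//] _ _ _ _] := configurationP w.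
by have := configuration_lty w mA; rewrite wA ltxx.
Qed.

Lemma configuration_ge1 w (A : set (space_time R E)) : measurable A ->
  w A != 0 -> 1 <= w A.
Proof.
move=> mA; have [n ->] := configuration_nat w mA.
by rewrite eqe pnatr_eq0 -lt0n lee_fin ler1n.
Qed.

(** The masses of the shrinking balls are positive integers, hence at least 1, and
so is their limit, the mass of the point; it is at most the mass of a time
slice, hence at most 1. *)
Lemma st_ball_gt0_atom w p :
  (forall n, w (st_ball p n.+1%:R^-1) != 0) -> w [set p] = 1.
Proof.
move=> wp.
have le1 : w [set p] <= 1.
  have [_ _ _ /(_ p.1) w1 _] := configurationP w.
  apply: le_trans w1; apply: le_measure; rewrite ?inE.
  - exact: measurable_st_set1.
  - exact: measurable_slice.
  - by move=> q ->.
apply/eqP; rewrite eq_le le1/=.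
pose F n := st_ball p n.+1%:R^-1.
have capF : \bigcap_n F n = [set p].
  apply/seteqP; split => [q Fq|q -> n _]; last first.
    by split; apply: ballxx; rewrite invr_gt0.
  have [->//|qp] := pselect (q = p).
  have [r r0] : exists2 r : R, (0 < r)%R & ~ st_ball p r q.
    by apply: st_separate => pq; exact: qp.
  case.
  have [m hm] : exists m, (m.+1%:R^-1 < r)%R.
    exists (Num.truncn r^-1)%R.
    by rewrite invf_plt ?posrE// truncnS_gt.
  by have [q1 q2] := Fq m Logic.I; split; apply: le_ball (ltW hm) _ _.
have mF n : measurable (F n) by exact: measurable_st_ball.
have : w \o F @ \oo --> w (\bigcap_n F n).
  apply: nonincreasing_cvg_mu => //.
  - exact: configuration_lty.
  - by rewrite capF; exact: measurable_st_set1.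
  - move=> n m nm; rewrite subsetEset => q [q1 q2].
    have le : (m.+1%:R^-1 <= n.+1%:R^-1 :> R)%R.
      by rewrite lef_pV2 ?posrE// ler_nat.
    by split; apply: le_ball le _ _.
rewrite capF => wF; rewrite -(cvg_lim _ wF)//; apply: lime_ge.
  by apply/cvg_ex; exists (w [set p]).
by apply: nearW => n; exact: configuration_ge1 (mF n) (wp n).
Qed.

Lemma suppP w p : supp w p <-> w [set p] = 1.
Proof.
split=> [wp|wp U oU Up].
  apply: st_ball_gt0_atom => n; rewrite gt_eqF//.
  apply: wp; first exact: st_ball_open.
  by split; apply: ballxx; rewrite invr_gt0.
apply: (@lt_le_trans _ _ (w [set p])); first by rewrite wp lte01.
apply: le_measure; rewrite ?inE.
- exact: measurable_st_set1.
- exact: measurable_st_open.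
- by move=> q ->.
Qed.

Lemma supp_eq0 w p : ~ supp w p -> w [set p] = 0.
Proof.
move=> /suppP wp; have [n wn] := configuration_nat w (measurable_st_set1 p sE).
have [_ _ _ /(_ p.1) w1 _] := configurationP w.
have : w [set p] <= 1.
  apply: le_trans w1; apply: le_measure; rewrite ?inE.
  - exact: measurable_st_set1.
  - exact: measurable_slice.
  - by move=> q ->.
move: wp; rewrite wn; case: n {wn} => [//|[//|n]] _.
by rewrite lee_fin lern1.
Qed.

Lemma suppPn w p : ~ supp w p <-> exists n, w (st_ball p n.+1%:R^-1) = 0.
Proof.
split=> [wp|[n wn]].
  apply: contrapT => /forallNP wn; apply: wp; apply/suppP.
  by apply: st_ball_gt0_atom => n; apply/eqP; exact: wn.
have pB : st_ball p n.+1%:R^-1 p by split; apply: ballxx; rewrite invr_gt0.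
by move=> /(_ _ (@st_ball_open _ _ p n.+1%:R^-1%R) pB); rewrite [X in _ < X]wn ltxx.
Qed.

Lemma measurable_supp w : measurable (supp w : set (space_time R E)).
Proof.
rewrite -[supp w]setCK; apply: measurableC.
have -> : ~` supp w = \bigcup_(U in [set U : set (R * E) | open U /\ ~ 0 < w U]) U.
  apply/seteqP; split => [p|p [U [oU wU] Up] wp]; last exact/wU/wp.
  move/existsNP => [U /not_implyP[oU /not_implyP[Up wU]]].
  by exists U.
by apply: measurable_st_open => //; apply: bigcup_open => U [].
Qed.

(** A point outside the support lies in a null cell, and there are countably many
cells. *)
Lemma supp_setC w : w (~` supp w) = 0.
Proof.
have [z dz] := separable_st_dense sE.
pose F n : set (space_time R E) := if choice.unpickle n is Some nm then
  if w (st_cell z nm) == 0 then st_cell z nm else set0 else set0.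
have mF n : measurable (F n).
  rewrite /F; case: choice.unpickle => // nm; case: ifP => // _.
  exact: measurable_st_ball.
have F0 n : w (F n) = 0.
  by rewrite /F; case: choice.unpickle => [nm|]; [case: eqP => // _ |]; exact: measure0.
apply: (@subset_measure0 _ _ _ w _ (\bigcup_n F n)).
- by apply: measurableC; exact: measurable_supp.
- exact: bigcup_measurable.
- move=> p /suppPn[n wn].
  have [|nm [nmp nms]] := @st_cell_subset _ _ z p n.+1%:R^-1%R dz.
    by rewrite invr_gt0.
  exists (choice.pickle nm) => //; rewrite /F choice.pickleK ifT//.
  apply/eqP; apply: subset_measure0 nms wn; exact: measurable_st_ball.
- apply/eqP; rewrite eq_le measure_ge0 andbT.
  apply: (le_trans (measure_sigma_subadditive _ _ _ (@subset_refl _ (\bigcup_n F n)))) => //.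
    exact: bigcup_measurable.
  by rewrite eseries0.
Qed.

Lemma fset_bigcup (B : {fset R * E}) :
  [set` B] = \bigcup_(p in [set` B]) [set (p : space_time R E)].
Proof. by apply/seteqP; split => [p Bp|p [q Bq ->]//]; exists p. Qed.

Lemma measurable_st_fset (B : {fset R * E}) :
  measurable ([set` B] : set (space_time R E)).
Proof.
rewrite fset_bigcup; apply: fin_bigcup_measurable => // p _.
exact: measurable_st_set1.
Qed.

Lemma measure_fset_supp w (B : {fset R * E}) : [set` B] `<=` supp w ->
  w [set` B] = #|` B|%:R%:E.
Proof.
move=> Bw; rewrite fset_bigcup measure_fin_bigcup//; last 2 first.
- by move=> p q _ _ [x [/= -> ->]].
- by move=> p _; exact: measurable_st_set1.
rewrite fsbig_finite//= set_fsetK big_seq (eq_bigr (fun=> 1%:E)); last first.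
  by move=> p pB; apply/suppP/Bw.
by rewrite -big_seq sumEFin big_const_seq count_predT iter_addr_0.
Qed.

(** Each atom has mass 1, and the total mass is finite. *)
Lemma finite_supp w : finite_set (supp w).
Proof.
have [n wn] := configuration_nat w measurableT.
apply: contrapT => /infinite_set_fset - /(_ n.+1)[B Bw nB].
have : w [set` B] <= w setT.
  apply: le_measure; rewrite ?inE//.
  exact: measurable_st_fset.
by rewrite measure_fset_supp// wn lee_fin ler_nat leqNgt nB.
Qed.

End configuration_structure.

(** * Adding and removing a point *)

Section configuration_operations.
Context {R : realType} (E : completeMetricType R) (T : R).
Hypothesis sE : separable E.
Local Open Scope ereal_scope.
Implicit Types (w : configuration E T) (p : space_time R E).

Lemma integral_configuration w (f : space_time R E -> \bar R) :
  measurable_fun setT f -> (forall p, 0 <= f p) ->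
  \int[w]_p f p = \sum_(p \in supp w) f p.
Proof.
move=> mf f0.
have fw := finite_supp sE w.
rewrite (ge0_negligible_integral (N := ~` (supp w : set (space_time R E))))//; last 2 first.
- by apply: measurableC; exact: measurable_supp.
- exact: supp_setC.
have -> : [set: space_time R E] `\` ~` supp w =
    \big[setU/set0]_(p <- fset_set (supp w)) [set (p : space_time R E)].
  rewrite bigsetU_fset_set//; apply/seteqP; split => p /=.
    by move=> [_ /contrapT wp]; exists p.
  by move=> [q wq ->]; split.
rewrite ge0_integral_bigsetU//=.
- rewrite fsbig_finite//= big_seq [RHS]big_seq; apply: eq_bigr => p.
  rewrite in_fset_set// inE => /(suppP sE) wp.
  rewrite (eq_integral (cst (f p))).
    by rewrite integral_cst ?wp ?mule1//; exact: measurable_st_set1.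
  by move=> q; rewrite inE => ->.
- by move=> p; exact: measurable_st_set1.
- by move=> p q _ _ [x [/= -> ->]].
- exact: measurable_funS mf.
Qed.

(** Two configurations with the same masses of measurable sets may differ as
functions on all sets, yet no measurable function separates them
([weq_measurable]). *)
Definition weq w w' := forall A, measurable A -> w A = w' A.

(** The sets that do not separate w from w' form a sigma-algebra, which contains
the generating events. *)
Lemma weq_preimage w w' (U : set (configuration E T)) :
  weq w w' -> measurable U -> U w <-> U w'.
Proof.
move=> ww'; suff : configuration_measurable (T := T) `<=` [set U | U w <-> U w'].
  exact.
apply: smallest_sub.
  split => //.
  - by move=> A AE; split => -[_ nA]; split => // /AE.
  - by move=> F FE; split => -[n _ Fn]; exists n => //; exact/FE.
move=> V [A mA [B mB <-]] /=.
by split => -[_ /= Bw]; split => //=; [rewrite -ww'|rewrite ww'].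
Qed.

Lemma weq_measurable d (Y : measurableType d) (F : configuration E T -> Y) w w' :
  (forall y : Y, measurable [set y]) -> measurable_fun setT F -> weq w w' ->
  F w = F w'.
Proof.
move=> m1 mF ww'.
have mU := mF measurableT _ (m1 (F w')).
by have [_] := weq_preimage ww' mU; case.
Qed.

Lemma weq_emeasurable (F : configuration E T -> \bar R) w w' :
  measurable_fun setT F -> weq w w' -> F w = F w'.
Proof. by apply: weq_measurable => y; exact: emeasurable_set1. Qed.

Lemma supp_window w : supp w `<=` window E T.
Proof.
move=> p /(suppP sE) wp; apply: contrapT => nwp.
have [_ w0 _ _ _] := configurationP w.
have : w [set p] = 0.
  apply: (@subset_measure0 _ _ _ w _ (~` window E T)) => //.
  - exact: measurable_st_set1.
  - by apply: measurableC; exact: measurable_window.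
  - by move=> q ->.
by rewrite wp => /eqP; rewrite onee_eq0.
Qed.

Definition slice (t : R) : set (space_time R E) := [set t] `*` [set: borel E].

Lemma measure_slice0 w t : w (slice t) = 0 <-> forall p, supp w p -> p.1 != t.
Proof.
split=> [wt p /(suppP sE) wp|wt].
  apply/eqP => pt; have : w [set p] = 0.
    apply: (@subset_measure0 _ _ _ w _ (slice t)) => //.
    - exact: measurable_st_set1.
    - exact: measurable_slice.
    - by move=> q ->.
  by rewrite wp => /eqP; rewrite onee_eq0.
apply: (@subset_measure0 _ _ _ w _ (~` (supp w : set (space_time R E)))).
- exact: measurable_slice.
- by apply: measurableC; exact: measurable_supp.
- by move=> p [/= pt _] /wt; rewrite pt eqxx.
- exact: supp_setC.
Qed.

(** This is exactly the case where w plus a unit mass at p is a configuration and p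
is not an atom: [add_pointE] and [add_point_id]. *)
Definition addable w p := [/\ window E T p, p.1 != 0%R & w (slice p.1) = 0].

Lemma addable_supp w p : addable w p -> ~ supp w p.
Proof. by move=> [_ _ /measure_slice0 h] /h; rewrite eqxx. Qed.

Lemma addable_is_configuration w p :
  addable w p -> is_configuration T (measure_add w \d_p).
Proof.
move=> [Wp p0 wp]; have [w1 w2 w3 w4 w5] := configurationP w.
have addE A : measure_add w \d_p A = w A + \d_p A by exact: measure_addE.
split.
- move=> A mA; right; have [n wA] := configuration_nat w mA.
  exists (n + (p \in A))%N.
  by rewrite [LHS]addE wA diracE natrD.
- by rewrite [LHS]addE [X in X + _]w2 diracE memNset ?adde0// => /(_ Wp).
- rewrite [LHS]addE [X in X + _]w3 diracE memNset ?adde0// => -[/= p00 _].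
  by move: p0; rewrite p00 eqxx.
- move=> t; rewrite [leLHS]addE; have [->|tp] := eqVneq t p.1.
    by rewrite [X in X + _]wp add0e diracE lee_fin lern1 leq_b1.
  rewrite diracE memNset ?adde0// => -[/= pt _].
  by move: tp; rewrite pt eqxx.
- rewrite [ltLHS]addE lte_add_pinfty// diracE ltry//.
Qed.

Lemma add_pointE w p : addable w p ->
  forall A, measurable A -> add_point w p A = w A + \d_p A.
Proof.
move=> wp; rewrite /add_point asboolF; last exact: addable_supp.
case: xgetP => [w' _ //|/(_ (Configuration (addable_is_configuration wp)))[]].
by move=> A mA; exact: measure_addE.
Qed.

Lemma add_point_id w p : ~ addable w p -> add_point w p = w.
Proof.
rewrite /add_point; case: asboolP => // nwp ad.
case: xgetP => // w' _ /= w'E; exfalso; apply: ad.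
have [w1 w2 w3 w4 w5] := configurationP w'.
have Wp : window E T p.
  apply: contrapT => nWp; move: w2.
  rewrite [X in X = _]w'E; last by apply: measurableC; exact: measurable_window.
  rewrite diracE mem_set// => /eqP.
  by rewrite padde_eq0// ?onee_eq0 ?andbF.
split => //.
- apply/eqP => p0; move: w3.
  rewrite [X in X = _]w'E; last exact: measurable_slice.
  by rewrite diracE mem_set//= => /eqP; rewrite padde_eq0// ?onee_eq0 ?andbF.
- have [n wn] := configuration_nat w (measurable_slice p.1 : measurable (slice p.1)).
  move: (w4 p.1); rewrite [X in X <= _]w'E; last exact: measurable_slice.
  rewrite diracE mem_set//= [X in X + _]wn -EFinD lee_fin gerDr.
  by rewrite -(mulr0n 1%R) ler_nat leqn0 /slice wn => /eqP ->.
Qed.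

Lemma supp_add_point w p : addable w p -> supp (add_point w p) = p |` supp w.
Proof.
move=> wp; apply/seteqP; split => q.
  move=> /(suppP sE); rewrite (add_pointE wp (measurable_st_set1 q sE)).
  have [wq _|nwq] := pselect (supp w q); first by right.
  rewrite [X in X + _](supp_eq0 sE nwq) add0e diracE.
  have [->|pq] := pselect (p = q); first by left.
  by rewrite memNset// => /esym/eqP; rewrite onee_eq0.
move=> wq; apply/(suppP sE); rewrite (add_pointE wp (measurable_st_set1 q sE)).
have nwp := addable_supp wp.
case: wq => [->|wq].
  by rewrite [X in X + _](supp_eq0 sE nwp) add0e diracE mem_set.
rewrite [X in X + _](suppP sE _ _).1// diracE memNset ?adde0// => /= pq.
by apply: nwp; rewrite pq.
Qed.

Lemma remove_is_configuration w p :
  is_configuration T (mrestr w (measurableC (measurable_st_set1 p sE))).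
Proof.
have [w1 w2 w3 w4 w5] := configurationP w.
have mp := measurableC (measurable_st_set1 p sE).
have le A : measurable A -> w (A `&` ~` [set p]) <= w A.
  by move=> mA; apply: le_measure; rewrite ?inE//; exact: measurableI.
split.
- move=> A mA; right; have [n wA] := configuration_nat w (measurableI _ _ mA mp).
  by exists n.
- apply/eqP; rewrite eq_le measure_ge0 andbT -[X in _ <= X]w2; apply: le.
  by apply: measurableC; exact: measurable_window.
- apply/eqP; rewrite eq_le measure_ge0 andbT -[X in _ <= X]w3; apply: le.
  exact: measurable_slice.
- move=> t; apply: le_trans (w4 t); apply: le; exact: measurable_slice.
- apply: le_lt_trans w5; apply: le; exact: measurable_window.
Qed.

(** An atom p of w has mass 1, hence accounts for the difference of the masses of A
and of A deprived of p. *)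
Lemma measureD1 w p (A : set (space_time R E)) : measurable A ->
  w A = w (A `\ p) + (if `[< supp w p >] then \d_p A else 0).
Proof.
move=> mA; have mp := measurable_st_set1 p sE.
have -> : w A = w (A `\ p) + w (A `&` [set p]).
  rewrite -measureU//.
  - by rewrite setUC setUIDK.
  - exact: measurableD.
  - exact: measurableI.
  - by apply/seteqP; split => q // -[[_ +] [_ /=]].
congr (_ + _); have [pA|pA] := pselect (A p); last first.
  rewrite (_ : _ `&` _ = set0); last first.
    by apply/seteqP; split => // q [Aq /= qp]; apply: pA; rewrite -qp.
  by rewrite measure0 diracE memNset//; case: ifP.
rewrite (_ : _ `&` _ = [set p]); last first.
  by apply/seteqP; split => q /= [] //; move=> ->.
rewrite diracE mem_set//; case: asboolP => wp; first exact/(suppP sE).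
exact: supp_eq0.
Qed.

Lemma remove_pointE w p A : measurable A -> remove_point w p A = w (A `\ p).
Proof.
move=> mA; have mp := measurable_st_set1 p sE.
rewrite /remove_point; case: xgetP => [w' _ /= w'E|nw'].
  have wp : w [set p] = w' [set p] + 1 by rewrite w'E// diracE mem_set.
  have Swp : supp w p.
    apply: contrapT => /(supp_eq0 sE); rewrite wp => /eqP.
    by rewrite padde_eq0// ?onee_eq0 ?andbF.
  have := w'E _ mA; rewrite (measureD1 w p mA) asboolT//.
  by move=> /(congr1 (fun x => x - \d_p A)); rewrite !addeK// diracE.
rewrite (measureD1 w p mA); case: asboolP => wp; last by rewrite adde0.
exfalso; apply: (nw' (Configuration (remove_is_configuration w p))) => B mB.
by rewrite (measureD1 w p mB) asboolT.
Qed.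

End configuration_operations.

(** * Measurability of the operations on configurations *)

Section configuration_measurability.
Context {R : realType} (E : completeMetricType R) (T : R).
Hypothesis sE : separable E.
Local Open Scope ereal_scope.
Local Notation ST := (space_time R E).
Local Notation config := (configuration E T).
Implicit Types (w : config) (p : ST).

Lemma indic_iff (X Y : Type) (A : set X) (B : set Y) x y :
  (A x <-> B y) -> \1_A x = \1_B y :> R.
Proof.
move=> AB; rewrite !indicE; have -> // : (x \in A) = (y \in B).
by apply/idP/idP; rewrite !inE => /AB.
Qed.

Lemma measurable_evaluation (A : set ST) : measurable A ->
  measurable_fun [set: config] (fun w : config => w A).
Proof.
move=> mA _ B mB; apply: sub_sigma_algebra; exists A => //.
by exists B.
Qed.

Lemma measurable_fun_configuration d (Z : measurableType d) (W : Z -> config) :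
  (forall A, measurable A -> measurable_fun setT (fun z => W z A)) ->
  measurable_fun setT W.
Proof.
move=> mW; apply: (@measurability _ _ _ _ _ _ (@evaluation_events R E T)) => //.
move=> _ [U [A mA [B mB <-]] <-].
rewrite setTI [X in measurable X](_ : _ = setT `&` (fun z => W z A) @^-1` B).
  exact: mW.
by rewrite !setTI.
Qed.

Section integral_kernel.
Import HBNNSimple.
Context d (Z : measurableType d) (W : Z -> config).
Hypothesis mW : measurable_fun setT W.

Let ker : Z -> {measure set ST -> \bar R} := fun z => W z.

Let measurable_ker U : measurable U -> measurable_fun setT (ker ^~ U).
Proof. by move=> mU; exact: measurableT_comp (measurable_evaluation mU) mW. Qed.

HB.instance Definition _ := isKernel.Build _ _ _ _ _ ker measurable_ker.

(** A configuration that depends measurably on a parameter is a kernel, and each of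
its values is a finite measure. *)
Lemma measurable_integral_configuration (h : Z * ST -> \bar R) :
  (forall z, 0 <= h z) -> measurable_fun setT h ->
  measurable_fun setT (fun z => \int[W z]_p h (z, p)).
Proof.
move=> h0 mh.
pose k_ := nnsfun_approx measurableT mh.
apply: (@measurable_fun_xsection_integral _ _ _ _ _ h ker k_).
- by move=> a b ab; exact/nd_nnsfun_approx.
- by move=> z; exact/cvg_nnsfun_approx.
- move=> n r.
  set A := k_ n @^-1` [set r].
  have mA : measurable A.
    rewrite /A -[X in measurable X]setTI.
    exact: (measurable_funP (k_ n) measurableT).
  rewrite (_ : (fun z => _) = (fun z => mrestr (ker z) measurableT (xsection A z))).
    suff H : forall z, exists M, forall X, measurable X ->
        mrestr (ker z) measurableT X < M%:E.
      by have [] := measurable_prod_subset_xsection_kernel (k := ker) H mA.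
    move=> z; have [m wm] := configuration_nat (W z) measurableT.
    exists (m%:R + 1)%R => X mX; rewrite /= /mrestr setIT.
    apply: (@le_lt_trans _ _ (W z setT)); first by apply: le_measure; rewrite ?inE.
    by rewrite wm lte_fin ltrDl.
  by apply/funext => z /=; rewrite /mrestr setIT.
Qed.

End integral_kernel.

Lemma measurable_st_neq d (Z : measurableType d) (f g : Z -> ST) :
  measurable_fun setT f -> measurable_fun setT g ->
  measurable [set z | f z <> g z].
Proof.
move=> mf mg; apply: measurableC.
have := measurable_fun_pair mf mg measurableT (measurable_st_diag sE).
by rewrite setTI.
Qed.

(** The removed point varies, so the mass is written as the integral of a jointly
measurable indicator. *)
Lemma measurable_removed_mass (A : set ST) : measurable A ->
  measurable_fun setT (fun z : config * ST => z.1 (A `\ z.2)).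
Proof.
move=> mA.
pose B := [set zq : (config * ST) * ST | A zq.2] `&`
          [set zq : (config * ST) * ST | zq.2 <> zq.1.2].
have mB : measurable B.
  apply: measurableI.
    rewrite -[X in measurable X]setTI.
    by have /(_ measurableT A mA) := @measurable_snd _ _ (config * ST)%type ST.
  by apply: measurable_st_neq => //; exact: measurableT_comp.
have -> : (fun z : config * ST => z.1 (A `\ z.2)) =
    (fun z => \int[z.1]_q (\1_B (z, q))%:E).
  apply/funext => z.
  have -> : (fun q => (\1_B (z, q))%:E) = (fun q => (\1_(A `\ z.2) q)%:E) :> (ST -> \bar R).
    by apply/funext => q; congr (_%:E); apply: indic_iff.
  rewrite integral_indic ?setIT//; apply: measurableD => //.
  exact: measurable_st_set1.
apply: (measurable_integral_configuration (W := fst) _ (h := fun zq => (\1_B zq)%:E)) => //.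
by apply/measurable_EFinP; exact: measurable_indic.
Qed.

Lemma measurable_remove_point :
  measurable_fun setT (fun z : config * ST => remove_point z.1 z.2).
Proof.
apply: measurable_fun_configuration => A mA.
under eq_fun do rewrite remove_pointE//.
exact: measurable_removed_mass.
Qed.

Lemma measurable_slice_mass :
  measurable_fun setT (fun z : config * ST => z.1 (slice z.2.1)).
Proof.
pose B := [set zq : (config * ST) * ST | zq.2.1 = zq.1.2.1].
have mB : measurable B.
  rewrite (_ : B = (fun zq : (config * ST) * ST => zq.2.1 == zq.1.2.1) @^-1` [set true]).
    rewrite -[X in measurable X]setTI; apply: measurable_fun_eqr => //.
    - by apply: measurableT_comp => //; exact: measurable_fst.
    - apply: (measurableT_comp (f := fst)) => //.
      by apply: (measurableT_comp (f := snd)).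
  by apply/seteqP; split => zq /= /eqP.
have -> : (fun z : config * ST => z.1 (slice z.2.1)) =
    (fun z => \int[z.1]_q (\1_B (z, q))%:E).
  apply/funext => z.
  have -> : (fun q => (\1_B (z, q))%:E) = (fun q => (\1_(slice z.2.1) q)%:E) :> (ST -> \bar R).
    by apply/funext => q; congr (_%:E); apply: indic_iff; split => [|[]].
  by rewrite integral_indic ?setIT//; exact: measurable_slice.
apply: (measurable_integral_configuration (W := fst) _ (h := fun zq => (\1_B zq)%:E)) => //.
by apply/measurable_EFinP; exact: measurable_indic.
Qed.

(** The mass of the time slice through the added point is again the integral of a
jointly measurable indicator. *)
Lemma measurable_addable : measurable [set z : config * ST | addable z.1 z.2].
Proof.
rewrite (_ : [set z | _] = (snd @^-1` window E T) `&`
  (((fun z : config * ST => z.2.1) @^-1` ~` [set 0%R]) `&`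
   ((fun z : config * ST => z.1 (slice z.2.1)) @^-1` [set 0]))).
  apply: measurableI; last apply: measurableI.
  - rewrite -[X in measurable X]setTI.
    by apply: measurable_snd => //; exact: measurable_window.
  - rewrite -[X in measurable X]setTI.
    have : measurable_fun setT (fun z : config * ST => z.2.1).
      exact: measurableT_comp.
    by apply => //; exact: measurableC.
  - by rewrite -[X in measurable X]setTI; exact: measurable_slice_mass.
apply/seteqP; split => z /=.
  by move=> [Wz /eqP z0 wz].
by move=> [Wz [/eqP z0 wz]].
Qed.

Lemma measurable_add_point :
  measurable_fun setT (fun z : config * ST => add_point z.1 z.2).
Proof.
apply: measurable_fun_configuration => A mA.
pose B := [set z : config * ST | addable z.1 z.2] `&` (snd @^-1` A).
have mB : measurable B.
  apply: measurableI; first exact: measurable_addable.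
  by rewrite -[X in measurable X]setTI; exact: measurable_snd.
rewrite (_ : (fun z => _) = (fun z : config * ST => z.1 A + (\1_B z)%:E)).
  apply: emeasurable_funD.
    by apply: (measurableT_comp (measurable_evaluation mA)).
  by apply/measurable_EFinP; exact: measurable_indic.
apply/funext => z; have [az|naz] := pselect (addable z.1 z.2); last first.
  by rewrite add_point_id// indicE memNset ?adde0// => -[].
rewrite add_pointE// /dirac; congr (_ + _%:E).
by apply: indic_iff; split => [|[]].
Qed.

Lemma measurable_add_point_comp d (Z : measurableType d) (W : Z -> config)
    (p : Z -> ST) : measurable_fun setT W -> measurable_fun setT p ->
  measurable_fun setT (fun z => add_point (W z) (p z)).
Proof.
move=> mW mp.
exact: (measurableT_comp measurable_add_point (measurable_fun_pair mW mp)).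
Qed.

Lemma measurable_remove_point_comp d (Z : measurableType d) (W : Z -> config)
    (p : Z -> ST) : measurable_fun setT W -> measurable_fun setT p ->
  measurable_fun setT (fun z => remove_point (W z) (p z)).
Proof.
move=> mW mp.
exact: (measurableT_comp measurable_remove_point (measurable_fun_pair mW mp)).
Qed.

End configuration_measurability.

(** * Nonnegative measurable functions *)

Section nonneg_measurable.
Context d (Z : measurableType d) {R : realType}.
Local Open Scope ereal_scope.

Definition nnm (F : Z -> \bar R) := measurable_fun setT F /\ forall z, 0 <= F z.

Implicit Types F G : Z -> \bar R.

Lemma nnm_m F : nnm F -> measurable_fun setT F. Proof. by case. Qed.

Lemma nnm_ge0 F z : nnm F -> 0 <= F z. Proof. by case. Qed.

Lemma nnmD F G : nnm F -> nnm G -> nnm (fun z => F z + G z).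
Proof.
move=> [mF F0] [mG G0]; split; first exact: emeasurable_funD.
by move=> z; exact: adde_ge0.
Qed.

Lemma nnmM F G : nnm F -> nnm G -> nnm (fun z => F z * G z).
Proof.
move=> [mF F0] [mG G0]; split; first exact: emeasurable_funM.
by move=> z; exact: mule_ge0.
Qed.

Lemma nnm_cst (c : \bar R) : 0 <= c -> nnm (fun=> c).
Proof. by move=> c0; split => //; exact: measurable_cst. Qed.

Lemma nnmZ (c : \bar R) F : 0 <= c -> nnm F -> nnm (fun z => c * F z).
Proof. by move=> c0 nF; apply: nnmM => //; exact: nnm_cst. Qed.

Lemma nnm_indic (A : set Z) : measurable A -> nnm (fun z => (\1_A z)%:E).
Proof.
move=> mA; split; first by apply/measurable_EFinP; exact: measurable_indic.
by move=> z; rewrite lee_fin.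
Qed.

Lemma nnm_EFin (f : Z -> R) : measurable_fun setT f -> (forall z, (0 <= f z)%R) ->
  nnm (fun z => (f z)%:E).
Proof. by move=> mf f0; split => [|z]; [exact/measurable_EFinP | rewrite lee_fin]. Qed.

Lemma nnm_series (F : nat -> Z -> \bar R) : (forall i, nnm (F i)) ->
  nnm (fun z => \sum_(i <oo) F i z).
Proof.
move=> nF; split.
  by apply: ge0_emeasurable_sum => [k z _ _|k _];
    [exact: nnm_ge0 | exact: nnm_m].
by move=> z; apply: nneseries_ge0 => n _ _; exact: nnm_ge0.
Qed.

Lemma nnm_sum (I : Type) (s : seq I) (F : I -> Z -> \bar R) : (forall i, nnm (F i)) ->
  nnm (fun z => \sum_(i <- s) F i z).
Proof.
move=> nF; split; first by apply: emeasurable_sum => i; exact: nnm_m.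
by move=> z; apply: sume_ge0 => i _; exact: nnm_ge0.
Qed.

End nonneg_measurable.

Lemma nnm_comp d d' (Z : measurableType d) (Y : measurableType d') (R : realType)
    (h : Y -> Z) (F : Z -> \bar R) :
  measurable_fun setT h -> nnm F -> nnm (F \o h).
Proof. by move=> mh [mF F0]; split => [|z]; [exact: measurableT_comp | exact: F0]. Qed.

Lemma nnm_integral d d' (Z : measurableType d) (Y : measurableType d') (R : realType)
    (m : {sigma_finite_measure set Y -> \bar R}) (H : Z * Y -> \bar R) :
  nnm H -> nnm (fun z => \int[m]_y H (z, y))%E.
Proof.
move=> [mH H0]; split; first exact: measurable_fun_fubini_tonelli_F.
by move=> z; apply: integral_ge0 => y _; exact: H0.
Qed.

(** * Integrating over an added point *)

Section adding_points.
Context {R : realType} (E : completeMetricType R) (T : R).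
Hypothesis sE : separable E.
Local Open Scope ereal_scope.
Local Notation ST := (space_time R E).
Local Notation config := (configuration E T).
Implicit Types (w : config) (p x y : ST).

Definition empty_config : config := Configuration (mzero_is_configuration E T).

Lemma supp_empty : supp empty_config = set0.
Proof.
apply/seteqP; split => p // /(_ setT openT Logic.I).
by rewrite /= /mzero ltxx.
Qed.

Lemma addableP w y : addable w y <->
  [/\ window E T y, y.1 != 0%R & forall p, supp w p -> p.1 != y.1].
Proof. by split=> -[Wy y0] /(measure_slice0 sE). Qed.

Lemma addable_add w x y : addable w x ->
  addable (add_point w x) y <-> addable w y /\ x.1 <> y.1.
Proof.
move=> wx; split=> [/addableP|[/addableP[Wy y0 h] xy]].
  rewrite (supp_add_point sE wx) => -[Wy y0 h].
  split; first by apply/addableP; split => // p wp; apply: h; right.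
  by apply/eqP; apply: (h x); left.
apply/addableP; rewrite (supp_add_point sE wx).
by split => // p [->|/h//]; exact/eqP.
Qed.

Lemma add_pointC w x y : addable w x -> addable w y -> x.1 <> y.1 ->
  weq (add_point (add_point w x) y) (add_point (add_point w y) x).
Proof.
move=> wx wy xy A mA.
have wxy : addable (add_point w x) y by apply/addable_add.
have wyx : addable (add_point w y) x.
  by apply/addable_add => //; split => //; exact/nesym.
by rewrite !add_pointE// addeAC.
Qed.

Lemma remove_add_point w x : addable w x -> weq (remove_point (add_point w x) x) w.
Proof.
move=> wx A mA; rewrite remove_pointE// add_pointE//; last first.
  by apply: measurableD => //; exact: measurable_st_set1.
rewrite diracE memNset ?adde0; last by move=> [_]; apply.
rewrite (measureD1 sE w x mA) asboolF ?adde0//.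
exact: (addable_supp sE).
Qed.

Lemma supp_remove_point w x : supp w x -> supp (remove_point w x) = supp w `\ x.
Proof.
move=> wx; apply/seteqP; split => y.
  move=> /(suppP sE); rewrite remove_pointE//; last exact: (measurable_st_set1 y sE).
  have [->|yx] := pselect (y = x).
    by rewrite setDv measure0 => /esym/eqP; rewrite onee_eq0.
  move=> wy; split => //; apply/(suppP sE); rewrite -wy; congr (w _).
  by apply/seteqP; split => [q ->|q []//]; split.
move=> [wy yx]; apply/(suppP sE).
rewrite remove_pointE//; last exact: (measurable_st_set1 y sE).
rewrite -((suppP sE w y).1 wy); congr (w _).
by apply/seteqP; split => [q []//|q ->]; split.
Qed.

Lemma addable_remove w x y : supp w x -> addable w y -> addable (remove_point w x) y.
Proof.
move=> wx [Wy y0 /(measure_slice0 sE) wy]; split => //.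
apply/(measure_slice0 sE) => p; rewrite supp_remove_point// => -[wp _].
exact: wy.
Qed.

Lemma remove_add_pointC w x y : supp w x -> addable w y ->
  weq (remove_point (add_point w y) x) (add_point (remove_point w x) y).
Proof.
move=> wx wy A mA; have mAx : measurable (A `\ x).
  by apply: measurableD => //; exact: measurable_st_set1.
rewrite remove_pointE// !add_pointE//; last exact: addable_remove.
rewrite remove_pointE//; congr (_ + _%:E); apply: indic_iff; split => [[]//|Ay].
by split => // yx; apply: (addable_supp sE wy); rewrite yx.
Qed.

Section operator.
Variable mu : {finite_measure set ST -> \bar R}.
Hypothesis muW : mu (~` window E T) = 0.
Hypothesis mu_slice : forall t : R, mu (slice t) = 0.

(** Only finitely many time slices carry an atom of w, and slices are null sets. *)
Lemma ae_addable w : {ae mu, forall x, addable w x}.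
Proof.
have mS : measurable (~` window E T `|` (slice 0%R `|`
    \bigcup_(p in (supp w : set ST)) slice p.1)).
  apply: measurableU.
    by apply: measurableC; exact: measurable_window.
  apply: measurableU; first exact: measurable_slice.
  apply: fin_bigcup_measurable => [|p _]; first exact: finite_supp.
  exact: measurable_slice.
exists (~` window E T `|` (slice 0%R `|`
    \bigcup_(p in (supp w : set ST)) slice p.1)); split => //.
  apply/eqP; rewrite eq_le measure_ge0 andbT.
  apply: le_trans (measureU2 _ _ _) _.
  - by apply: measurableC; exact: measurable_window.
  - apply: measurableU; first exact: measurable_slice.
    apply: fin_bigcup_measurable => [|p _]; first exact: finite_supp.
    exact: measurable_slice.
  rewrite [X in X + _]muW add0e; apply: le_trans (measureU2 _ _ _) _.
  - exact: measurable_slice.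
  - apply: fin_bigcup_measurable => [|p _]; first exact: finite_supp.
    exact: measurable_slice.
  rewrite [X in X + _]mu_slice add0e.
  apply: le_trans (content_sub_fsum _ (finite_supp sE w) _ _ (@subset_refl _ _)) _.
  - by move=> p _; exact: measurable_slice.
  - apply: fin_bigcup_measurable => [|p _]; first exact: finite_supp.
    exact: measurable_slice.
  by rewrite fsbig1// => p _; exact: mu_slice.
move=> x /= nwx; apply: contrapT => nS; apply: nwx.
have Wx : window E T x by apply: contrapT => nWx; apply: nS; left.
split => //.
- by apply/eqP => x0; apply: nS; right; left; split.
- apply/(measure_slice0 sE) => p wp; apply/eqP => px.
  by apply: nS; right; right; exists p => //; split.
Qed.

Lemma ae_time_neq t : {ae mu, forall x, t <> x.1}.
Proof.
exists (slice t); split; [exact: measurable_slice|exact: mu_slice|].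
by move=> x /= /contrapT tx; split.
Qed.

Definition add_op (f : ST -> R) (F : config -> \bar R) (w : config) : \bar R :=
  \int[mu]_x ((f x)%:E * F (add_point w x)).

Definition weight (f : ST -> R) := measurable_fun setT f /\ forall x, (0 <= f x)%R.

Lemma nnm_add_point d (Z : measurableType d) (H : config * Z -> \bar R) :
  nnm H -> nnm (fun z : (config * Z) * ST => H (add_point z.1.1 z.2, z.1.2)).
Proof.
apply: nnm_comp; apply: measurable_fun_pair.
  by apply: measurable_add_point_comp => //; exact: measurableT_comp.
exact: measurableT_comp.
Qed.

Lemma nnm_add_op_param d (Z : measurableType d) (f : ST -> Z -> R)
    (H : config * Z -> \bar R) :
  measurable_fun setT (fun z : ST * Z => f z.1 z.2) ->
  (forall x o, (0 <= f x o)%R) -> nnm H ->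
  nnm (fun z : config * Z => add_op (f ^~ z.2) (fun w => H (w, z.2)) z.1).
Proof.
move=> mf f0 nH.
apply: (nnm_integral mu (H := fun z : (config * Z) * ST =>
  (f z.2 z.1.2)%:E * H (add_point z.1.1 z.2, z.1.2))).
apply: nnmM; last exact: nnm_add_point.
apply: nnm_EFin => //.
apply: (measurableT_comp mf (g := fun z : (config * Z) * ST => (z.2, z.1.2))).
by apply: measurable_fun_pair => //; exact: measurableT_comp.
Qed.

Lemma nnm_add_op f F : weight f -> nnm F -> nnm (add_op f F).
Proof.
move=> [mf f0] nF.
have : nnm (fun z : config * unit => add_op f F z.1).
  apply: (@nnm_add_op_param _ _ (fun x _ => f x) (F \o fst)) => //.
  - exact: measurableT_comp.
  - exact: nnm_comp.
by move/(nnm_comp (h := fun w => (w, tt))); apply.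
Qed.

Lemma nnm_add_op_integrand f F w : weight f -> nnm F ->
  nnm (fun x => (f x)%:E * F (add_point w x)).
Proof.
move=> [mf f0] nF; apply: nnmM; first exact: nnm_EFin.
apply: (nnm_comp _ nF).
exact: measurable_add_point_comp.
Qed.

Lemma ae_add_op f F G w : weight f -> nnm F -> nnm G ->
  {ae mu, forall x, F (add_point w x) = G (add_point w x)} ->
  add_op f F w = add_op f G w.
Proof.
move=> wf nF nG FG.
have nFi := nnm_add_op_integrand w wf nF.
have nGi := nnm_add_op_integrand w wf nG.
apply: ge0_ae_eq_integral => //; try exact: nnm_m.
- by move=> x _; exact: (nnm_ge0 x nFi).
- by move=> x _; exact: (nnm_ge0 x nGi).
- by apply: filterS FG => x -> _.
Qed.

Lemma ae_le_add_op f g F G w : weight f -> weight g -> nnm F -> nnm G ->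
  {ae mu, forall x, (f x <= g x)%R} ->
  {ae mu, forall x, F (add_point w x) <= G (add_point w x)} ->
  add_op f F w <= add_op g G w.
Proof.
move=> wf wg nF nG fg FG.
have nFi := nnm_add_op_integrand w wf nF.
have nGi := nnm_add_op_integrand w wg nG.
apply: ae_ge0_le_integral => //; try exact: nnm_m.
- by move=> x _; exact: (nnm_ge0 x nFi).
- by move=> x _; exact: (nnm_ge0 x nGi).
- apply: filterS2 fg FG => x fgx FGx _.
  by apply: lee_pmul; rewrite ?lee_fin//; [exact: wf.2|exact: nnm_ge0].
Qed.

Lemma add_opD f F G w : weight f -> nnm F -> nnm G ->
  add_op f (fun w => F w + G w) w = add_op f F w + add_op f G w.
Proof.
move=> wf nF nG.
have nFi := nnm_add_op_integrand w wf nF.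
have nGi := nnm_add_op_integrand w wf nG.
rewrite /add_op -ge0_integralD//; try exact: nnm_m.
- by apply: eq_integral => x _; rewrite ge0_muleDr; try exact: nnm_ge0.
- by move=> x _; exact: (nnm_ge0 x nFi).
- by move=> x _; exact: (nnm_ge0 x nGi).
Qed.

Lemma add_opZ f c F w : weight f -> 0 <= c -> nnm F ->
  add_op f (fun w => c * F w) w = c * add_op f F w.
Proof.
move=> wf c0 nF; have nFi := nnm_add_op_integrand w wf nF.
rewrite /add_op -ge0_integralZl//.
- by apply: eq_integral => x _; rewrite muleCA.
- exact: nnm_m nFi.
- by move=> x _; exact: (nnm_ge0 x nFi).
Qed.

Lemma add_op_series f (F : nat -> config -> \bar R) w : weight f ->
  (forall i, nnm (F i)) ->
  add_op f (fun w => \sum_(i <oo) F i w) w = \sum_(i <oo) add_op f (F i) w.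
Proof.
move=> wf nF; rewrite /add_op -integral_nneseries//.
- apply: eq_integral => x _; rewrite -nneseriesZl// ?lee_fin ?wf.2// => i _.
  exact: nnm_ge0 (nF i).
- by move=> i; exact: nnm_m (nnm_add_op_integrand w wf (nF i)).
- by move=> i x _; exact: nnm_ge0 (nnm_add_op_integrand w wf (nF i)).
Qed.

End operator.
End adding_points.

(** * The exponential series and the formula of Mecke *)

Section exponential_series.
Context {R : realType} (E : completeMetricType R) (T : R).
Hypothesis sE : separable E.
Local Open Scope ereal_scope.
Local Notation ST := (space_time R E).
Local Notation config := (configuration E T).
Implicit Types (w : config) (p x y : ST).
Variable mu : {finite_measure set ST -> \bar R}.
Hypothesis muW : mu (~` window E T) = 0.
Hypothesis mu_slice : forall t : R, mu (slice t) = 0.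

Local Notation K := (@add_op R E T mu).

Definition iter_add (f : ST -> R) n (F : config -> \bar R) : config -> \bar R :=
  iter n (K f) F.

Lemma iter_addS f n F : iter_add f n.+1 F = K f (iter_add f n F).
Proof. by []. Qed.

Lemma nnm_iter_add f n F : weight f -> nnm F -> nnm (iter_add f n F).
Proof. by move=> wf nF; elim: n => //= n ih; exact: nnm_add_op. Qed.

Lemma nnm_iter_add_param d (Z : measurableType d) (f : ST -> Z -> R) n
    (H : config * Z -> \bar R) :
  measurable_fun setT (fun z : ST * Z => f z.1 z.2) ->
  (forall x o, (0 <= f x o)%R) -> nnm H ->
  nnm (fun z : config * Z => iter_add (f ^~ z.2) n (fun w => H (w, z.2)) z.1).
Proof.
move=> mf f0 nH; elim: n => [|n ih] /=.
  by move: nH; congr nnm; apply/funext => -[].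
exact: (nnm_add_op_param sE mu mf f0 ih).
Qed.

Lemma iter_addD f n F G w : weight f -> nnm F -> nnm G ->
  iter_add f n (fun w => F w + G w) w = iter_add f n F w + iter_add f n G w.
Proof.
move=> wf nF nG; elim: n w => //= n ih w.
rewrite -add_opD//; try exact: nnm_iter_add.
by congr (K f _ w); apply/funext => v; exact: ih.
Qed.

Lemma iter_addZ f n c F w : weight f -> 0 <= c -> nnm F ->
  iter_add f n (fun w => c * F w) w = c * iter_add f n F w.
Proof.
move=> wf c0 nF; elim: n w => //= n ih w.
rewrite -add_opZ//; last exact: nnm_iter_add.
by congr (K f _ w); apply/funext => v; exact: ih.
Qed.

Lemma iter_add_series f n (F : nat -> config -> \bar R) w : weight f ->
  (forall i, nnm (F i)) ->
  iter_add f n (fun w => \sum_(i <oo) F i w) w = \sum_(i <oo) iter_add f n (F i) w.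
Proof.
move=> wf nF; elim: n w => //= n ih w.
rewrite -add_op_series//; last by move=> i; exact: nnm_iter_add.
by congr (K f _ w); apply/funext => v; exact: ih.
Qed.

Lemma iter_add_le f g n F G w : weight f -> weight g -> nnm F -> nnm G ->
  {ae mu, forall x, (f x <= g x)%R} -> (forall w, F w <= G w) ->
  iter_add f n F w <= iter_add g n G w.
Proof.
move=> wf wg nF nG fg FG; elim: n w => [w|n ih w]; first exact: FG.
have nFn := nnm_iter_add n wf nF; have nGn := nnm_iter_add n wg nG.
exact: (ae_le_add_op sE wf wg nFn nGn fg (aeW mu (fun x => ih (add_point w x)))).
Qed.

Lemma iter_add_ae f n F G (Q : config -> Prop) w : weight f -> nnm F -> nnm G ->
  (forall w, Q w -> {ae mu, forall x, Q (add_point w x)}) ->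
  (forall w, Q w -> F w = G w) -> Q w ->
  iter_add f n F w = iter_add f n G w.
Proof.
move=> wf nF nG Qadd FG; elim: n w => [w /FG//|n ih w Qw] /=.
apply: ae_add_op => //; try exact: nnm_iter_add.
by apply: filterS (Qadd _ Qw) => x; exact: ih.
Qed.

Lemma iter_add_cst f n c w : weight f -> 0 <= c ->
  iter_add f n (fun=> c) w = c * (\int[mu]_x (f x)%:E) ^+ n.
Proof.
move=> wf c0; elim: n w => [w|n ih w]; first by rewrite expe0 mule1.
rewrite iter_addS (_ : iter_add _ _ _ = fun=> c * (\int[mu]_x (f x)%:E) ^+ n); last first.
  by apply/funext.
rewrite /add_op ge0_integralZr//.
- by rewrite muleCA -expeS.
- by apply/measurable_EFinP; exact: wf.1.
- by move=> x _; rewrite lee_fin wf.2.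
- by rewrite mule_ge0// expe_ge0// integral_ge0// => x _; rewrite lee_fin wf.2.
Qed.

(** Up to the factor exp (- int f), the mean of F for the Poisson process of
intensity f on the window: the n-th term is the contribution of the
configurations with n points. *)
Definition exp_add (f : ST -> R) (F : config -> \bar R) : \bar R :=
  \sum_(n <oo) (n`!%:R^-1)%:E * iter_add f n F (empty_config E T).

Let invf_ge0 n : 0 <= (n`!%:R^-1)%:E :> \bar R.
Proof. by rewrite lee_fin invr_ge0. Qed.

Lemma exp_add_ge0 f F : weight f -> nnm F -> 0 <= exp_add f F.
Proof.
move=> wf nF; apply: nneseries_ge0 => n _ _; rewrite mule_ge0//.
exact: nnm_ge0 (nnm_iter_add n wf nF).
Qed.

Lemma exp_add_le f g F G : weight f -> weight g -> nnm F -> nnm G ->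
  {ae mu, forall x, (f x <= g x)%R} -> (forall w, F w <= G w) ->
  exp_add f F <= exp_add g G.
Proof.
move=> wf wg nF nG fg FG; apply: lee_nneseries => [n _ _|n _].
  by rewrite mule_ge0// (nnm_ge0 _ (nnm_iter_add n wf nF)).
by rewrite lee_wpmul2l//; exact: iter_add_le.
Qed.

Lemma exp_addD f F G : weight f -> nnm F -> nnm G ->
  exp_add f (fun w => F w + G w) = exp_add f F + exp_add f G.
Proof.
move=> wf nF nG; rewrite /exp_add -nneseriesD//.
- apply: eq_eseriesr => n _; rewrite iter_addD// ge0_muleDr//.
  + exact: nnm_ge0 (nnm_iter_add n wf nF).
  + exact: nnm_ge0 (nnm_iter_add n wf nG).
- by move=> n _ _; rewrite mule_ge0// (nnm_ge0 _ (nnm_iter_add n wf nF)).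
- by move=> n _ _; rewrite mule_ge0// (nnm_ge0 _ (nnm_iter_add n wf nG)).
Qed.

Lemma exp_addZ f (c : R) F : weight f -> (0 <= c)%R -> nnm F ->
  exp_add f (fun w => c%:E * F w) = c%:E * exp_add f F.
Proof.
move=> wf c0 nF; rewrite /exp_add -nneseriesZl//.
- by apply: eq_eseriesr => n _; rewrite iter_addZ// muleCA.
- by move=> n _; rewrite mule_ge0// (nnm_ge0 _ (nnm_iter_add n wf nF)).
Qed.

Lemma exp_add_series f (F : nat -> config -> \bar R) : weight f ->
  (forall i, nnm (F i)) ->
  exp_add f (fun w => \sum_(i <oo) F i w) = \sum_(i <oo) exp_add f (F i).
Proof.
move=> wf nF; rewrite /exp_add nneseries_interchange; last first.
  by move=> i j; rewrite mule_ge0// (nnm_ge0 _ (nnm_iter_add _ wf (nF _))).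
apply: eq_eseriesr => n _; rewrite iter_add_series// nneseriesZl//.
by move=> i _; exact: nnm_ge0 (nnm_iter_add n wf (nF i)).
Qed.

(** The series only meets configurations built from the empty one by adding points,
so a property kept by almost every addition may be assumed. It serves to stay
where the likelihood is finite. *)
Lemma exp_add_ae f F G (Q : config -> Prop) : weight f -> nnm F -> nnm G ->
  (forall w, Q w -> {ae mu, forall x, Q (add_point w x)}) ->
  (forall w, Q w -> F w = G w) -> Q (empty_config E T) ->
  exp_add f F = exp_add f G.
Proof.
move=> wf nF nG Qadd FG Q0; apply: eq_eseriesr => n _.
by rewrite (iter_add_ae n wf nF nG Qadd FG Q0).
Qed.

Section mecke.

Definition nnm_field (X : ST -> config -> \bar R) :=
  nnm (fun z : config * ST => X z.2 z.1).

Definition atom_sum (X : ST -> config -> \bar R) w : \bar R :=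
  \int[w]_p X p (remove_point w p).

Definition field_integral (X : ST -> config -> \bar R) w : \bar R :=
  \int[mu]_p X p w.

Definition add_op_field (X : ST -> config -> \bar R) p : config -> \bar R :=
  K (fun=> 1%R) (X p).

Let w1 : @weight R E (fun=> 1%R).
Proof. by split => //; exact: measurable_cst. Qed.

Lemma nnm_field_at X p : nnm_field X -> nnm (X p).
Proof. by move/(nnm_comp (pair2_measurable p)). Qed.

Lemma nnm_field_atom X : nnm_field X ->
  nnm (fun z : config * ST => X z.2 (remove_point z.1 z.2)).
Proof.
move/(nnm_comp (h := fun z : config * ST => (remove_point z.1 z.2, z.2))); apply.
by apply: measurable_fun_pair => //; exact: measurable_remove_point_comp.
Qed.

Lemma nnm_atom_sum X : nnm_field X -> nnm (atom_sum X).
Proof.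
move=> /nnm_field_atom[mX X0]; split.
  apply: (measurable_integral_configuration (W := id) _
    (h := fun z => X z.2 (remove_point z.1 z.2))) => //.
by move=> w; apply: integral_ge0 => p _; exact: (X0 (w, p)).
Qed.

Lemma nnm_field_integral X : nnm_field X -> nnm (field_integral X).
Proof. by move=> nX; exact: (nnm_integral mu nX). Qed.

Lemma nnm_add_op_field X : nnm_field X -> nnm_field (add_op_field X).
Proof.
move=> nX; apply: (nnm_add_op_param sE mu (f := fun _ _ => 1%R)
  (H := fun z : config * ST => X z.2 z.1)) => //.
Qed.

Lemma atom_sumE X w : nnm_field X ->
  atom_sum X w = \sum_(p \in supp w) X p (remove_point w p).
Proof.
move=> /nnm_field_atom nX.
have [mX X0] := nnm_comp (pair1_measurable w) nX.
by rewrite /atom_sum integral_configuration.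
Qed.

(** The atoms of w + y are y and the atoms of w; removing an atom of w commutes with
adding y. *)
Lemma atom_sum_add X w y : nnm_field X -> addable w y ->
  atom_sum X (add_point w y) =
  X y w + \sum_(p \in supp w) X p (add_point (remove_point w p) y).
Proof.
move=> nX wy; have wyn := addable_supp sE wy.
rewrite atom_sumE// supp_add_point// fsbigU0/=; last 3 first.
- exact: finite_set1.
- exact: finite_supp.
- by move=> p [/= ->].
rewrite fsbig_set1; congr (_ + _).
  apply: (weq_emeasurable (nnm_m (nnm_field_at y nX))).
  exact: remove_add_point.
apply: eq_fsbigr => p; rewrite inE => wp.
apply: (weq_emeasurable (nnm_m (nnm_field_at p nX))).
exact: remove_add_pointC.
Qed.

(** The commutation relation K S = I + S K between the addition K of a point, the
sum S over the atoms and the integral I. *)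
Lemma add_op_atom_sum X w : nnm_field X ->
  K (fun=> 1%R) (atom_sum X) w =
  field_integral X w + atom_sum (add_op_field X) w.
Proof.
move=> nX.
have nXp p : nnm (fun y => X p (add_point (remove_point w p) y)).
  apply: (nnm_comp _ (nnm_field_at p nX)).
  exact: measurable_add_point_comp.
have nXw : nnm (X ^~ w) := nnm_comp (pair1_measurable w) nX.
transitivity (\int[mu]_y (X y w +
    \sum_(p \in supp w) X p (add_point (remove_point w p) y))).
  apply: ge0_ae_eq_integral => //.
  - exact: nnm_m (nnm_add_op_integrand sE w w1 (nnm_atom_sum nX)).
  - apply: emeasurable_funD; first exact: nnm_m.
    by apply: emeasurable_fsum => [|p]; [exact: finite_supp|exact: nnm_m (nXp p)].
  - by move=> y _; exact: nnm_ge0 (nnm_add_op_integrand sE w w1 (nnm_atom_sum nX)).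
  - move=> y _; rewrite adde_ge0 ?(nnm_ge0 _ nXw)//.
    by apply: fsume_ge0 => p _; exact: nnm_ge0 (nXp p).
  - apply: filterS (ae_addable sE muW mu_slice w) => y wy _.
    by rewrite mul1e atom_sum_add.
rewrite ge0_integralD//; last 4 first.
- by move=> y _; exact: nnm_ge0 nXw.
- exact: nnm_m.
- by move=> y _; apply: fsume_ge0 => p _; exact: nnm_ge0 (nXp p).
- by apply: emeasurable_fsum => [|p]; [exact: finite_supp|exact: nnm_m (nXp p)].
congr (_ + _); rewrite ge0_integral_fsum//; last 3 first.
- by move=> p; exact: nnm_m (nXp p).
- by move=> p y _; exact: nnm_ge0 (nXp p).
- exact: finite_supp.
rewrite atom_sumE; last exact: nnm_add_op_field.
apply: eq_fsbigr => p _; apply: eq_integral => y _.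
by rewrite mul1e.
Qed.

Lemma add_op_field_integral X w : nnm_field X ->
  K (fun=> 1%R) (field_integral X) w = field_integral (add_op_field X) w.
Proof.
move=> nX; rewrite /add_op /field_integral /add_op_field /add_op.
transitivity (\int[mu]_x \int[mu]_p X p (add_point w x)).
  by apply: eq_integral => x _; rewrite mul1e.
rewrite (@fubini_tonelli _ _ _ _ _ mu mu (fun z => X z.2 (add_point w z.1)))/=.
- by apply: eq_integral => p _; apply: eq_integral => x _; rewrite mul1e.
- apply: (nnm_m (nnm_comp (h := fun z => (add_point w z.1, z.2)) _ nX)).
  by apply: measurable_fun_pair => //; exact: measurable_add_point_comp.
- by move=> z; exact: (nnm_ge0 (add_point w z.1, z.2) nX).
Qed.

Definition iter_field n (X : ST -> config -> \bar R) := iter n add_op_field X.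

Lemma nnm_iter_field n X : nnm_field X -> nnm_field (iter_field n X).
Proof. by move=> nX; elim: n => //= n ih; exact: nnm_add_op_field. Qed.

Lemma iter_field_integral n X : nnm_field X ->
  iter_add (fun=> 1%R) n (field_integral X) = field_integral (iter_field n X).
Proof.
move=> nX; elim: n => //= n ->; apply/funext => w.
by apply: add_op_field_integral; exact: nnm_iter_field.
Qed.

(** Moving S through n + 1 factors K leaves n + 1 equal commutators, as I commutes
with K. *)
Lemma iter_atom_sum n X w : nnm_field X ->
  iter_add (fun=> 1%R) n.+1 (atom_sum X) w =
  n.+1%:R%:E * iter_add (fun=> 1%R) n (field_integral X) w
  + atom_sum (iter_field n.+1 X) w.
Proof.
move=> nX; elim: n w => [w|n ih w].
  by rewrite /= mul1e add_op_atom_sum.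
rewrite iter_addS.
have -> : iter_add (fun=> 1%R) n.+1 (atom_sum X) = fun w =>
    n.+1%:R%:E * iter_add (fun=> 1%R) n (field_integral X) w
    + atom_sum (iter_field n.+1 X) w by apply/funext.
have nI : nnm (iter_add (fun=> 1%R) n (field_integral X)).
  by apply: nnm_iter_add => //; exact: nnm_field_integral.
rewrite add_opD//; last 2 first.
- by apply: nnmZ => //; rewrite lee_fin.
- by apply: nnm_atom_sum; exact: nnm_iter_field.
rewrite add_opZ// add_op_atom_sum; last exact: nnm_iter_field.
rewrite -iter_field_integral// -iter_addS addeA; congr (_ + _).
rewrite -[X in _ + X]mul1e -ge0_muleDl ?lee_fin//.
by rewrite -EFinD natr1.
Qed.

(** The formula of Mecke for unit intensity. S vanishes at the empty configuration,
so that only the commutators remain in [iter_atom_sum], and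
(n + 1) / (n + 1)! = 1 / n!. *)
Lemma exp_add_atom_sum X : nnm_field X ->
  exp_add (fun=> 1%R) (atom_sum X) = exp_add (fun=> 1%R) (field_integral X).
Proof.
move=> nX.
have sum0 Y : atom_sum Y (empty_config E T) = 0.
  rewrite /atom_sum /empty_config /=.
  exact: integral_measure_zero.
have nS := nnm_atom_sum nX.
rewrite /exp_add nneseries_recl//; last first.
  by move=> n _; rewrite mule_ge0// (nnm_ge0 _ (nnm_iter_add n w1 nS)).
rewrite /= sum0 mule0 add0e -(nneseries_addn 1); last first.
  by move=> n; rewrite mule_ge0// (nnm_ge0 _ (nnm_iter_add _ w1 nS)).
apply: eq_eseriesr => n _; rewrite addn1 iter_atom_sum// sum0 adde0.
rewrite muleA -EFinM; congr (_%:E * _).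
by rewrite factS natrM invfM -mulrAC mulVf ?mul1r// pnatr_eq0.
Qed.

End mecke.
End exponential_series.

(** * Product weights and the change of intensity *)

Section product_weight.
Context {R : realType} (E : completeMetricType R) (T : R).
Hypothesis sE : separable E.
Local Notation ST := (space_time R E).
Local Notation config := (configuration E T).
Implicit Types (w : config) (p x y : ST).

Definition prod_weight (f : ST -> R) (w : config) : R :=
  \big[*%R/1]_(p \in supp w) f p.

Lemma prod_weightE f w : prod_weight f w = \prod_(p <- fset_set (supp w)) f p.
Proof. by rewrite /prod_weight fsbig_finite//; exact: finite_supp. Qed.

Lemma prod_weight_add f w x : addable w x ->
  prod_weight f (add_point w x) = f x * prod_weight f w.
Proof.
move=> wx; have wxn := addable_supp sE wx.
rewrite /prod_weight supp_add_point// fsbigU0/=; last 3 first.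
- exact: finite_set1.
- exact: finite_supp.
- by move=> p [/= ->].
by rewrite fsbig_set1.
Qed.

Lemma prod_weight_empty f : prod_weight f (empty_config E T) = 1.
Proof. by rewrite /prod_weight supp_empty fsbig_set0. Qed.

Lemma prod_weight_ge0 f w : (forall x, 0 <= f x) -> 0 <= prod_weight f w.
Proof. by move=> f0; rewrite prod_weightE; apply: prodr_ge0. Qed.

Lemma eq_prod_weight f g w : (forall x, supp w x -> f x = g x) ->
  prod_weight f w = prod_weight g w.
Proof. by move=> fg; apply: eq_fsbigr => p; rewrite inE => /fg. Qed.

Lemma prod_weight_le f g w : (forall x, 0 <= f x) ->
  (forall x, supp w x -> f x <= g x) -> prod_weight f w <= prod_weight g w.
Proof.
move=> f0 fg; rewrite !prod_weightE big_seq [leRHS]big_seq; apply: ler_prod => p.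
by rewrite in_fset_set ?inE => [/fg ->|]; [rewrite f0|exact: finite_supp].
Qed.

(** Sums over the atoms are integrals against w, hence measurable; products are
reduced to sums by logarithms. The two sums keep the positive and the negative
parts of the logarithms apart, since only nonnegative functions are integrated,
and the zero factors are counted separately. *)
Lemma prod_as_exp (s : seq ST) (f : ST -> R) : (forall p, 0 <= f p) ->
  \prod_(p <- s) f p =
  if \sum_(p <- s) (f p == 0)%:R == 0 :> R then
    expR (\sum_(p <- s) ln (Num.max (f p) 1) - \sum_(p <- s) - ln (Num.min (f p) 1))
  else 0.
Proof.
move=> f0; elim: s => [|p s ih]; first by rewrite !big_nil eqxx subr0 expR0.
rewrite !big_cons ih; have [fp0|fp0] := eqVneq (f p) 0.
  rewrite fp0 mul0r gt_eqF// ltr_pwDl//.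
  by apply: sumr_ge0 => q _; rewrite ler0n.
rewrite add0r; case: ifP => _; last by rewrite mulr0.
have fgt0 : 0 < f p by rewrite lt_neqAle eq_sym fp0 f0.
set A := \sum_(j <- s) _; set B := \sum_(j <- s) _.
have -> a b : a + A - (- b + B) = (a + b) + (A - B) :> R by ring.
rewrite [RHS]expRD; congr (_ * _); have [f1|f1] := leP 1 (f p).
  by rewrite ln1 addr0 lnK.
by rewrite ln1 add0r lnK.
Qed.

Lemma measurable_supp_sum d (Z : measurableType d) (g : ST -> Z -> R) :
  measurable_fun setT (fun z : ST * Z => g z.1 z.2) -> (forall x z, 0 <= g x z) ->
  measurable_fun setT (fun z : config * Z => \sum_(p <- fset_set (supp z.1)) g p z.2).
Proof.
move=> mg g0.
pose h (zp : (config * Z) * ST) : \bar R := (g zp.2 zp.1.2)%:E.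
have nh : nnm h.
  apply: nnm_EFin => //; apply: (measurableT_comp mg (g := fun zp : (config * Z) * ST => (zp.2, zp.1.2))).
  by apply: measurable_fun_pair => //; exact: measurableT_comp.
rewrite (_ : (fun z => _) = fine \o (fun z : config * Z => (\int[z.1]_p h (z, p))%E)).
  apply: measurableT_comp => //.
  exact: (measurable_integral_configuration (W := fst) _ (h := h) nh.2 nh.1).
apply/funext => z /=.
have [mhz hz0] := nnm_comp (pair1_measurable z) nh.
rewrite integral_configuration// fsbig_finite//=; last exact: finite_supp.
by rewrite sumEFin.
Qed.

Lemma nnm_prod_weight_param d (Z : measurableType d) (f : ST -> Z -> R) :
  measurable_fun setT (fun z : ST * Z => f z.1 z.2) -> (forall x z, 0 <= f x z) ->
  nnm (fun z : config * Z => (prod_weight (f ^~ z.2) z.1)%:E).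
Proof.
move=> mf f0; apply: nnm_EFin; last by move=> z; exact: prod_weight_ge0.
have ms0 : measurable_fun setT (fun z : config * Z =>
    \sum_(p <- fset_set (supp z.1)) (f p z.2 == 0)%:R : R).
  apply: (measurable_supp_sum (g := fun p z => (f p z == 0)%:R)) => //.
  rewrite (_ : (fun z => _) = \1_((fun z : ST * Z => f z.1 z.2) @^-1` [set 0])).
    by apply: measurable_indic; rewrite -[X in measurable X]setTI; exact: mf.
  apply/funext => z; rewrite indicE; congr (_%:R); congr nat_of_bool.
  by apply/eqP/idP; rewrite inE.
have ms1 : measurable_fun setT (fun z : config * Z =>
    \sum_(p <- fset_set (supp z.1)) ln (Num.max (f p z.2) 1)).
  apply: (measurable_supp_sum (g := fun p z => ln (Num.max (f p z) 1))).
    apply: (measurableT_comp (@measurable_ln R)); exact: measurable_maxr.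
  by move=> x z; rewrite ln_ge0// le_max lexx orbT.
have ms2 : measurable_fun setT (fun z : config * Z =>
    \sum_(p <- fset_set (supp z.1)) - ln (Num.min (f p z.2) 1)).
  apply: (measurable_supp_sum (g := fun p z => - ln (Num.min (f p z) 1))).
    apply: measurable_funN.
    apply: (measurableT_comp (@measurable_ln R)); exact: measurable_minr.
  by move=> x z; rewrite oppr_ge0 ln_le0// ge_min lexx orbT.
under eq_fun do rewrite prod_weightE prod_as_exp//.
apply: measurable_fun_ifT => //; first exact: measurable_fun_eqr.
apply: (measurableT_comp (@measurable_expR R)).
exact: measurable_funB.
Qed.

Lemma nnm_prod_weight f : weight f -> nnm (fun w => (prod_weight f w)%:E).
Proof.
move=> [mf f0]; have mf' : measurable_fun setT (fun z : ST * unit => f z.1).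
  exact: measurableT_comp.
by have /(nnm_comp (pair2_measurable tt)) := nnm_prod_weight_param mf' (fun x _ => f0 x).
Qed.

Section weighted_series.
Local Open Scope ereal_scope.
Variable mu : {finite_measure set ST -> \bar R}.
Hypothesis muW : mu (~` window E T) = 0.
Hypothesis mu_slice : forall t : R, mu (slice t) = 0.

Lemma weight1 : @weight R E (fun=> 1%R).
Proof. by split => //; exact: measurable_cst. Qed.

(** Adding x multiplies the product weight by f x, so conjugation by this weight
turns the unit intensity into f. *)
Lemma iter_add_weight f n F w : weight f -> nnm F ->
  (prod_weight f w)%:E * iter_add mu f n F w =
  iter_add mu (fun=> 1%R) n (fun w => (prod_weight f w)%:E * F w) w.
Proof.
move=> wf nF; elim: n w => //= n ih w.
have -> : iter_add mu (fun=> 1%R) n (fun w => (prod_weight f w)%:E * F w) =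
    (fun w => (prod_weight f w)%:E * iter_add mu f n F w).
  by apply/funext => v; rewrite ih.
have nI := nnm_iter_add sE mu n wf nF.
have nfi := nnm_add_op_integrand sE w wf nI.
have pw0 : 0 <= (prod_weight f w)%:E by rewrite lee_fin prod_weight_ge0//; exact: wf.2.
have nP := nnmM (nnm_prod_weight wf) nI.
rewrite /add_op -ge0_integralZl//; last 2 first.
- exact: nnm_m nfi.
- by move=> x _; exact: nnm_ge0 nfi.
apply: ge0_ae_eq_integral => //.
- exact: nnm_m (nnmZ pw0 nfi).
- exact: nnm_m (nnm_add_op_integrand sE w weight1 nP).
- by move=> x _; exact: nnm_ge0 (nnmZ pw0 nfi).
- by move=> x _; exact: nnm_ge0 (nnm_add_op_integrand sE w weight1 nP).
- apply: filterS (ae_addable sE muW mu_slice w) => x wx _.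
  by rewrite mul1e prod_weight_add// EFinM muleCA muleA.
Qed.

(** The density of a Poisson process with respect to the unit intensity. *)
Lemma exp_add_weight f F : weight f -> nnm F ->
  exp_add mu f F = exp_add mu (fun=> 1%R) (fun w => (prod_weight f w)%:E * F w).
Proof.
move=> wf nF; apply: eq_eseriesr => n _; congr (_ * _).
by rewrite -iter_add_weight// prod_weight_empty mul1e.
Qed.

Lemma iter_add_integral d (Z : measurableType d) (P : {finite_measure set Z -> \bar R}) n
    (H : config * Z -> \bar R) w : nnm H ->
  iter_add mu (fun=> 1%R) n (fun w => \int[P]_o H (w, o)) w =
  \int[P]_o iter_add mu (fun=> 1%R) n (fun w => H (w, o)) w.
Proof.
move=> nH; elim: n w => //= n ih w.
transitivity (add_op mu (fun=> 1%R)
    (fun w => \int[P]_o iter_add mu (fun=> 1%R) n (fun w => H (w, o)) w) w).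
  by congr (add_op _ _ _ _); apply/funext => v; exact: ih.
have nI : nnm (fun z : config * Z => iter_add mu (fun=> 1%R) n (fun w => H (w, z.2)) z.1).
  exact: (nnm_iter_add_param sE mu n (f := fun _ _ => 1%R)).
rewrite /add_op.
transitivity (\int[mu]_x \int[P]_o
    iter_add mu (fun=> 1%R) n (fun w => H (w, o)) (add_point w x)).
  by apply: eq_integral => x _; rewrite mul1e.
have nIx : nnm (fun z : ST * Z =>
    iter_add mu (fun=> 1%R) n (fun w => H (w, z.2)) (add_point w z.1)).
  apply: (nnm_comp (h := fun z : ST * Z => (add_point w z.1, z.2)) _ nI).
  by apply: measurable_fun_pair => //; exact: measurable_add_point_comp.
rewrite (@fubini_tonelli _ _ _ _ _ mu P (fun z =>
    iter_add mu (fun=> 1%R) n (fun w => H (w, z.2)) (add_point w z.1))).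
- by apply: eq_integral => o _; apply: eq_integral => x _; rewrite mul1e.
- exact: nnm_m nIx.
- by move=> z; exact: nnm_ge0 nIx.
Qed.

Lemma exp_add_integral d (Z : measurableType d) (P : {finite_measure set Z -> \bar R})
    (H : config * Z -> \bar R) : nnm H ->
  exp_add mu (fun=> 1%R) (fun w => \int[P]_o H (w, o)) =
  \int[P]_o exp_add mu (fun=> 1%R) (fun w => H (w, o)).
Proof.
move=> nH.
have nI n : nnm (fun o => iter_add mu (fun=> 1%R) n (fun w => H (w, o)) (empty_config E T)).
  exact: nnm_comp (pair1_measurable (empty_config E T))
    (nnm_iter_add_param sE mu n (f := fun _ _ => 1%R) (measurable_cst _) (fun _ _ => ler01) nH).
have c0 n : 0 <= (n`!%:R^-1)%:E :> \bar R by rewrite lee_fin invr_ge0.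
rewrite /exp_add integral_nneseries//.
- apply: eq_eseriesr => n _; rewrite ge0_integralZl//.
  + by rewrite iter_add_integral.
  + exact: nnm_m (nI n).
  + by move=> o _; exact: nnm_ge0 (nI n).
- by move=> n; exact: nnm_m (nnmZ (c0 n) (nI n)).
- by move=> n o _; exact: nnm_ge0 (nnmZ (c0 n) (nI n)).
Qed.

Lemma nnm_exp_add_param d (Z : measurableType d) (f : ST -> Z -> R)
    (H : config * Z -> \bar R) :
  measurable_fun setT (fun z : ST * Z => f z.1 z.2) ->
  (forall x o, (0 <= f x o)%R) -> nnm H ->
  nnm (fun o => exp_add mu (f ^~ o) (fun w => H (w, o))).
Proof.
move=> mf f0 nH; apply: nnm_series => n; apply: nnmZ; first by rewrite lee_fin invr_ge0.
exact: nnm_comp (pair1_measurable (empty_config E T)) (nnm_iter_add_param sE mu n mf f0 nH).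
Qed.

(** Written under the unit intensity, the series no longer depends on o, and may be
exchanged with the integral over o. *)
Lemma exp_add_mixture d (Z : measurableType d) (P : {finite_measure set Z -> \bar R})
    (f : ST -> Z -> R) (c : Z -> \bar R) (H : config * Z -> \bar R) :
  measurable_fun setT (fun z : ST * Z => f z.1 z.2) ->
  (forall x o, (0 <= f x o)%R) -> nnm c -> (forall o, c o \is a fin_num) -> nnm H ->
  \int[P]_o (c o * exp_add mu (f ^~ o) (fun w => H (w, o))) =
  exp_add mu (fun=> 1%R) (fun w => \int[P]_o (c o * (prod_weight (f ^~ o) w)%:E * H (w, o))).
Proof.
move=> mf f0 nc cfin nH.
have wf o : weight (f ^~ o) by split => //; exact: measurable_fun_pair1 mf.
have nHo o : nnm (fun w => H (w, o)) := nnm_comp (pair2_measurable o) nH.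
have nG : nnm (fun z : config * Z => c z.2 * (prod_weight (f ^~ z.2) z.1)%:E * H z).
  apply: nnmM => //; apply: nnmM; last exact: nnm_prod_weight_param.
  exact: nnm_comp nc.
rewrite (exp_add_integral P nG); apply: eq_integral => o _.
rewrite exp_add_weight// -(fineK (cfin o)) -exp_addZ//.
- by congr exp_add; apply/funext => w; rewrite muleA.
- exact: fine_ge0 (nnm_ge0 o nc).
- by apply: nnmM => //; exact: nnm_prod_weight.
Qed.

End weighted_series.
End product_weight.

(** * Integrals of bounded functions against a weight *)

Section weighted_integral.
Context d (X : measurableType d) {R : realType} (mu : {measure set X -> \bar R}).

Definition bounded_measurable (g : X -> R) :=
  measurable_fun setT g /\ exists M, forall x, `|g x| <= M.

Local Notation bdd := bounded_measurable.

Lemma bdd_cst c : bdd (fun=> c).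
Proof. by split; [exact: measurable_cst | exists `|c|]. Qed.

Lemma bddD g1 g2 : bdd g1 -> bdd g2 -> bdd (fun x => g1 x + g2 x).
Proof.
move=> [m1 [M1 b1]] [m2 [M2 b2]]; split; first exact: measurable_funD.
by exists (M1 + M2) => x; rewrite (le_trans (ler_normD _ _))// lerD.
Qed.

Lemma bddM g1 g2 : bdd g1 -> bdd g2 -> bdd (fun x => g1 x * g2 x).
Proof.
move=> [m1 [M1 b1]] [m2 [M2 b2]]; split; first exact: measurable_funM.
by exists (M1 * M2) => x; rewrite normrM ler_pM.
Qed.

Lemma bddZ c g : bdd g -> bdd (fun x => c * g x).
Proof. by move=> bg; apply: bddM => //; exact: bdd_cst. Qed.

Lemma bddB g1 g2 : bdd g1 -> bdd g2 -> bdd (fun x => g1 x - g2 x).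
Proof.
move=> b1 b2; have := bddD b1 (bddZ (-1) b2).
by congr bdd; apply/funext => x; rewrite mulN1r.
Qed.

Lemma bddX2 g : bdd g -> bdd (fun x => g x ^+ 2).
Proof. by move=> bg; exact: (bddM bg bg). Qed.

Lemma bdd_max g1 g2 : bdd g1 -> bdd g2 -> bdd (fun x => Num.max (g1 x) (g2 x)).
Proof.
move=> [m1 [M1 b1]] [m2 [M2 b2]]; split; first exact: measurable_maxr.
exists (Num.max M1 M2) => x; rewrite le_max.
by have [_|_] := leP (g1 x) (g2 x); rewrite ?b1 ?b2 ?orbT.
Qed.

Lemma bdd_sum (I : Type) (s : seq I) (g : I -> X -> R) :
  (forall i, bdd (g i)) -> bdd (fun x => \sum_(i <- s) g i x).
Proof.
move=> bg; elim: s => [|i s ih].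
  by under eq_fun do rewrite big_nil; exact: bdd_cst.
by under eq_fun do rewrite big_cons; exact: bddD.
Qed.

Variable f : X -> R.
Hypothesis mf : measurable_fun setT f.
Hypothesis f0 : forall x, 0 <= f x.
Hypothesis f_int : mu.-integrable setT (EFin \o f).

Definition wint (g : X -> R) : R := \int[mu]_x (f x * g x).

Lemma wint_integrable g : bdd g -> mu.-integrable setT (EFin \o (fun x => f x * g x)).
Proof.
move=> [mg [M gM]]; have M0 : 0 <= M by exact: le_trans (gM point).
have := integrableZl measurableT M f_int; apply: le_integrable => //.
- by apply/measurable_EFinP; exact: measurable_funM.
- move=> x _ /=; rewrite lee_fin !normrM (ger0_norm M0) mulrC.
  by rewrite ler_wpM2r.
Qed.

Lemma EFin_wint g : bdd g -> (wint g)%:E = (\int[mu]_x ((f x)%:E * (g x)%:E))%E.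
Proof.
move=> bg; rewrite /wint /Rintegral fineK//.
exact/integrable_fin_num/wint_integrable.
Qed.

Lemma wintD g1 g2 : bdd g1 -> bdd g2 -> wint (fun x => g1 x + g2 x) = wint g1 + wint g2.
Proof.
move=> b1 b2; rewrite /wint -RintegralD//; try exact: wint_integrable.
by apply: eq_Rintegral => x _; rewrite mulrDr.
Qed.

Lemma wintZ c g : bdd g -> wint (fun x => c * g x) = c * wint g.
Proof.
move=> bg; rewrite /wint -RintegralZl//; last exact: wint_integrable.
by apply: eq_Rintegral => x _; rewrite mulrCA.
Qed.

Lemma wintB g1 g2 : bdd g1 -> bdd g2 -> wint (fun x => g1 x - g2 x) = wint g1 - wint g2.
Proof.
move=> b1 b2; rewrite -[- wint g2]mulN1r -wintZ// -wintD//; last exact: bddZ.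
by congr wint; apply/funext => x; rewrite mulN1r.
Qed.

Lemma wint_ge0 g : (forall x, 0 <= g x) -> 0 <= wint g.
Proof. by move=> g0; apply: Rintegral_ge0 => x _; rewrite mulr_ge0. Qed.

Lemma wint_le g1 g2 : bdd g1 -> bdd g2 -> (forall x, g1 x <= g2 x) -> wint g1 <= wint g2.
Proof.
move=> b1 b2 g12; rewrite -subr_ge0 -wintB//; apply: wint_ge0 => x.
by rewrite subr_ge0.
Qed.

Lemma wint_cst c : wint (fun=> c) = c * wint (fun=> 1).
Proof. by rewrite -wintZ ?mulr1//; exact: bdd_cst. Qed.

Lemma wint_sum (I : Type) (s : seq I) (g : I -> X -> R) : (forall i, bdd (g i)) ->
  wint (fun x => \sum_(i <- s) g i x) = \sum_(i <- s) wint (g i).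
Proof.
move=> bg; elim: s => [|i s ih].
  rewrite big_nil -[RHS](mul0r (wint (fun=> 1))) -wint_cst.
  by congr wint; apply/funext => x; rewrite big_nil.
rewrite big_cons -ih -wintD//; last exact: bdd_sum.
by congr wint; apply/funext => x; rewrite big_cons.
Qed.

Lemma wint_ae g1 g2 : bdd g1 -> bdd g2 -> {ae mu, forall x, g1 x = g2 x} ->
  wint g1 = wint g2.
Proof.
move=> b1 b2 g12; apply: EFin_inj; rewrite !EFin_wint//.
apply: ae_eq_integral => //.
- by apply: emeasurable_funM; apply/measurable_EFinP => //; case: b1.
- by apply: emeasurable_funM; apply/measurable_EFinP => //; case: b2.
- by apply: filterS g12 => x -> _.
Qed.

Lemma wint_ae_le g1 g2 : bdd g1 -> bdd g2 -> {ae mu, forall x, g1 x <= g2 x} ->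
  wint g1 <= wint g2.
Proof.
move=> b1 b2 g12; rewrite (@wint_ae g2 (fun x => Num.max (g1 x) (g2 x)))//.
- apply: wint_le => // [|x]; last by rewrite le_max lexx.
  exact: bdd_max.
- exact: bdd_max.
- by apply: filterS g12 => x /max_r ->.
Qed.

Lemma wint_sqr_shift g t : bdd g ->
  wint (fun x => (g x - t) ^+ 2) =
  wint (fun x => g x ^+ 2) - 2 * t * wint g + t ^+ 2 * wint (fun=> 1).
Proof.
move=> bg; have b1 := bddX2 bg; have b2 := bddZ (2 * t) bg.
have b3 := bdd_cst (t ^+ 2).
rewrite -wint_cst -(wintZ (2 * t) bg) -wintB// -wintD//; last exact: bddB.
by congr wint; apply/funext => x; ring.
Qed.

(** The quadratic polynomial int f (g - t)^2 in t is nonnegative; its value at the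
quotient of int f g by int f is the claim. When int f = 0 the polynomial is
affine, and its slope has to vanish. *)
Lemma wint_cauchy_schwarz g : bdd g ->
  wint g ^+ 2 <= wint (fun=> 1) * wint (fun x => g x ^+ 2).
Proof.
move=> bg; set L := wint (fun=> 1); set D := wint g; set S := wint _.
have L0 : 0 <= L by apply: wint_ge0.
have h t : 0 <= S - 2 * t * D + t ^+ 2 * L.
  by rewrite -wint_sqr_shift//; apply: wint_ge0 => x; exact: sqr_ge0.
have [L_eq0|L_neq0] := eqVneq L 0.
  have D0 : D = 0.
    apply: contrapT => /eqP D0; have := h ((S + 1) / (2 * D)).
    rewrite L_eq0 mulr0 addr0 (_ : 2 * _ * D = S + 1); last by field.
    by lra.
  by rewrite D0 L_eq0 mul0r expr0n.
have Lgt0 : 0 < L by rewrite lt_neqAle eq_sym L_neq0.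
have := h (D / L); rewrite -(pmulr_rge0 _ Lgt0).
rewrite [X in 0 <= X](_ : _ = L * S - D ^+ 2); first by rewrite subr_ge0.
by field.
Qed.

(** The Jensen inequality for the square and the measure delta + h f mu, of total
mass 1 + h int f. *)
Lemma wint_jensen g a h : bdd g -> 0 <= h ->
  (a + h * wint g) ^+ 2 <=
  (1 + h * wint (fun=> 1)) * (a ^+ 2 + h * wint (fun x => g x ^+ 2)).
Proof.
move=> bg h0; have cs := wint_cauchy_schwarz bg.
have : 0 <= wint (fun x => (g x - a) ^+ 2) by apply: wint_ge0 => x; exact: sqr_ge0.
rewrite wint_sqr_shift//.
set L := wint (fun=> 1) in cs *; set D := wint g in cs *; set S := wint _ in cs *.
move=> sh; rewrite -subr_ge0.
have -> : (1 + h * L) * (a ^+ 2 + h * S) - (a + h * D) ^+ 2 =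
  h * (S - 2 * a * D + a ^+ 2 * L) + h ^+ 2 * (L * S - D ^+ 2) by ring.
by rewrite addr_ge0// mulr_ge0// ?sqr_ge0// subr_ge0.
Qed.

End weighted_integral.

(** * Binomial coefficients and inverse factorials *)

Section binomial_coefficients.
Context {R : realType}.

(** The product of the factors 1 - i / n for i < j is at least 1 minus the sum of the i / n. *)
Lemma ffact_ratio_bounds (n j : nat) : (0 < n)%N -> (j <= n)%N ->
  1 - j%:R ^+ 2 / n%:R <= ((n ^_ j)%:R / n%:R ^+ j : R) <= 1.
Proof.
move=> n0; have nR : 0 < n%:R :> R by rewrite ltr0n.
elim: j => [_|j ih jn].
  by rewrite ffactn0 expr0 divr1 expr0n mul0r subr0 lexx.
have /andP[lo up] := ih (ltnW jn).
set r : R := (n ^_ j)%:R / n%:R ^+ j in lo up.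
have -> : (n ^_ j.+1)%:R / n%:R ^+ j.+1 = r * (1 - j%:R / n%:R) :> R.
  rewrite ffactnSr natrM natrB ?(ltnW jn)// exprSr /r.
  have p0 : n%:R ^+ j != 0 :> R by rewrite expf_neq0// gt_eqF.
  have nn0 : n%:R != 0 :> R by rewrite gt_eqF.
  by move: (n%:R ^+ j) ((n ^_ j)%:R) p0 => a b a0; field; rewrite nn0.
have t0 : 0 <= j%:R / n%:R :> R by rewrite divr_ge0.
have t1 : j%:R / n%:R <= 1 :> R by rewrite ler_pdivrMr// mul1r ler_nat ltnW.
have r0 : 0 <= r by rewrite /r divr_ge0// exprn_ge0.
apply/andP; split; last by rewrite mulr_ile1// ?subr_ge0// gerBl.
have : (1 - j%:R ^+ 2 / n%:R) * (1 - j%:R / n%:R) <= r * (1 - j%:R / n%:R) :> R.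
  by rewrite ler_wpM2r// subr_ge0.
apply: le_trans; rewrite -natr1.
have -> : (j%:R + 1) ^+ 2 / n%:R = j%:R ^+ 2 / n%:R + 2 * (j%:R / n%:R) + n%:R^-1 :> R by ring.
have : 0 <= j%:R ^+ 2 / n%:R * (j%:R / n%:R) :> R by rewrite mulr_ge0// divr_ge0// exprn_ge0.
have : 0 <= n%:R^-1 :> R by rewrite invr_ge0.
set a := j%:R ^+ 2 / n%:R; set b := j%:R / n%:R in t0 *.
by move: t0 => + ? ?; nra.
Qed.

Lemma binomial_ratio_bounds (n j : nat) : (0 < n)%N -> (j <= n)%N ->
  (1 - j%:R ^+ 2 / n%:R) / j`!%:R <= ('C(n, j)%:R / n%:R ^+ j : R) <= j`!%:R^-1.
Proof.
move=> n0 jn; have /andP[lo up] := ffact_ratio_bounds n0 jn.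
have j0 : 0 < j`!%:R :> R by rewrite ltr0n fact_gt0.
have -> : 'C(n, j)%:R / n%:R ^+ j = (n ^_ j)%:R / n%:R ^+ j / j`!%:R :> R.
  rewrite -bin_ffact natrM mulrAC mulfK// gt_eqF//.
by rewrite ler_pM2r ?invr_gt0// lo/= -[leRHS]mul1r ler_pM2r ?invr_gt0.
Qed.

Lemma binomial_shift_sum (n : nat) (b : nat -> R) :
  \sum_(j < n.+1) 'C(n, j)%:R * b j + \sum_(j < n.+1) 'C(n, j)%:R * b j.+1 =
  \sum_(j < n.+2) 'C(n.+1, j)%:R * b j.
Proof.
rewrite [RHS]big_ord_recl/= bin0.
under [in RHS]eq_bigr do rewrite /bump/= add1n binS natrD mulrDl.
rewrite big_split/= addrA; congr (_ + _).
rewrite [in RHS]big_ord_recr/= bin_small// mul0r addr0.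
by rewrite big_ord_recl/= bin0; congr (_ + _).
Qed.

End binomial_coefficients.

(** * A random walk that adds points *)

Section poincare.
Context {R : realType} (E : completeMetricType R) (T : R).
Hypothesis sE : separable E.
Local Notation ST := (space_time R E).
Local Notation config := (configuration E T).
Variable mu : {finite_measure set ST -> \bar R}.
Hypothesis muW : mu (~` window E T) = 0%E.
Hypothesis mu_slice : forall t : R, mu (slice t) = 0%E.
Variable f : ST -> R.
Hypothesis wf : weight f.
Hypothesis f_int : mu.-integrable setT (EFin \o f).

Local Notation I := (wint mu f).
Let L := I (fun=> 1).

Let mf : measurable_fun setT f := wf.1.
Let f0 : forall x, 0 <= f x := wf.2.

Implicit Types (u v : config -> R) (w : config) (x y : ST).

Definition bnn (v : config -> R) := bounded_measurable v /\ forall w, 0 <= v w.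

Lemma bnn_nnm v : bnn v -> nnm (EFin \o v).
Proof. by move=> [[mv _] v0]; exact: nnm_EFin. Qed.

Lemma nnm_bnn v M : nnm (EFin \o v) -> (forall w, v w <= M) -> bnn v.
Proof.
move=> [mv v0] vM; have v0' w : 0 <= v w by rewrite -lee_fin; exact: v0.
split => //; split; first exact/measurable_EFinP.
by exists M => w; rewrite ger0_norm.
Qed.

Lemma bnnD u v : bnn u -> bnn v -> bnn (fun w => u w + v w).
Proof. by move=> [bu u0] [bv v0]; split => [|w]; [exact: bddD|exact: addr_ge0]. Qed.

Lemma bnnZ c v : 0 <= c -> bnn v -> bnn (fun w => c * v w).
Proof. by move=> c0 [bv v0]; split => [|w]; [exact: bddZ|exact: mulr_ge0]. Qed.

Lemma bnnX2 v : bnn v -> bnn (fun w => v w ^+ 2).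
Proof. by move=> [bv v0]; split => [|w]; [exact: bddX2|exact: sqr_ge0]. Qed.

Lemma bnn_bound v : bnn v -> exists M, forall w, v w <= M.
Proof. by move=> [[_ [M vM]] _]; exists M => w; exact: le_trans (ler_norm _) _. Qed.

Lemma bdd_add_point v w : bounded_measurable v -> bounded_measurable (fun x => v (add_point w x)).
Proof.
move=> [mv [M vM]]; split; last by exists M.
by apply: measurableT_comp => //; exact: measurable_add_point_comp.
Qed.

Lemma sqr_difference_le (a b M : R) : 0 <= a -> 0 <= b -> a <= M -> b <= M ->
  (a - b) ^+ 2 <= M ^+ 2.
Proof. by move=> a0 b0 aM bM; nra. Qed.

Definition mean_add (v : config -> R) w : R := I (fun x => v (add_point w x)).

Definition energy (v : config -> R) w : R :=
  I (fun x => (v (add_point w x) - v w) ^+ 2).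

Lemma EFin_mean_add v w : bnn v -> (mean_add v w)%:E = add_op mu f (EFin \o v) w.
Proof. by move=> [bv _]; rewrite EFin_wint//; exact: bdd_add_point. Qed.

Lemma bnn_mean_add v : bnn v -> bnn (mean_add v).
Proof.
move=> bv; have [M vM] := bnn_bound bv; apply: (@nnm_bnn _ (M * L)).
  rewrite (_ : EFin \o _ = add_op mu f (EFin \o v)).
    by apply: nnm_add_op => //; exact: bnn_nnm.
  by apply/funext => w /=; rewrite EFin_mean_add.
move=> w; rewrite -wint_cst//; apply: wint_le => //; last exact: bdd_cst.
by apply: bdd_add_point; case: bv.
Qed.

Lemma bdd_difference v w : bounded_measurable v ->
  bounded_measurable (fun x => v (add_point w x) - v w).
Proof. by move=> bv; apply: bddB; [exact: bdd_add_point|exact: bdd_cst]. Qed.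

Lemma bnn_energy v : bnn v -> bnn (energy v).
Proof.
move=> bv; have [bbv v0] := bv; have [M vM] := bnn_bound bv.
have M0 : 0 <= M by exact: le_trans (v0 point) (vM point).
apply: (@nnm_bnn _ ((M ^+ 2) * L)).
  rewrite (_ : EFin \o _ = fun w => (\int[mu]_x ((f x)%:E *
      ((v (add_point w x) - v w) ^+ 2)%:E))%E); last first.
    by apply/funext => w /=; rewrite EFin_wint//; exact/bddX2/bdd_difference.
  apply: (nnm_integral mu (H := fun z : config * ST => ((f z.2)%:E *
      ((v (add_point z.1 z.2) - v z.1) ^+ 2)%:E)%E)).
  apply: nnmM; first by apply: nnm_EFin => //; exact: measurableT_comp.
  apply: nnm_EFin; last by move=> z; exact: sqr_ge0.
  apply: (measurable_funX 2); apply: measurable_funB.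
    by apply: (measurableT_comp bbv.1); exact: measurable_add_point_comp.
  exact: measurableT_comp bbv.1 _.
move=> w; rewrite -wint_cst//; apply: wint_le => //; last 2 first.
- exact: bdd_cst.
- by move=> x; exact: sqr_difference_le.
- exact/bddX2/bdd_difference.
Qed.

Lemma mean_addD u v w : bnn u -> bnn v ->
  mean_add (fun w => u w + v w) w = mean_add u w + mean_add v w.
Proof. by move=> [bu _] [bv _]; rewrite /mean_add wintD//; exact: bdd_add_point. Qed.

Lemma mean_addZ c v w : bnn v -> mean_add (fun w => c * v w) w = c * mean_add v w.
Proof. by move=> [bv _]; rewrite /mean_add wintZ//; exact: bdd_add_point. Qed.

Lemma mean_add_le u v w : bnn u -> bnn v -> (forall w, u w <= v w) ->
  mean_add u w <= mean_add v w.
Proof. by move=> [bu _] [bv _] uv; apply: wint_le => //; exact: bdd_add_point. Qed.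

Lemma energyE v w : bnn v ->
  energy v w = mean_add (fun w => v w ^+ 2) w - 2 * v w * mean_add v w + v w ^+ 2 * L.
Proof. by move=> [bv _]; rewrite /energy wint_sqr_shift//; exact: bdd_add_point. Qed.

Section step.
Variable h : R.
Hypothesis h0 : 0 <= h.

Let L0 : 0 <= L. Proof. exact: wint_ge0. Qed.

(** Up to the normalization by D = 1 + h L, a step of the walk that adds a point
drawn from f mu with weight h. *)
Definition step_op (v : config -> R) w : R := v w + h * mean_add v w.

Let D := 1 + h * L.

Let D0 : 0 <= D. Proof. by rewrite addr_ge0// mulr_ge0. Qed.

Lemma bnn_step_op v : bnn v -> bnn (step_op v).
Proof. by move=> bv; apply: bnnD => //; apply: bnnZ => //; exact: bnn_mean_add. Qed.

Lemma step_opD u v w : bnn u -> bnn v ->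
  step_op (fun w => u w + v w) w = step_op u w + step_op v w.
Proof. by move=> bu bv; rewrite /step_op mean_addD//; ring. Qed.

Lemma step_opZ c v w : bnn v -> step_op (fun w => c * v w) w = c * step_op v w.
Proof. by move=> bv; rewrite /step_op mean_addZ//; ring. Qed.

Lemma step_op_le u v w : bnn u -> bnn v -> (forall w, u w <= v w) ->
  step_op u w <= step_op v w.
Proof.
by move=> bu bv uv; rewrite /step_op lerD// ler_wpM2l// mean_add_le.
Qed.

(** The difference of the two sides is the square of h (K v - L v), where K adds a
point: the variance of a step is its energy up to a nonnegative term. *)
Lemma step_op_variance v w : bnn v ->
  D * step_op (fun w => v w ^+ 2) w <= step_op v w ^+ 2 + D * h * energy v w.
Proof.
move=> bv; rewrite energyE// /step_op /D -subr_ge0.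
set k1 := mean_add v w; set k2 := mean_add _ w; set a := v w.
rewrite (_ : _ - _ = h ^+ 2 * (k1 - L * a) ^+ 2); last by ring.
by rewrite mulr_ge0// sqr_ge0.
Qed.

Let second_difference v w x y :=
  (v (add_point (add_point w y) x) - v (add_point w y)) ^+ 2.

Let nnm_second_difference v w : bnn v ->
  nnm (fun z : ST * ST => ((f z.2)%:E * (second_difference v w z.1 z.2)%:E)%E).
Proof.
move=> [[mv _] _]; apply: nnmM; first by apply: nnm_EFin => //; exact: measurableT_comp.
apply: nnm_EFin; last by move=> z; exact: sqr_ge0.
apply: (measurable_funX 2); apply: measurable_funB; apply: measurableT_comp => //.
  by do 2 apply: measurable_add_point_comp => //.
exact: measurable_add_point_comp.
Qed.

(** The gradient of a step is the step of the gradient, because the order in which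
two points are added does not matter. The Jensen inequality then bounds its
square, and the Fubini theorem reassembles the energies. *)
Lemma energy_step_op v w : bnn v -> energy (step_op v) w <= D * step_op (energy v) w.
Proof.
move=> bv; have [bbv v0] := bv; have [M vM] := bnn_bound bv.
have M0 : 0 <= M by exact: le_trans (v0 point) (vM point).
have b2add x : bounded_measurable (fun y => v (add_point (add_point w y) x)).
  split; last by case: bbv => _ [B vB]; exists B.
  by apply: (measurableT_comp bbv.1); do 2 apply: measurable_add_point_comp => //.
have bsd x : bounded_measurable (fun y => second_difference v w x y).
  by apply: bddX2; apply: bddB; [exact: b2add | exact: bdd_add_point].
have bsd' y : bounded_measurable (fun x => second_difference v w x y).
  exact/bddX2/bdd_difference.
have sdM x y : second_difference v w x y <= M ^+ 2.
  exact: sqr_difference_le.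
have bJ : bounded_measurable (fun x => I (second_difference v w x)).
  split.
    apply/measurable_EFinP; rewrite (_ : EFin \o _ = fun x =>
      (\int[mu]_y ((f y)%:E * (second_difference v w x y)%:E))%E).
      exact: nnm_m (nnm_integral mu (nnm_second_difference w bv)).
    by apply/funext => x /=; rewrite EFin_wint.
  exists (M ^+ 2 * L) => x; rewrite ger0_norm; last first.
    by apply: wint_ge0 => // y; exact: sqr_ge0.
  by rewrite -wint_cst//; apply: wint_le => //; exact: bdd_cst.
(* Integrating first over the step y and then over the gradient x, or the
   other way around. *)
have swap : I (fun x => I (second_difference v w x)) = mean_add (energy v) w.
  have Inn x : 0 <= I (second_difference v w x).
    by apply: wint_ge0 => // y; exact: sqr_ge0.
  apply: EFin_inj.
  apply: (etrans (EFin_wint mf f_int bJ)).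
  apply: (etrans _ (esym (EFin_mean_add w (bnn_energy bv)))).
  have nsd := nnm_second_difference w bv.
  transitivity (\int[mu]_x \int[mu]_y
      ((f x)%:E * ((f y)%:E * (second_difference v w x y)%:E)))%E.
    apply: eq_integral => x _; rewrite EFin_wint// ge0_integralZl//.
    - exact: nnm_m (nnm_comp (pair1_measurable x) nsd).
    - by move=> y _; exact: nnm_ge0 (x, y) nsd.
    - by rewrite lee_fin.
  rewrite (@fubini_tonelli _ _ _ _ _ mu mu (fun z =>
      ((f z.1)%:E * ((f z.2)%:E * (second_difference v w z.1 z.2)%:E))%E))/=; last 2 first.
  - apply: emeasurable_funM; last exact: nnm_m nsd.
    by apply/measurable_EFinP; exact: measurableT_comp.
  - by move=> z; rewrite mule_ge0 ?lee_fin//; exact: (nnm_ge0 z nsd).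
  apply: eq_integral => y _ /=.
  apply: (etrans _ (congr1 (fun r => (f y)%:E * r)%E (esym (EFin_wint mf f_int (bsd' y))))).
  rewrite -ge0_integralZl//.
  - by apply: eq_integral => x _; rewrite muleCA.
  - by apply: emeasurable_funM; apply/measurable_EFinP => //; case: (bsd' y).
  - by move=> x _; rewrite mule_ge0 ?lee_fin// sqr_ge0.
  - by rewrite lee_fin.
have -> : D * step_op (energy v) w = I (fun x => D * ((v (add_point w x) - v w) ^+ 2 +
    h * I (second_difference v w x))).
  have be := bddX2 (bdd_difference w bbv).
  have bs1 := bddZ h bJ; have bs := bddD be bs1.
  apply/esym; apply: (etrans (wintZ mf f_int D bs)); congr (D * _).
  apply: (etrans (wintD mf f_int be bs1)); congr (energy v w + _).
  move: swap; set c := mean_add (energy v) w => <-.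
  exact: (wintZ mf f_int h bJ).
apply: (wint_ae_le mf f0 f_int).
- by apply: bddX2; apply: bdd_difference; case: (bnn_step_op bv).
- apply: bddZ; apply: bddD; last exact: (bddZ h bJ).
  by apply: bddX2; exact: bdd_difference.
apply: filterS (ae_addable sE muW mu_slice w) => x wx.
pose g y := v (add_point (add_point w y) x) - v (add_point w y).
have bg : bounded_measurable g.
  exact: (bddB (b2add x) (bdd_add_point w bbv)).
have eqd : step_op v (add_point w x) - step_op v w = (v (add_point w x) - v w) + h * I g.
  suff -> : I g = mean_add v (add_point w x) - mean_add v w.
    rewrite /step_op; move: (mean_add v (add_point w x)) (mean_add v w) => a b.
    by move: (v (add_point w x)) (v w) => c e; ring.
  have b1 := bdd_add_point (add_point w x) bbv; have b2 := bdd_add_point w bbv.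
  apply: (etrans _ (wintB mf f_int b1 b2)).
  apply: (wint_ae mf f_int bg (bddB b1 b2)).
  have ae2 := ae_time_neq mu_slice x.1.
  apply: filterS2 (ae_addable sE muW mu_slice w) ae2 => y wy xy.
  have wC := add_pointC sE wy wx (nesym xy).
  have eqv := weq_measurable (fun r : R => measurable_set1 r) bbv.1 wC.
  exact: (congr1 (fun r => r - v (add_point w y)) eqv).
have := wint_jensen mf f0 f_int (v (add_point w x) - v w) bg h0.
exact: (fun jen => eq_ind_r (fun r => r ^+ 2 <= _) jen eqd).
Qed.

Definition step_iter n v := iter n step_op v.

Lemma bnn_step_iter n v : bnn v -> bnn (step_iter n v).
Proof. by move=> bv; elim: n => //= n ih; exact: bnn_step_op. Qed.

Lemma energy_step_iter n v w : bnn v ->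
  energy (step_iter n v) w <= D ^+ n * step_iter n (energy v) w.
Proof.
move=> bv; elim: n w => [w|n ih w]; first by rewrite expr0 mul1r.
have bn := bnn_step_iter n bv; have ben := bnn_step_iter n (bnn_energy bv).
apply: le_trans (energy_step_op w bn) _; rewrite exprS -mulrA ler_wpM2l//.
rewrite -step_opZ//; apply: step_op_le => //; first exact: bnn_energy.
by apply: bnnZ => //; exact: exprn_ge0.
Qed.

(** The variance after n steps is the sum of the variances due to each of them, and
each is bounded by the energy, transported by the other n - 1 steps. *)
Lemma step_iter_variance n v w : bnn v ->
  D ^+ n * step_iter n (fun w => v w ^+ 2) w <=
  step_iter n v w ^+ 2 + n%:R * h * D ^+ n * step_iter n.-1 (energy v) w.
Proof.
move=> bv; elim: n w => [w|n ih w]; first by rewrite expr0 !mul1r !mul0r addr0.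
have bn := bnn_step_iter n bv; have bn2 := bnn_step_iter n (bnnX2 bv).
have ben := bnn_step_iter n (bnn_energy bv).
have ben1 := bnn_step_iter n.-1 (bnn_energy bv).
have Dn0 : 0 <= D ^+ n by exact: exprn_ge0.
have c0 : 0 <= n%:R * h * D ^+ n by rewrite !mulr_ge0.
have h1 : D * (D ^+ n * step_iter n.+1 (fun w => v w ^+ 2) w) <=
    D * (step_op (fun w => step_iter n v w ^+ 2) w +
         n%:R * h * D ^+ n * step_op (step_iter n.-1 (energy v)) w).
  rewrite ler_wpM2l// -!step_opZ// -step_opD//; last 2 first.
  - exact: bnnX2.
  - exact: bnnZ.
  apply: step_op_le => //; first exact: bnnZ.
  by apply: bnnD; [exact: bnnX2 | exact: bnnZ].
have h2 := step_op_variance w bn.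
have h3 : D * h * energy (step_iter n v) w <= D * h * (D ^+ n * step_iter n (energy v) w).
  by rewrite ler_wpM2l ?mulr_ge0//; exact: energy_step_iter.
have h4 : D * (n%:R * h * D ^+ n * step_op (step_iter n.-1 (energy v)) w) =
    D * (n%:R * h * D ^+ n * step_iter n (energy v) w).
  by case: (n) => [|m]//; rewrite !mul0r.
rewrite exprS -mulrA; apply: (le_trans h1); rewrite mulrDr h4.
move: h2 h3; rewrite [step_op (step_iter n v) w]/(step_iter n.+1 v w) -natr1 /=.
set X := D ^+ n; set Y := step_iter n (energy v) w => h2 h3.
have -> : (n%:R + 1) * h * (D * X) * Y = D * h * (X * Y) + D * (n%:R * h * X * Y) by ring.
by move: h2 h3; lra.
Qed.

Definition mean_iter j v := iter j mean_add v.

Lemma bnn_mean_iter j v : bnn v -> bnn (mean_iter j v).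
Proof. by move=> bv; elim: j => //= j ih; exact: bnn_mean_add. Qed.

Lemma mean_iterD j u v w : bnn u -> bnn v ->
  mean_iter j (fun w => u w + v w) w = mean_iter j u w + mean_iter j v w.
Proof.
move=> bu bv; elim: j w => //= j ih w.
rewrite -mean_addD; try exact: bnn_mean_iter.
by congr (mean_add _ w); apply/funext => x; exact: ih.
Qed.

Lemma mean_iterZ j c v w : bnn v -> mean_iter j (fun w => c * v w) w = c * mean_iter j v w.
Proof.
move=> bv; elim: j w => //= j ih w.
rewrite -mean_addZ; last exact: bnn_mean_iter.
by congr (mean_add _ w); apply/funext => x; exact: ih.
Qed.

(** The binomial expansion of the n-th power of 1 + h K. *)
Lemma step_iter_binomial n v w : bnn v ->
  step_iter n v w = \sum_(j < n.+1) 'C(n, j)%:R * (h ^+ j * mean_iter j v w).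
Proof.
move=> bv; elim: n v bv => [v bv|n ih v bv].
  by rewrite big_ord1 bin0 expr0 !mul1r.
rewrite /step_iter iterSr -/(step_iter _ _) ih; last exact: bnn_step_op.
rewrite -(binomial_shift_sum n (fun j => h ^+ j * mean_iter j v w)) -big_split/=.
apply: eq_bigr => j _; rewrite /step_op mean_iterD//; last first.
  by apply: bnnZ => //; exact: bnn_mean_add.
rewrite mean_iterZ; last exact: bnn_mean_add.
rewrite -[mean_iter j (mean_add v) w]/(iter j mean_add (mean_add v) w) -iterSr.
rewrite iterS -/(mean_iter j v) exprSr.
move: (mean_add _ w) (mean_iter j v w) (h ^+ j) ('C(n, j)%:R) => b a p c.
by ring.
Qed.

End step.

End poincare.

(** * The Poincare inequality of a Poisson process *)

Section poincare_limit.
Context {R : realType} (E : completeMetricType R) (T : R).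
Hypothesis sE : separable E.
Local Notation ST := (space_time R E).
Local Notation config := (configuration E T).
Variable mu : {finite_measure set ST -> \bar R}.
Hypothesis muW : mu (~` window E T) = 0%E.
Hypothesis mu_slice : forall t : R, mu (slice t) = 0%E.
Variable f : ST -> R.
Hypothesis wf : weight f.
Hypothesis f_int : mu.-integrable setT (EFin \o f).
Implicit Types (u v : config -> R) (w : config) (x y : ST).

Local Notation L := (wint mu f (fun=> 1)).
Local Notation e0 := (empty_config E T).

Let mf : measurable_fun setT f := wf.1.
Let f0 : forall x, 0 <= f x := wf.2.

Lemma EFin_mass : L%:E = (\int[mu]_x (f x)%:E)%E.
Proof.
rewrite EFin_wint//; last exact: bdd_cst.
by apply: eq_integral => x _; rewrite mule1.
Qed.

Let L0 : 0 <= L. Proof. exact: wint_ge0. Qed.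

Lemma iter_add_EFin n v w : bnn v ->
  iter_add mu f n (EFin \o v) w = (mean_iter mu f n v w)%:E.
Proof.
move=> bv; elim: n w => // n ih w.
rewrite [RHS]EFin_mean_add//; last exact: bnn_mean_iter.
by rewrite iter_addS; congr (add_op _ _ _ w); apply/funext.
Qed.

Definition series_coeff v n : R := n`!%:R^-1 * mean_iter mu f n v e0.

Lemma series_coeff_ge0 v n : bnn v -> 0 <= series_coeff v n.
Proof.
by move=> bv; rewrite mulr_ge0// ?invr_ge0//; case: (bnn_mean_iter sE wf f_int n bv).
Qed.

Lemma exp_add_EFin v : bnn v ->
  exp_add mu f (EFin \o v) = (\sum_(n <oo) (series_coeff v n)%:E)%E.
Proof. by move=> bv; apply: eq_eseriesr => n _; rewrite iter_add_EFin// -EFinM. Qed.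

Lemma exp_add1 : exp_add mu f (fun _ : config => 1%E) = (expR L)%:E.
Proof.
have -> : exp_add mu f (fun _ : config => 1%E) = (\sum_(n <oo) (exp_coeff L n)%:E)%E.
  apply: eq_eseriesr => n _; rewrite iter_add_cst// mul1e -EFin_mass.
  by rewrite -EFin_expe -EFinM mulrC.
apply/cvg_lim => //; rewrite (_ : (fun n => _) = EFin \o series (exp_coeff L)).
  by apply: cvg_EFin; [exact: nearW | exact: is_cvg_series_exp_coeff].
by apply/funext => n /=; rewrite sumEFin.
Qed.

Lemma exp_add_fin v : bnn v -> exp_add mu f (EFin \o v) \is a fin_num.
Proof.
move=> bv; have [M vM] := bnn_bound bv.
have M0 : 0 <= M by exact: le_trans (bv.2 point) (vM point).
rewrite ge0_fin_numE; last by apply: exp_add_ge0 => //; exact: bnn_nnm.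
apply: (@le_lt_trans _ _ (exp_add mu f (fun _ : config => M%:E * 1)%E)).
  apply: exp_add_le => //; first exact: bnn_nnm.
  - by apply: nnm_cst; rewrite mule1 lee_fin.
  - exact: aeW.
  - by move=> w; rewrite mule1 lee_fin.
by rewrite exp_addZ// exp_add1 -EFinM ltry.
Qed.

Lemma partial_sum_le v n : bnn v ->
  \sum_(j < n) series_coeff v j <= fine (exp_add mu f (EFin \o v)).
Proof.
move=> bv; rewrite -lee_fin fineK ?exp_add_fin// exp_add_EFin// -sumEFin.
rewrite -(big_mkord xpredT (fun j => (series_coeff v j)%:E)).
by apply: nneseries_lim_ge => j _ _; rewrite lee_fin series_coeff_ge0.
Qed.

Lemma partial_sum_sup v (a C : R) : bnn v -> 0 <= a ->
  (forall n, a * \sum_(j < n) series_coeff v j <= C) ->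
  a * fine (exp_add mu f (EFin \o v)) <= C.
Proof.
move=> bv a0 h.
rewrite -lee_fin EFinM fineK ?exp_add_fin// exp_add_EFin//.
rewrite -nneseriesZl//; last by move=> j _; rewrite lee_fin series_coeff_ge0.
apply: lime_le.
  by apply: is_cvg_nneseries => j _ _; rewrite -EFinM lee_fin mulr_ge0// series_coeff_ge0.
apply: nearW => n; rewrite big_mkord.
under eq_bigr do rewrite -EFinM.
by rewrite sumEFin lee_fin -mulr_sumr.
Qed.

Lemma step_iter_le v m n : bnn v -> (m <= n)%N -> (0 < n)%N ->
  step_iter mu f n%:R^-1 m v e0 <= fine (exp_add mu f (EFin \o v)).
Proof.
move=> bv mn n0; rewrite step_iter_binomial ?invr_ge0//.
apply: le_trans (partial_sum_le m.+1 bv); apply: ler_sum => j _.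
have jm : (j <= m)%N by rewrite -ltnS.
have /andP[_ up] := @binomial_ratio_bounds R n j n0 (leq_trans jm mn).
rewrite mulrA ler_wpM2r//; first by case: (bnn_mean_iter sE wf f_int j bv).
apply: le_trans up; rewrite exprVn ler_wpM2r ?invr_ge0 ?exprn_ge0//.
by rewrite ler_nat leq_bin2l.
Qed.

(** The binomial coefficient of n and j, divided by n^j, tends to 1 / j!; keeping the
J first terms makes the error uniform. *)
Lemma step_iter_ge v J n : bnn v -> (J <= n)%N -> (0 < n)%N ->
  (1 - J%:R ^+ 2 / n%:R) * \sum_(j < J) series_coeff v j <=
  step_iter mu f n%:R^-1 n v e0.
Proof.
move=> bv Jn n0; rewrite step_iter_binomial ?invr_ge0//.
have m0 j : 0 <= mean_iter mu f j v e0 by case: (bnn_mean_iter sE wf f_int j bv).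
apply: (@le_trans _ _ (\sum_(j < J) 'C(n, j)%:R * (n%:R^-1 ^+ j * mean_iter mu f j v e0))).
  rewrite mulr_sumr; apply: ler_sum => j _.
  have jn : (j <= n)%N by exact: leq_trans (ltnW (ltn_ord j)) Jn.
  have /andP[lo _] := @binomial_ratio_bounds R n j n0 jn.
  rewrite /series_coeff !mulrA ler_wpM2r// exprVn; apply: le_trans lo.
  rewrite ler_wpM2r ?invr_ge0// lerD2l lerN2 ler_wpM2r ?invr_ge0//.
  by rewrite ler_sqr ?nnegrE// ler_nat ltnW.
rewrite -(big_mkord xpredT (fun j => 'C(n, j)%:R * (n%:R^-1 ^+ j * mean_iter mu f j v e0))).
rewrite -(big_mkord xpredT (fun j => 'C(n, j)%:R * (n%:R^-1 ^+ j * mean_iter mu f j v e0))).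
rewrite (big_cat_nat (n := J) (p := n.+1)) ?(leq_trans Jn)//= lerDl.
by apply: sumr_ge0 => j _; rewrite !mulr_ge0// exprn_ge0// invr_ge0.
Qed.

Let bnn1 : bnn (fun _ : config => 1).
Proof. by split => //; exact: bdd_cst. Qed.

(** The constant 1 gives the total mass of the walk. *)
Lemma step_iter1 n h w : step_iter mu f h n (fun=> 1) w = (1 + h * L) ^+ n.
Proof.
elim: n w => // n ih w; rewrite /step_iter iterS -/(step_iter _ _ _ _ _).
rewrite (_ : step_iter _ _ _ _ _ = fun=> (1 + h * L) ^+ n); last exact/funext.
rewrite /step_op /mean_add exprS.
have -> := wint_cst mf f_int ((1 + h * L) ^+ n).
by move: L ((1 + h * L) ^+ n) => l p; ring.
Qed.

Lemma le_of_archimedean (x y c : R) (m : nat) :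
  (forall n, (m < n)%N -> x - y / n%:R <= c) -> x <= c.
Proof.
move=> h; rewrite leNgt; apply/negP => cx.
pose n := (m.+1 + Num.truncn (`|y| / (x - c))).+1.
have xc : 0 < x - c by rewrite subr_gt0.
have n0 : 0 < n%:R :> R by rewrite ltr0n.
have mn : (m < n)%N by rewrite /n ltnS (leq_trans (leqnSn m))// leq_addr.
have := h n mn; apply/negP; rewrite -ltNge ltrBrDl -ltrBrDr ltr_pdivrMr//.
apply: (le_lt_trans (ler_norm _)).
rewrite mulrC -ltr_pdivrMr//; apply: (lt_le_trans (truncnS_gt _)).
by rewrite ler_nat /n addSn !ltnS leqW// leq_addl.
Qed.

(** This is [step_iter_variance] with h = 1 / n, in the limit. With s(v) for the
series of v, it reads s(1) s(v^2) <= s(v)^2 + s(1) s(energy v), the Poincare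
inequality before normalization by s(1) = exp L. *)
Theorem poisson_poincare v : bnn v ->
  expR L * fine (exp_add mu f (EFin \o (fun w => v w ^+ 2))) <=
  fine (exp_add mu f (EFin \o v)) ^+ 2 +
  expR L * fine (exp_add mu f (EFin \o energy mu f v)).
Proof.
move=> bv; have bv2 := bnnX2 bv; have be := bnn_energy sE wf f_int bv.
set C := _ + _.
(* The partial sums of the left side are compared with the walk of n steps
   for n large, which the right side bounds for all n. *)
have key J : (\sum_(j < J) series_coeff (fun=> 1) j) *
    (\sum_(j < J) series_coeff (fun w => v w ^+ 2) j) <= C.
  set A := \sum_(j < J) _; set B := \sum_(j < J) _.
  have A0 : 0 <= A by apply: sumr_ge0 => j _; exact: series_coeff_ge0.
  have B0 : 0 <= B by apply: sumr_ge0 => j _; exact: series_coeff_ge0.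
  (* J <= n is needed to expand n steps, and J^2 <= n makes the factor
     1 - J^2 / n nonnegative. *)
  apply: (@le_of_archimedean _ (2 * J%:R ^+ 2 * (A * B)) _ (J + J ^ 2)) => n Jn.
  have n0 : (0 < n)%N by exact: leq_ltn_trans Jn.
  have nR : 0 < n%:R :> R by rewrite ltr0n.
  have Jn1 : (J <= n)%N by rewrite ltnW// (leq_ltn_trans _ Jn)// leq_addr.
  have Jn2 : (J ^ 2 <= n)%N by rewrite ltnW// (leq_ltn_trans _ Jn)// leq_addl.
  have n'0 : 0 <= n%:R^-1 :> R by rewrite invr_ge0.
  have := step_iter_variance sE muW mu_slice wf f_int n'0 n e0 bv.
  rewrite mulfV ?gt_eqF// mul1r => var.
  have lo1 := step_iter_ge bnn1 Jn1 n0; rewrite step_iter1 -/A in lo1.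
  have lo2 := step_iter_ge bv2 Jn1 n0; rewrite -/B in lo2.
  have up1 := step_iter_le bv (leqnn n) n0.
  have up2 := step_iter_le be (leq_pred n) n0.
  have DeL : (1 + n%:R^-1 * L) ^+ n <= expR L.
    rewrite (_ : expR L = expR (n%:R^-1 * L) ^+ n).
      by rewrite lerXn2r ?nnegrE ?expR_ge0 ?expR_ge1Dx// addr_ge0// mulr_ge0.
    by rewrite -expRM_natl mulrA mulfV ?mul1r// gt_eqF.
  set theta := 1 - J%:R ^+ 2 / n%:R in lo1 lo2.
  have theta0 : 0 <= theta.
    by rewrite subr_ge0 ler_pdivrMr// mul1r -natrX ler_nat.
  have D0 : 0 <= (1 + n%:R^-1 * L) ^+ n by rewrite exprn_ge0// addr_ge0// mulr_ge0.
  have bs0 u m : bnn u -> 0 <= step_iter mu f n%:R^-1 m u e0.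
    by move=> bu; case: (bnn_step_iter sE wf f_int n'0 m bu).
  have h1 : (theta * A) * (theta * B) <= C.
    apply: (@le_trans _ _ ((1 + n%:R^-1 * L) ^+ n *
        step_iter mu f n%:R^-1 n (fun w => v w ^+ 2) e0)).
      by apply: ler_pM => //; exact: mulr_ge0.
    apply: le_trans var _; apply: lerD.
      by rewrite ler_sqr ?nnegrE ?bs0// (le_trans (bs0 _ n bv)).
    by apply: ler_pM => //; exact: bs0.
  apply: le_trans h1; rewrite /theta.
  have -> : 2 * J%:R ^+ 2 * (A * B) / n%:R = 2 * (J%:R ^+ 2 / n%:R) * (A * B) by ring.
  have : 0 <= (J%:R ^+ 2 / n%:R) ^+ 2 * (A * B) by rewrite mulr_ge0 ?sqr_ge0 ?mulr_ge0.
  by set b := J%:R ^+ 2 / n%:R; lra.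
have mono (u : config -> R) J K : bnn u -> (J <= K)%N ->
    \sum_(j < J) series_coeff u j <= \sum_(j < K) series_coeff u j.
  move=> bu JK; rewrite -(big_mkord xpredT (series_coeff u)).
  rewrite -(big_mkord xpredT (series_coeff u)) (big_cat_nat (n := J) (p := K))//= lerDl.
  by apply: sumr_ge0 => j _; exact: series_coeff_ge0.
(* Both series on the left are replaced by their partial sums, one after the
   other. *)
have -> : expR L = fine (exp_add mu f (EFin \o (fun _ : config => 1))).
  by rewrite [X in fine X]exp_add1.
rewrite mulrC; apply: partial_sum_sup => // [|J].
  by apply: fine_ge0; exact: (exp_add_ge0 sE mu wf (bnn_nnm bv2)).
rewrite mulrC; apply: partial_sum_sup => // [|K].
  by apply: sumr_ge0 => j _; exact: series_coeff_ge0.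
apply: le_trans (key (maxn J K)); apply: ler_pM.
- by apply: sumr_ge0 => j _; exact: series_coeff_ge0.
- by apply: sumr_ge0 => j _; exact: series_coeff_ge0.
- by apply: mono => //; exact: leq_maxl.
- by apply: mono => //; exact: leq_maxr.
Qed.

End poincare_limit.

(** * Counts of a Poisson process *)

Section poisson_counts.
Context {R : realType} (E : completeMetricType R) (T : R).
Hypothesis sE : separable E.
Local Notation ST := (space_time R E).
Local Notation config := (configuration E T).
Variable mu : {finite_measure set ST -> \bar R}.
Hypothesis muW : mu (~` window E T) = 0%E.
Hypothesis mu_slice : forall t : R, mu (slice t) = 0%E.
Variable f : ST -> R.
Hypothesis wf : weight f.
Hypothesis f_int : mu.-integrable setT (EFin \o f).
Variables (n : nat) (A : 'I_n -> set ST).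
Hypothesis mA : forall i, measurable (A i).
Hypothesis tA : trivIset setT A.
Implicit Types (w : config) (x : ST) (k : 'I_n -> nat) (i : 'I_n).

Local Notation L := (wint mu f (fun=> 1)).
Local Notation e0 := (empty_config E T).

Let mf : measurable_fun setT f := wf.1.
Let f0 : forall x, 0 <= f x := wf.2.

Definition counts_are k : set config := [set w | forall i, w (A i) = (k i)%:R%:E].

Definition counts_indic k w : R := \1_(counts_are k) w.

(** The counts that precede the arrival of a point in part i. *)
Definition decr i k : 'I_n -> nat := fun j => if j == i then (k j).-1 else k j.

Definition outside : set ST := ~` \bigcup_i A i.

Definition part_mass i : R := wint mu f (\1_(A i)).

Definition outside_mass : R := wint mu f (\1_outside).

Definition total_count k : nat := \sum_(i < n) k i.

Definition count_weight k : R := \prod_(i < n) (part_mass i ^+ k i / (k i)`!%:R).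

Lemma measurable_counts_are k : measurable (counts_are k).
Proof.
have -> : counts_are k = \bigcap_(i in [set: 'I_n]) [set w : config | w (A i) = (k i)%:R%:E].
  by apply/seteqP; split => [w h i _|w h i]; [exact: h | exact: (h i)].
apply: fin_bigcap_measurable => // i _.
rewrite -[X in measurable X]setTI.
exact: (measurable_evaluation (mA i) measurableT (emeasurable_set1 (k i)%:R%:E)).
Qed.

Lemma bnn_counts_indic k : bnn (counts_indic k).
Proof.
split; last by move=> w; rewrite /counts_indic indicE.
split; first by apply: measurable_indic; exact: measurable_counts_are.
by exists 1 => w; rewrite /counts_indic indicE ger0_norm// lern1 leq_b1.
Qed.

Lemma measurable_outside : measurable outside.
Proof. by apply: measurableC; apply: fin_bigcup_measurable. Qed.

Lemma bdd_indic (B : set ST) : measurable B -> bounded_measurable (\1_B : ST -> R).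
Proof.
move=> mB; split; first exact: measurable_indic.
by exists 1 => x; rewrite indicE ger0_norm// lern1 leq_b1.
Qed.

(** A point added in part i increases the count of this part only, and a point
added outside of the parts changes no count. *)
Lemma counts_indic_add k w x : addable w x ->
  counts_indic k (add_point w x) =
  \sum_(i < n) (0 < k i)%:R * (counts_indic (decr i k) w * \1_(A i) x) +
  counts_indic k w * \1_outside x.
Proof.
move=> wx.
have addA i : add_point w x (A i) = (w (A i) + (x \in A i)%:R%:E)%E.
  by rewrite add_pointE.
have [[i0 _ xi0]|nx] := pselect ((\bigcup_i A i) x); last first.
  have xA i : (x \in A i) = false by apply/negbTE; rewrite notin_setE => xA; apply: nx; exists i.
  rewrite big1 => [|i _]; last by rewrite indicE xA mulr0 mulr0.
  rewrite add0r [X in _ * X]indicE mem_set// mulr1; apply: indic_iff.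
  by split => h i; move: (h i); rewrite addA xA adde0.
have xA i : (x \in A i) = (i == i0).
  apply/idP/eqP => [|->]; last exact: mem_set.
  rewrite inE => xi; apply: (@tA i i0) => //; by exists x.
rewrite [X in _ + _ * X]indicE memNset; last by apply; exists i0.
rewrite mulr0 addr0 (bigD1 i0)//= big1 ?addr0; last first.
  by move=> i ii0; rewrite indicE xA (negbTE ii0) !mulr0.
rewrite indicE xA eqxx mulr1 /counts_indic.
have [m wm] := configuration_nat w (mA i0).
have [k0|k0] := posnP (k i0).
  rewrite mul0r indicE memNset//= => /(_ i0).
  rewrite addA xA eqxx wm k0 -EFinD -natrD => /eqP.
  by rewrite eqe pnatr_eq0 addn1.
rewrite mul1r; apply: indic_iff; split => h i; move: (h i); rewrite addA xA /decr.
  have [->|ii0] := eqVneq i i0; last by rewrite adde0.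
  rewrite wm -EFinD -natrD addn1 => -[] /eqP; rewrite eqr_nat => /eqP <-.
  by [].
have [->|ii0] := eqVneq i i0; last by rewrite adde0.
rewrite wm => -[] /eqP; rewrite eqr_nat => /eqP ->.
by rewrite -EFinD -natrD addn1 prednK.
Qed.

Lemma part_mass_ge0 i : 0 <= part_mass i.
Proof. by apply: wint_ge0 => // x; rewrite indicE. Qed.

Lemma bnn_sum (I : Type) (s : seq I) (v : I -> config -> R) :
  (forall j, bnn (v j)) -> bnn (fun w => \sum_(j <- s) v j w).
Proof.
move=> bv; split; first by apply: bdd_sum => j; exact: (bv j).1.
by move=> w; apply: sumr_ge0 => j _; exact: (bv j).2.
Qed.

Lemma mean_iter_sum N (I : Type) (s : seq I) (v : I -> config -> R) w :
  (forall j, bnn (v j)) ->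
  mean_iter mu f N (fun w => \sum_(j <- s) v j w) w =
  \sum_(j <- s) mean_iter mu f N (v j) w.
Proof.
move=> bv; elim: s => [|j s ih].
  have -> : (fun w : config => \sum_(j <- [::]) v j w) = fun w => 0 * 1.
    by apply/funext => w'; rewrite big_nil mul0r.
  rewrite big_nil mean_iterZ ?mul0r//.
  by split => //; exact: bdd_cst.
have -> : (fun w : config => \sum_(j <- j :: s) v j w) =
    fun w => v j w + \sum_(j <- s) v j w by apply/funext => w'; rewrite big_cons.
by rewrite mean_iterD// ?ih ?big_cons//; exact: bnn_sum.
Qed.

Lemma mean_add_counts k w :
  mean_add mu f (counts_indic k) w =
  \sum_(i < n) ((0 < k i)%:R * part_mass i) * counts_indic (decr i k) w +
  outside_mass * counts_indic k w.
Proof.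
have bA i := bdd_indic (mA i); have bO := bdd_indic measurable_outside.
have bi i : bounded_measurable (fun x =>
    (0 < k i)%:R * (counts_indic (decr i k) w * \1_(A i) x) : R).
  by do 2 apply: bddZ.
have bs := bdd_sum (index_enum 'I_n) bi.
have -> : \sum_(i < n) ((0 < k i)%:R * part_mass i) * counts_indic (decr i k) w =
    wint mu f (fun x => \sum_(i < n) (0 < k i)%:R * (counts_indic (decr i k) w * \1_(A i) x)).
  apply/esym; apply: (etrans (wint_sum mf f_int _ bi)); apply: eq_bigr => i _.
  apply: (etrans (wintZ mf f_int _ (bddZ (counts_indic (decr i k) w) (bA i)))).
  rewrite -mulrA; congr (_ * _).
  by apply: (etrans (wintZ mf f_int _ (bA i))); rewrite mulrC.
have -> : outside_mass * counts_indic k w = wint mu f (fun x => counts_indic k w * \1_outside x).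
  by apply/esym; apply: (etrans (wintZ mf f_int _ bO)); rewrite mulrC.
have bO' := bddZ (counts_indic k w) bO.
apply: (etrans _ (wintD mf f_int bs bO')).
apply: (wint_ae mf f_int) => //.
- by apply: bdd_add_point => //; case: (bnn_counts_indic k).
- exact: bddD.
- by apply: filterS (ae_addable sE muW mu_slice w) => x; exact: counts_indic_add.
Qed.

Lemma total_count_decr i k : (0 < k i)%N -> total_count k = (total_count (decr i k)).+1.
Proof.
move=> ki; rewrite /total_count (bigD1 i)//= [in RHS](bigD1 i)//= /decr eqxx.
rewrite -addSn prednK//; congr (_ + _)%N; apply: eq_bigr => j ji.
by rewrite (negbTE ji).
Qed.

Lemma count_weight_decr i k : (0 < k i)%N ->
  part_mass i * count_weight (decr i k) = (k i)%:R * count_weight k.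
Proof.
move=> ki; rewrite /count_weight (bigD1 i)//= [in RHS](bigD1 i)//= !mulrA /decr eqxx.
congr (_ * _); last by apply: eq_bigr => j ji; rewrite (negbTE ji).
case: (k i) ki => // m _ /=; rewrite -exprS factS natrM.
have m0 : m`!%:R != 0 :> R by rewrite pnatr_eq0 -lt0n fact_gt0.
have m1 : m.+1%:R != 0 :> R by rewrite pnatr_eq0.
move: (part_mass i ^+ m.+1) (m`!%:R) (m.+1%:R) m0 m1 => p a b a0 b0.
by field; rewrite a0 b0.
Qed.

(** The multinomial number for N points, k i of which fall in each part i and the
others outside. *)
Definition count_iter N k : R :=
  if (total_count k <= N)%N then
    N`!%:R * count_weight k *
    (outside_mass ^+ (N - total_count k) / (N - total_count k)`!%:R)
  else 0.

(** By induction on N, removing the last point: it lies in part i, which happens in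
proportion to k i, or outside. *)
Lemma mean_iter_counts N k :
  mean_iter mu f N (counts_indic k) e0 = count_iter N k.
Proof.
elim: N k => [k|N ih k].
  rewrite /count_iter leqn0 /mean_iter/= /counts_indic; have [k0|k0] := eqVneq (total_count k) 0%N.
    have ki i : k i = 0%N.
      by apply/eqP; move/eqP: k0; rewrite /total_count sum_nat_eq0 => /forallP/(_ i).
    rewrite indicE mem_set/= ?k0 ?subn0 ?expr0 ?divr1 ?mulr1 ?mul1r.
      by rewrite /count_weight big1// => i _; rewrite ki expr0 divr1.
    by move=> i; rewrite ki.
  rewrite indicE memNset//= => h; move/eqP: k0; apply; rewrite /total_count big1// => i _.
  by have /eqP := h i; rewrite eq_sym /mzero eqe pnatr_eq0 => /eqP.
rewrite /mean_iter iterSr -/(mean_iter _ _ _ _).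
have -> : mean_add mu f (counts_indic k) = fun w =>
    \sum_(i < n) ((0 < k i)%:R * part_mass i) * counts_indic (decr i k) w +
    outside_mass * counts_indic k w by apply/funext => w; exact: mean_add_counts.
have om0 : 0 <= outside_mass by apply: wint_ge0 => // x; rewrite indicE.
have bi i : bnn (fun w => ((0 < k i)%:R * part_mass i) * counts_indic (decr i k) w).
  by apply: bnnZ; [rewrite mulr_ge0// part_mass_ge0 | exact: bnn_counts_indic].
rewrite mean_iterD//; last 2 first.
- exact: bnn_sum.
- by apply: bnnZ => //; exact: bnn_counts_indic.
rewrite mean_iter_sum// mean_iterZ//; last exact: bnn_counts_indic.
rewrite ih (eq_bigr (fun i => (0 < k i)%:R * part_mass i * count_iter N (decr i k))); last first.
  by move=> i _; rewrite mean_iterZ ?ih//; exact: bnn_counts_indic.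
set K := total_count k; set r := outside_mass; set c := count_weight k.
have -> : \sum_(i < n) (0 < k i)%:R * part_mass i * count_iter N (decr i k) =
    \sum_(i < n) (k i)%:R * (if (K <= N.+1)%N then
      N`!%:R * c * (r ^+ (N.+1 - K) / (N.+1 - K)`!%:R) else 0).
  apply: eq_bigr => i _; have [->|ki] := posnP (k i); first by rewrite !mul0r.
  rewrite mul1r /count_iter /K (total_count_decr ki) ltnS subSS.
  case: ifP => _; last by rewrite !mulr0.
  have := count_weight_decr ki; rewrite -/c.
  move: (count_weight (decr i k)) => c' cE.
  by rewrite mulrA (mulrCA _ N`!%:R) cE !mulrA [N`!%:R * _]mulrC -!mulrA.
rewrite -mulr_suml -natr_sum -/(total_count k) -/K /count_iter -/K -/r -/c.
have [KN|KN] := leqP K N; last first.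
  rewrite mulr0 addr0; case: ifP => [KN1|_]; last by rewrite mulr0.
  have -> : K = N.+1 by apply/eqP; rewrite eqn_leq KN1.
  by rewrite subnn expr0 divr1 !mulr1 factS natrM mulrA.
rewrite (leqW KN) subSn// exprS !factS !natrM.
have s0 : (N - K)`!%:R != 0 :> R by rewrite pnatr_eq0 -lt0n fact_gt0.
have s1 : (N - K).+1%:R != 0 :> R by rewrite pnatr_eq0.
have -> : N.+1%:R = K%:R + (N - K).+1%:R :> R by rewrite -natrD addnS subnKC.
move: (r ^+ (N - K)) ((N - K)`!%:R) ((N - K).+1%:R) (N`!%:R) (K%:R) s0 s1 => p s t u q s0 t0.
by field; rewrite s0 t0.
Qed.

Lemma mass_decomposition : L = \sum_(i < n) part_mass i + outside_mass.
Proof.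
have bA i := bdd_indic (mA i); have bO := bdd_indic measurable_outside.
have bs := bdd_sum (index_enum 'I_n) bA.
have <- := wint_sum mf f_int (index_enum 'I_n) bA.
apply: (etrans _ (wintD mf f_int bs bO)).
congr (wint mu f); apply/funext => x.
have [[i0 _ xi0]|nx] := pselect ((\bigcup_i A i) x).
  rewrite [X in _ + X]indicE memNset ?addr0; last by apply; exists i0.
  rewrite (bigD1 i0)//= indicE mem_set// big1 ?addr0// => i ii0.
  rewrite indicE memNset// => xi; move/eqP: ii0; apply.
  by apply: (@tA i i0) => //; exists x.
rewrite [X in _ + X]indicE mem_set// big1 ?add0r// => i _.
by rewrite indicE memNset// => xi; apply: nx; exists i.
Qed.

(** Summing over the number of points outside gives an exponential series. *)
Lemma exp_add_counts k :
  exp_add mu f (fun w => (counts_indic k w)%:E) = (count_weight k * expR outside_mass)%:E.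
Proof.
have bk := bnn_counts_indic k; set r := outside_mass; set K := total_count k.
have c0 j : 0 <= series_coeff mu f (counts_indic k) j by exact: series_coeff_ge0.
have om0 : 0 <= r by apply: wint_ge0 => // x; rewrite indicE.
have cw0 : 0 <= count_weight k.
  apply: prodr_ge0 => i _; rewrite mulr_ge0 ?invr_ge0// exprn_ge0//.
  exact: part_mass_ge0.
rewrite (exp_add_EFin sE wf f_int bk) (nneseries_split _ K) => [|j _]; last by rewrite lee_fin.
rewrite big_mkord big1 ?add0e; last first.
  move=> j _; rewrite /series_coeff mean_iter_counts /count_iter -/K.
  by rewrite leqNgt ltn_ord/= mulr0.
rewrite -(nneseries_addn K); last by move=> j; rewrite lee_fin.
have cE j : series_coeff mu f (counts_indic k) (j + K) = count_weight k * exp_coeff r j.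
  rewrite /series_coeff mean_iter_counts /count_iter -/K leq_addl addnK -/r -mulrA mulKf.
    by [].
  by rewrite pnatr_eq0 -lt0n fact_gt0.
under eq_eseriesr => j _ do rewrite cE EFinM.
rewrite nneseriesZl; last by move=> j _; rewrite lee_fin exp_coeff_ge0.
rewrite EFinM; congr (_ * _)%E.
apply/cvg_lim => //; rewrite (_ : (fun n => _) = EFin \o series (exp_coeff r)).
  by apply: cvg_EFin; [exact: nearW | exact: is_cvg_series_exp_coeff].
by apply/funext => j /=; rewrite sumEFin.
Qed.

Lemma poisson_counts k :
  ((expR (- L))%:E * exp_add mu f (fun w => (counts_indic k w)%:E))%E =
  (\prod_(i < n) poisson_weight (part_mass i)%:E (k i))%E.
Proof.
rewrite exp_add_counts -EFinM.
transitivity (\prod_(i < n) (expR (- part_mass i) * part_mass i ^+ k i * (k i)`!%:R^-1))%:E.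
  congr (_%:E); rewrite mass_decomposition.
  have -> : \prod_(i < n) (expR (- part_mass i) * part_mass i ^+ k i * (k i)`!%:R^-1) =
      \prod_(i < n) expR (- part_mass i) * count_weight k.
    by rewrite /count_weight -big_split; apply: eq_bigr => i _; rewrite /= mulrA.
  rewrite mulrCA -expRD [in RHS]mulrC; congr (_ * _).
  rewrite (_ : - _ + _ = - \sum_(i < n) part_mass i); last by ring.
  by rewrite -sumrN expR_sum.
rewrite -prodEFin; apply: eq_bigr => i _.
by rewrite /poisson_weight -EFin_expe -EFinN /= -!EFinM.
Qed.

End poisson_counts.

(** * Functionals determined by their values on indicators *)

Section sigma_linear_functionals.
Context d (X : measurableType d) {R : realType}.
Local Open Scope ereal_scope.
Implicit Types (I J : (X -> \bar R) -> \bar R) (F G : X -> \bar R).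

(** The properties shared by the mean of F for the law of N and by the average of
exponential series; it spares the construction of the latter as an integral. *)
Record sigma_linear I : Prop := SigmaLinear {
  sl_ge0 : forall F, (forall x, 0 <= F x) -> 0 <= I F ;
  slZ : forall (c : R) F, (0 <= c)%R -> nnm F -> I (fun x => c%:E * F x) = c%:E * I F ;
  slD : forall F G, nnm F -> nnm G -> I (fun x => F x + G x) = I F + I G ;
  sl_series : forall F : nat -> X -> \bar R, (forall i, nnm (F i)) ->
    I (fun x => \sum_(i <oo) F i x) = \sum_(i <oo) I (F i) }.

Lemma nnm0 : nnm (fun _ : X => 0 : \bar R).
Proof. exact: nnm_cst. Qed.

Lemma sl0 I : sigma_linear I -> I (fun=> 0) = 0.
Proof.
move=> hI; rewrite -[RHS](mul0e (I (fun=> 0))) -(slZ hI (lexx 0%R) nnm0).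
by congr I; apply/funext => x; rewrite mul0e.
Qed.

Lemma sl_sum I (K : Type) (s : seq K) (F : K -> X -> \bar R) : sigma_linear I ->
  (forall i, nnm (F i)) -> I (fun x => \sum_(i <- s) F i x) = \sum_(i <- s) I (F i).
Proof.
move=> hI nF; elim: s => [|i s ih].
  rewrite big_nil -[RHS](sl0 hI); congr I; apply/funext => x; exact: big_nil.
rewrite big_cons -ih -(slD hI)//; last exact: nnm_sum.
by congr I; apply/funext => x; rewrite big_cons.
Qed.

Definition measure_of I (hI : sigma_linear I) (U : set X) : \bar R :=
  I (fun x => (\1_U x)%:E).

Section measure_of_instance.
Variables (I : (X -> \bar R) -> \bar R) (hI : sigma_linear I).

Let measure_of0 : measure_of hI set0 = 0.
Proof.
rewrite /measure_of -[RHS](sl0 hI); congr I; apply/funext => x.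
by rewrite indic0.
Qed.

Let measure_of_ge0 U : 0 <= measure_of hI U.
Proof. by apply: (sl_ge0 hI) => x; rewrite lee_fin. Qed.

Let measure_of_semi_sigma_additive : semi_sigma_additive (measure_of hI).
Proof.
move=> U mU tU mUU.
have nU i : nnm (fun x => (\1_(U i) x)%:E : \bar R) by exact: nnm_indic.
rewrite /measure_of.
have -> : (fun x => (\1_(\bigcup_n U n) x)%:E) = fun x => \sum_(i <oo) (\1_(U i) x)%:E :> \bar R.
  apply/funext => x; have [[i0 _ xi0]|nx] := pselect ((\bigcup_n U n) x).
    rewrite indicE mem_set; last by exists i0.
    rewrite (@nneseriesD1 _ _ i0)//= indicE mem_set// eseries0 ?adde0// => i _ /= ii0.
    rewrite indicE memNset// => xi; move/eqP: ii0; apply.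
    by apply: (tU i i0) => //; exists x.
  rewrite indicE memNset// eseries0// => i _ _.
  by rewrite indicE memNset// => xi; apply: nx; exists i.
rewrite (sl_series hI nU).
by apply: is_cvg_nneseries => n _ _; exact: measure_of_ge0.
Qed.

HB.instance Definition _ := isMeasure.Build _ _ _ (measure_of hI)
  measure_of0 measure_of_ge0 measure_of_semi_sigma_additive.

End measure_of_instance.

Import HBNNSimple.

Lemma sl_nnsfun I J (g : {nnsfun X >-> R}) : sigma_linear I -> sigma_linear J ->
  (forall U, measurable U -> I (fun x => (\1_U x)%:E) = J (fun x => (\1_U x)%:E)) ->
  I (EFin \o g) = J (EFin \o g).
Proof.
move=> hI hJ IJ.
pose h (r : R) x : \bar R := (`|r|%R)%:E * (\1_(g @^-1` [set r]) x)%:E.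
have mg r : measurable (g @^-1` [set r]).
  by rewrite -[X in measurable X]setTI; exact: (measurable_funP g measurableT).
have nh r : nnm (h r) by apply: nnmZ; [rewrite lee_fin|exact: nnm_indic].
have -> : EFin \o g = fun x => \sum_(r <- fset_set (range g)) h r x.
  apply/funext => x /=; rewrite fimfunE fsbig_finite//=.
  rewrite -sumEFin big_seq [RHS]big_seq; apply: eq_bigr => r.
  rewrite in_fset_set// inE => -[y _ <-].
  by rewrite /h -EFinM ger0_norm.
rewrite !sl_sum//; apply: eq_bigr => r _; rewrite !slZ ?IJ//; exact: nnm_indic.
Qed.

(** The approximation of F by simple functions, with the limit taken through a
series of nonnegative increments. *)
Lemma sl_approx I (F : X -> \bar R) (mF : measurable_fun setT F) :
  sigma_linear I -> (forall x, 0 <= F x) ->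
  I F = limn (fun n => I (EFin \o nnsfun_approx measurableT mF n)).
Proof.
move=> hI F0; set g := nnsfun_approx measurableT mF.
have ndg x : {homo (fun n => g n x) : m n / (m <= n)%N >-> (m <= n)%R}.
  by move=> m n mn; exact/lefP/nd_nnsfun_approx.
pose h n x : \bar R := (if n is m.+1 then g m.+1 x - g m x else g 0%N x)%:E.
have nh n : nnm (h n).
  case: n => [|n]; apply: nnm_EFin => //.
    exact: measurable_funB.
  by move=> x; rewrite subr_ge0 ndg.
have sumh n x : \sum_(i < n.+1) h i x = (g n x)%:E.
  elim: n => [|n ih]; first by rewrite big_ord1.
  by rewrite big_ord_recr /= ih -EFinD addrC subrK.
have -> : F = fun x => \sum_(i <oo) h i x.
  apply/funext => x; apply/esym/cvg_lim => //; rewrite -cvg_shiftS/=.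
  under eq_fun do rewrite big_mkord sumh.
  exact: cvg_nnsfun_approx.
rewrite (sl_series hI nh).
apply/cvg_lim => //; rewrite -cvg_shiftS/=.
have -> : (fun n => \sum_(0 <= i < n.+1) I (h i)) = (fun n => I (EFin \o g n)).
  apply/funext => n; rewrite big_mkord -(sl_sum _ hI)//.
  by congr I; apply/funext => x; rewrite /= -sumh.
apply: ereal_nondecreasing_is_cvgn => m n mn.
have -> : EFin \o g n = fun x => (EFin \o g m) x + (g n x - g m x)%:E.
  by apply/funext => x /=; rewrite -EFinD addrC subrK.
rewrite (slD hI).
- by rewrite leeDl// (sl_ge0 hI)// => x; rewrite lee_fin subr_ge0 ndg.
- by apply: nnm_EFin => // x; exact: fun_ge0.
- apply: nnm_EFin; first exact: measurable_funB.
  by move=> x; rewrite subr_ge0 ndg.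
Qed.

Lemma sigma_linear_ext I J : sigma_linear I -> sigma_linear J ->
  (forall U, measurable U -> I (fun x => (\1_U x)%:E) = J (fun x => (\1_U x)%:E)) ->
  forall F, nnm F -> I F = J F.
Proof.
move=> hI hJ IJ F [mF F0]; rewrite (sl_approx mF hI F0) (sl_approx mF hJ F0).
by congr (limn _); apply/funext => n; exact: sl_nnsfun.
Qed.

End sigma_linear_functionals.

(** * The pi-system of the counting events *)

Section count_pi_system.
Context {R : realType} (E : completeMetricType R) (T : R).
Hypothesis sE : separable E.
Local Notation ST := (space_time R E).
Local Notation config := (configuration E T).
Local Open Scope ereal_scope.

Definition count_events : set_system config :=
  [set U | exists n (A : 'I_n -> set ST) (k : 'I_n -> nat),
    [/\ forall i, measurable (A i), forall i, A i `<=` window E T & U = counts_are A k]].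

Lemma configuration_window (w : config) (A : set ST) : measurable A ->
  w A = w (A `&` window E T).
Proof.
move=> mA; have [_ w0 _ _ _] := configurationP w.
have mW := @measurable_window R E T.
rewrite -[in LHS](setUIDK A (window E T)) measureU//.
- rewrite [X in _ + X](_ : _ = 0) ?adde0//.
  apply: (@subset_measure0 _ _ _ w _ (~` window E T)) => //.
  + exact: measurableD.
  + exact: measurableC.
- exact: measurableI.
- exact: measurableD.
- by apply/seteqP; split => x // [[_ ?] [_]].
Qed.

(** Integrality of the masses reduces the evaluation at a set to the countably many
events that prescribe one count. *)
Lemma count_events_generate : @measurable _ config = <<s count_events >>.
Proof.
have mW := @measurable_window R E T.
apply/seteqP; split; last first.
  apply: smallest_sub; first exact: sigma_algebra_measurable.
  by move=> U [n [A [k [mA _ ->]]]]; exact: measurable_counts_are.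
apply: smallest_sub; first exact: smallest_sigma_algebra.
move=> U [A mA [B mB <-]].
have -> : [set: config] `&` (fun w : config => w A) @^-1` B =
  \bigcup_(m in [set m : nat | B m%:R%:E])
    counts_are (fun _ : 'I_1 => A `&` window E T) (fun=> m).
  rewrite setTI; apply/seteqP; split => [w /= Bw|w [m Bm] /(_ ord0)].
    have [m wm] := configuration_nat w mA.
    exists m; first by rewrite /= -wm.
    by move=> i; rewrite -configuration_window.
  by rewrite -configuration_window//= => ->.
rewrite bigcup_mkcond; apply: sigma_algebra_bigcup => m.
case: ifP => _; last exact: sigma_algebra0.
apply: sub_sigma_algebra; exists 1%N, (fun=> A `&` window E T), (fun=> m).
by split => // i; exact: measurableI.
Qed.

(** The sets of two events are listed one after the other: they need not be
disjoint, which is why the pi-system allows overlapping sets. *)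
Lemma count_events_setI : setI_closed count_events.
Proof.
move=> U V [n [A [k [mA WA ->]]]] [m [B [l [mB WB ->]]]].
exists (n + m)%N, (fun i : 'I_(n + m) => match fintype.split i with inl j => A j | inr j => B j end),
  (fun i : 'I_(n + m) => match fintype.split i with inl j => k j | inr j => l j end).
split.
- by move=> i; case: (fintype.split i).
- by move=> i; case: (fintype.split i).
apply/seteqP; split => [w [wA wB] i|w h]; first by case: (fintype.split i).
split => i.
  by have := h (lshift m i); rewrite -[lshift m i]/(unsplit (inl i)) unsplitK.
by have := h (rshift n i); rewrite -[rshift n i]/(unsplit (inr i)) unsplitK.
Qed.

Lemma count_events_setT : count_events setT.
Proof.
exists 0%N, (fun=> set0), (fun=> 0%N); split => //.
by apply/seteqP; split => // w _; case.
Qed.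

Section atoms.
Variables (n : nat) (A : 'I_n -> set ST).
Hypothesis mA : forall i, measurable (A i).
Hypothesis WA : forall i, A i `<=` window E T.

(** The atoms of the finite algebra generated by the A i. *)
Definition set_atom (S : {set 'I_n}) : set ST :=
  window E T `&` [set x | forall i, A i x <-> i \in S].

Lemma measurable_set_atom S : measurable (set_atom S).
Proof.
have mW := @measurable_window R E T.
apply: measurableI => //.
have -> : [set x | forall i, A i x <-> i \in S] =
    \bigcap_(i in [set: 'I_n]) (if i \in S then A i else ~` A i).
  apply/seteqP; split => [x h i _|x h i].
    by case: ifPn => [/h//|iS /h]; rewrite (negbTE iS).
  by have := h i Logic.I; case: ifPn.
apply: fin_bigcap_measurable => // i _.
by case: ifPn => // _; exact: measurableC.
Qed.

Lemma trivIset_set_atom : trivIset setT set_atom.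
Proof.
move=> S S' _ _ [x [[_ h] [_ h']]]; apply/setP => i.
by apply/idP/idP => [/h/h'|/h'/h].
Qed.

Lemma set_atom_cover i : A i = \bigcup_(S in [set S : {set 'I_n} | i \in S]) set_atom S.
Proof.
apply/seteqP; split => [x Ax|x [S /= iS [_ /(_ i)[_]]]]; last exact.
pose S := [set j | `[< A j x >]]%SET.
exists S; first by rewrite /= inE; exact/asboolP.
split; first exact: WA Ax.
by move=> j; rewrite inE; split => [/asboolP|/asboolP].
Qed.

Lemma configuration_set_atom (w : config) i :
  w (A i) = \sum_(S : {set 'I_n} | i \in S) w (set_atom S).
Proof.
rewrite [in LHS]set_atom_cover measure_fin_bigcup//.
- transitivity (\sum_(S <- enum [pred S : {set 'I_n} | i \in S]) w (set_atom S)).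
    have -> : [set S : {set 'I_n} | i \in S] = [set` enum [pred S : {set 'I_n} | i \in S]].
      by apply/seteqP; split => S /=; rewrite mem_enum.
    by rewrite [RHS]fsbig_seq ?enum_uniq.
  by rewrite big_enum.
- exact: finite_finset.
- by move=> S S' _ _; exact: trivIset_set_atom.
- by move=> S _; exact: measurable_set_atom.
Qed.

End atoms.

End count_pi_system.

(** * The law of a Cox process is a mixture of Poisson laws *)

Section count_uniqueness.
Context {R : realType} (E : completeMetricType R) (T : R).
Hypothesis sE : separable E.
Local Notation ST := (space_time R E).
Local Notation config := (configuration E T).
Local Open Scope ereal_scope.

(** The definition of a Cox process gives the counts on disjoint sets only. The
counts on overlapping sets are determined by those on the atoms of the algebra
that they generate, so an event on the former is a disjoint union of events on
the latter. *)
Lemma measure_counts_unique (m1 m2 : {measure set config -> \bar R}) :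
  (forall n (A : 'I_n -> set ST) (k : 'I_n -> nat), (forall i, measurable (A i)) ->
    (forall i, A i `<=` window E T) -> trivIset setT A ->
    m1 (counts_are A k) = m2 (counts_are A k)) ->
  forall U, count_events U -> m1 U = m2 U.
Proof.
move=> m12 U [n [A [k [mA WA ->]]]].
have mAt S : measurable (set_atom T A S) by exact: measurable_set_atom.
pose B (j : 'I_#|{set 'I_n}|) : set ST := set_atom T A (enum_val j).
pose D (l : {ffun {set 'I_n} -> nat}) : set config :=
  counts_are B (fun j => l (enum_val j)).
have DP l w : D l w <-> forall S, w (set_atom T A S) = (l S)%:R%:E.
  split=> [h S|h j]; last exact: h.
  by have := h (enum_rank S); rewrite /B enum_rankK.
pose cond (l : {ffun {set 'I_n} -> nat}) :=
  [forall i : 'I_n, (\sum_(S : {set 'I_n} | i \in S) l S == k i)%N].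
(* l ranges over the counts on the atoms that are compatible with k,
   enumerated by their codes. *)
pose F j : set config := if @choice.pickle_inv {ffun {set 'I_n} -> nat} j is Some l then
  if cond l then D l else set0 else set0.
have mD l : measurable (D l) by apply: measurable_counts_are => j; exact: mAt.
have mF j : measurable (F j).
  by rewrite /F; case: choice.pickle_inv => // l; case: ifP.
have tF : trivIset setT F.
  move=> j j' _ _ [w []]; rewrite /F.
  case jl : choice.pickle_inv => [l|//]; case: ifP => // _ /DP wl.
  case jl' : choice.pickle_inv => [l'|//]; case: ifP => // _ /DP wl'.
  have ll' : l = l'.
    apply/ffunP => S; apply/eqP; rewrite -(eqr_nat R) -eqe.
    by rewrite -wl -wl'.
  have := @choice.pickle_invK {ffun {set 'I_n} -> nat} j; rewrite jl /= => <-.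
  have := @choice.pickle_invK {ffun {set 'I_n} -> nat} j'; rewrite jl' /= => <-.
  by rewrite ll'.
have sumE (w : config) (l : {ffun {set 'I_n} -> nat}) i :
    (forall S, w (set_atom T A S) = (l S)%:R%:E) ->
    w (A i) = (\sum_(S : {set 'I_n} | i \in S) l S)%N%:R%:E.
  move=> wl; rewrite (configuration_set_atom mA WA).
  rewrite natr_sum -sumEFin; apply: eq_bigr => S _; exact: wl.
have -> : counts_are A k = \bigcup_j F j.
  apply/seteqP; split => [w wk|w [j _]]; last first.
    rewrite /F; case: choice.pickle_inv => // l; case: ifP => // /forallP cl /DP wl i.
    by rewrite (sumE _ _ i wl) (eqP (cl i)).
  pose l := [ffun S => projT1 (cid (configuration_nat w (mAt S)))].
  have wl S : w (set_atom T A S) = (l S)%:R%:E.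
    by rewrite ffunE; exact: (projT2 (cid (configuration_nat w (mAt S)))).
  exists (choice.pickle l) => //; rewrite /F choice.pickleK_inv ifT; last first.
    apply/forallP => i; rewrite -(eqr_nat R) -eqe -(sumE w l i wl).
    by apply/eqP; exact: wk.
  exact/DP.
rewrite !measure_bigcup//; apply: eq_eseriesr => j _.
rewrite /F; case: choice.pickle_inv => [l|]; last by rewrite !measure0.
case: ifP => _; last by rewrite !measure0.
apply: m12 => [i|i|]; first exact: mAt.
  by move=> x [].
by move=> i j' _ _ /(trivIset_set_atom Logic.I Logic.I)/enum_val_inj.
Qed.

End count_uniqueness.

Lemma measurable_expeR (R : realType) : measurable_fun setT (@expeR R).
Proof.
have -> : @expeR R = fun x => if x == -oo%E then 0%E else er_map expR x.
  by apply/funext => -[r| |].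
apply: measurable_fun_ifT => //.
- apply: (measurable_fun_bool true).
  rewrite setTI (_ : _ @^-1` _ = [set -oo%E]); first exact: emeasurable_set1.
  by apply/seteqP; split => x /= /eqP.
- exact: (@measurable_er_map _ (measurableTypeR R) R expR (@measurable_expR R)).
Qed.

Section mixed_poisson.
Context {R : realType} (E : completeMetricType R) (T : R).
Hypothesis sE : separable E.
Local Notation ST := (space_time R E).
Local Notation config := (configuration E T).
Local Open Scope ereal_scope.
Variable mu : {finite_measure set ST -> \bar R}.
Hypothesis muW : mu (~` window E T) = 0.
Hypothesis mu_slice : forall t : R, mu (slice t) = 0.
Context d (Omega : measurableType d) (P : probability Omega R).
Variable lam : ST -> Omega -> R.
Hypothesis mlam : measurable_fun setT (fun z : ST * Omega => lam z.1 z.2).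
Hypothesis lam0 : forall x o, (0 <= lam x o)%R.

Definition total_mass o : \bar R := \int[mu]_x (lam x o)%:E.

Hypothesis mass_fin : {ae P, forall o, total_mass o < +oo}.

Definition normalizer o : \bar R := expeR (- total_mass o).

Lemma nnm_lam : nnm (fun z : ST * Omega => (lam z.1 z.2)%:E).
Proof. exact: nnm_EFin. Qed.

Lemma weight_lam o : weight (lam ^~ o).
Proof. by split => //; exact: measurable_fun_pair1 mlam. Qed.

Lemma nnm_total_mass : nnm total_mass.
Proof.
apply: (nnm_integral mu (H := fun z : Omega * ST => (lam z.2 z.1)%:E)).
apply: (nnm_comp (h := fun z : Omega * ST => (z.2, z.1)) _ nnm_lam).
exact: measurable_fun_pair.
Qed.

Lemma normalizer_fin_num o : normalizer o \is a fin_num.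
Proof.
rewrite /normalizer; have := nnm_ge0 o nnm_total_mass.
by case: (total_mass o).
Qed.

Lemma nnm_normalizer : nnm normalizer.
Proof.
split; last by move=> o; exact: expeR_ge0.
apply: (measurableT_comp (@measurable_expeR R)).
exact: (measurableT_comp (@oppe_measurable R setT) (nnm_m nnm_total_mass)).
Qed.

Lemma lam_integrable o : total_mass o < +oo -> mu.-integrable setT (EFin \o lam ^~ o).
Proof.
move=> fin; have [ml _] := weight_lam o.
apply/integrableP; split; first exact/measurable_EFinP.
by under eq_integral do rewrite /= ger0_norm//.
Qed.

Lemma normalizerE o : total_mass o < +oo ->
  normalizer o = (expR (- wint mu (lam ^~ o) (fun=> 1%R)))%:E.
Proof.
move=> fin; rewrite /normalizer /total_mass.
by rewrite -(EFin_mass (weight_lam o) (lam_integrable fin)).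
Qed.

(** The average over o of the Poisson mean of F for the intensity lam at o; the
series is multiplied by 0 when the total mass is infinite. *)
Definition mixture (F : config -> \bar R) : \bar R :=
  \int[P]_o (normalizer o * exp_add mu (lam ^~ o) F).

Lemma nnm_mixture_integrand (H : config * Omega -> \bar R) : nnm H ->
  nnm (fun o => normalizer o * exp_add mu (lam ^~ o) (fun w => H (w, o))).
Proof.
by move=> nH; apply: nnmM; [exact: nnm_normalizer | exact: nnm_exp_add_param].
Qed.

Let nnm_integrand (F : config -> \bar R) : nnm F ->
  nnm (fun o => normalizer o * exp_add mu (lam ^~ o) F).
Proof. by move=> nF; apply: (nnm_mixture_integrand (H := F \o fst)); exact: nnm_comp. Qed.

Lemma sigma_linear_mixture : sigma_linear mixture.
Proof.
have wl := weight_lam; have c0 o := nnm_ge0 o nnm_normalizer.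
split=> [F F0|c F c0' nF|F G nF nG|F nF].
- apply: integral_ge0 => o _; rewrite mule_ge0//; apply: nneseries_ge0 => n _ _.
  rewrite mule_ge0 ?lee_fin ?invr_ge0//.
  elim: n (empty_config E T) => [w|n ih w] /=; first exact: F0.
  by apply: integral_ge0 => x _; rewrite mule_ge0 ?lee_fin.
- rewrite /mixture -ge0_integralZl//.
  + by apply: eq_integral => o _; rewrite exp_addZ// muleCA.
  + exact: nnm_m (nnm_integrand nF).
  + by move=> o _; exact: nnm_ge0 (nnm_integrand nF).
- rewrite /mixture -ge0_integralD//.
  + apply: eq_integral => o _; rewrite exp_addD// ge0_muleDr//; exact: exp_add_ge0.
  + by move=> o _; exact: nnm_ge0 (nnm_integrand nF).
  + exact: nnm_m (nnm_integrand nF).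
  + by move=> o _; exact: nnm_ge0 (nnm_integrand nG).
  + exact: nnm_m (nnm_integrand nG).
- rewrite /mixture -integral_nneseries//.
  + apply: eq_integral => o _; rewrite exp_add_series//.
    rewrite -(fineK (normalizer_fin_num o)) nneseriesZl// => i _.
    exact: exp_add_ge0.
  + by move=> i; exact: nnm_m (nnm_integrand (nF i)).
  + by move=> i o _; exact: nnm_ge0 (nnm_integrand (nF i)).
Qed.

Variable N : Omega -> config.
Hypothesis mN : measurable_fun setT N.

Lemma sigma_linear_law : sigma_linear (fun F : config -> \bar R => \int[P]_o F (N o)).
Proof.
have nNF (F : config -> \bar R) : nnm F -> nnm (F \o N) by exact: nnm_comp.
split=> [F F0|c F c0 nF|F G nF nG|F nF].
- by apply: integral_ge0 => o _.
- rewrite ge0_integralZl//; first exact: (nnm_m (nNF _ nF)).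
  by move=> o _; exact: (nnm_ge0 o (nNF _ nF)).
- rewrite ge0_integralD//.
  + by move=> o _; exact: (nnm_ge0 o (nNF _ nF)).
  + exact: (nnm_m (nNF _ nF)).
  + by move=> o _; exact: (nnm_ge0 o (nNF _ nG)).
  + exact: (nnm_m (nNF _ nG)).
- rewrite integral_nneseries//.
  + by move=> i; exact: (nnm_m (nNF _ (nF i))).
  + by move=> i o _; exact: (nnm_ge0 o (nNF _ (nF i))).
Qed.

Hypothesis hcox : forall n (A : 'I_n -> set ST) (k : 'I_n -> nat),
  (forall i, measurable (A i)) -> (forall i, A i `<=` window E T) -> trivIset setT A ->
  P [set o | forall i, N o (A i) = (k i)%:R%:E] =
  \int[P]_o \prod_(i < n) poisson_weight (\int[mu]_(x in A i) (lam x o)%:E) (k i).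

Let measurable_prod_ereal (I : Type) (s : seq I) (g : I -> Omega -> \bar R) :
  (forall i, measurable_fun setT (g i)) ->
  measurable_fun setT (fun o => \prod_(i <- s) g i o).
Proof.
move=> mg; elim: s => [|i s ih].
  by under eq_fun do rewrite big_nil; exact: measurable_cst.
by under eq_fun do rewrite big_cons; exact: emeasurable_funM.
Qed.

Let measurable_expe (g : Omega -> \bar R) k : measurable_fun setT g ->
  measurable_fun setT (fun o => g o ^+ k).
Proof.
move=> mg; elim: k => [|k ih]; first by under eq_fun do rewrite expe0; exact: measurable_cst.
by under eq_fun do rewrite expeS; exact: emeasurable_funM.
Qed.

Lemma integral_part_mass o A : measurable A -> total_mass o < +oo ->
  \int[mu]_(x in A) (lam x o)%:E = (wint mu (lam ^~ o) (\1_A))%:E.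
Proof.
move=> mA fin; rewrite (EFin_wint (weight_lam o).1 (lam_integrable fin) (bdd_indic mA)).
rewrite [LHS]integral_mkcond; apply: eq_integral => x _; rewrite patchE indicE.
by case: (x \in A); rewrite ?mule1 ?mule0.
Qed.

Lemma mixture_counts n (A : 'I_n -> set ST) (k : 'I_n -> nat) :
  (forall i, measurable (A i)) -> trivIset setT A ->
  mixture (fun w => (\1_(counts_are A k) w)%:E) =
  \int[P]_o \prod_(i < n) poisson_weight (\int[mu]_(x in A i) (lam x o)%:E) (k i).
Proof.
move=> mA tA; have nI : nnm (fun w : config => (\1_(counts_are A k) w)%:E : \bar R).
  by apply: nnm_indic; exact: measurable_counts_are.
have nA i : nnm (fun o => \int[mu]_(x in A i) (lam x o)%:E).
  have -> : (fun o => \int[mu]_(x in A i) (lam x o)%:E) =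
      fun o => \int[mu]_x ((lam x o)%:E * (\1_(A i) x)%:E).
    apply/funext => o; rewrite [LHS]integral_mkcond; apply: eq_integral => x _.
    by rewrite patchE indicE; case: (x \in A i); rewrite ?mule1 ?mule0.
  apply: (nnm_integral mu (H := fun z : Omega * ST => (lam z.2 z.1)%:E * (\1_(A i) z.2)%:E)).
  apply: nnmM; last by apply: (nnm_comp _ (nnm_indic (mA i))).
  apply: (nnm_comp (h := fun z : Omega * ST => (z.2, z.1)) _ nnm_lam).
  exact: measurable_fun_pair.
apply: ge0_ae_eq_integral => //.
- exact: nnm_m (nnm_integrand nI).
- apply: measurable_prod_ereal => i; rewrite /poisson_weight.
  apply: emeasurable_funM => //; apply: emeasurable_funM.
    apply: (measurableT_comp (@measurable_expeR R)).
    exact: (measurableT_comp (@oppe_measurable R setT) (nnm_m (nA i))).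
  by apply: measurable_expe; exact: nnm_m (nA i).
- by move=> o _; exact: nnm_ge0 (nnm_integrand nI).
- move=> o _; apply: prode_ge0 => i _; rewrite /poisson_weight.
  apply: mule_ge0; last by rewrite lee_fin invr_ge0.
  apply: mule_ge0; first exact: expeR_ge0.
  by apply: expe_ge0; exact: (nnm_ge0 o (nA i)).
- apply: filterS mass_fin => o fin _.
  rewrite normalizerE// (poisson_counts sE muW mu_slice (weight_lam o) (lam_integrable fin) mA tA).
  by apply: eq_bigr => i _; rewrite integral_part_mass.
Qed.

(** Both sides are sigma-linear in F. They agree on the counting events, hence on
all events, and therefore on nonnegative measurable functions. *)
Theorem mixed_poisson_law (F : config -> \bar R) : nnm F ->
  \int[P]_o F (N o) = mixture F.
Proof.
apply: (sigma_linear_ext sigma_linear_law sigma_linear_mixture) => U mU.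
change (measure_of sigma_linear_law U = measure_of sigma_linear_mixture U).
apply: (@measure_unique _ _ _ (@count_events R E T) (fun=> setT)) => //.
- exact: count_events_generate.
- exact: count_events_setI.
- by move=> _; exact: count_events_setT.
- by rewrite bigcup_const.
- apply: measure_counts_unique => n A k mA WA tA.
  apply: (etrans _ (esym (mixture_counts k mA tA))).
  apply: (etrans _ (hcox k mA WA tA)).
  transitivity (\int[P]_o (\1_(N @^-1` counts_are A k) o)%:E).
    by apply: eq_integral => o _; congr (_%:E); apply: indic_iff.
  rewrite integral_indic ?setIT//.
  by rewrite -[X in measurable X]setTI; apply: mN => //; exact: measurable_counts_are.
- move=> _; change (\int[P]_o (\1_[set: config] (N o))%:E < +oo).
  rewrite (eq_integral (cst 1)) => [|o _]; last by rewrite indicT.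
  rewrite integral_cst// mul1e; apply: le_lt_trans (ltry 1).
  exact: probability_le1.
Qed.

End mixed_poisson.

(** * Means of Poisson functionals under comparable intensities *)

Section poisson_mean.
Context {R : realType} (E : completeMetricType R) (T : R).
Hypothesis sE : separable E.
Local Notation ST := (space_time R E).
Local Notation config := (configuration E T).
Variable mu : {finite_measure set ST -> \bar R}.
Hypothesis muW : mu (~` window E T) = 0%E.
Hypothesis mu_slice : forall t : R, mu (slice t) = 0%E.
Implicit Types (u v : config -> R) (w : config) (x y : ST).

Local Notation mass f := (wint mu f (fun=> 1)).

(** The mean of v for the Poisson process of intensity f. *)
Definition pmean (f : ST -> R) (v : config -> R) : R :=
  expR (- mass f) * fine (exp_add mu f (EFin \o v)).

Section one_intensity.
Variable f : ST -> R.
Hypothesis wf : weight f.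
Hypothesis f_int : mu.-integrable setT (EFin \o f).

Let fin v (bv : bnn v) := exp_add_fin sE wf f_int bv.

Lemma pmean_ge0 v : bnn v -> 0 <= pmean f v.
Proof.
move=> bv; rewrite mulr_ge0 ?expR_ge0//; apply: fine_ge0.
by apply: exp_add_ge0 => //; exact: bnn_nnm.
Qed.

Lemma pmeanD u v : bnn u -> bnn v -> pmean f (fun w => u w + v w) = pmean f u + pmean f v.
Proof.
move=> bu bv; rewrite /pmean -mulrDr -fineD ?fin//; congr (_ * fine _).
rewrite -(exp_addD sE mu wf (bnn_nnm bu) (bnn_nnm bv)).
by congr exp_add; apply/funext => w /=; rewrite EFinD.
Qed.

Lemma pmeanZ c v : 0 <= c -> bnn v -> pmean f (fun w => c * v w) = c * pmean f v.
Proof.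
move=> c0 bv; rewrite /pmean mulrCA; congr (_ * _).
have -> : EFin \o (fun w => c * v w) = fun w => (c%:E * (EFin \o v) w)%E.
  by apply/funext => w /=; rewrite EFinM.
by rewrite exp_addZ//; [rewrite fineM ?fin | exact: bnn_nnm].
Qed.

Lemma bnn_cst c : 0 <= c -> bnn (fun _ : config => c).
Proof. by move=> c0; split => //; exact: bdd_cst. Qed.

Lemma pmean_cst c : 0 <= c -> pmean f (fun=> c) = c.
Proof.
move=> c0; have := pmeanZ c0 (bnn_cst ler01).
have -> : (fun _ : config => c * 1) = (fun=> c) by apply/funext => w; rewrite mulr1.
move=> ->; rewrite /pmean (_ : EFin \o _ = fun=> 1%E)// exp_add1//=.
by rewrite -expRD addNr expR0 mulr1.
Qed.

Lemma pmean_sqr_shift v t : 0 <= t -> bnn v ->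
  pmean f (fun w => (v w - t) ^+ 2) =
  pmean f (fun w => v w ^+ 2) - 2 * t * pmean f v + t ^+ 2.
Proof.
move=> t0 bv; have bt : bnn (fun w => (v w - t) ^+ 2).
  split; last by move=> w; exact: sqr_ge0.
  by apply: bddX2; apply: bddB; [case: bv | exact: bdd_cst].
have t20 : 0 <= 2 * t by rewrite mulr_ge0.
have : pmean f (fun w => (v w - t) ^+ 2 + 2 * t * v w) =
    pmean f (fun w => v w ^+ 2 + t ^+ 2).
  by congr (pmean f); apply/funext => w; ring.
rewrite pmeanD//; last exact: bnnZ.
rewrite pmeanZ// pmeanD//; last 2 first.
- exact: bnnX2.
- exact: (bnn_cst (sqr_ge0 t)).
rewrite (pmean_cst (sqr_ge0 t)).
by move: (pmean f (fun w => (v w - t) ^+ 2)) (pmean f (fun w => v w ^+ 2)) (pmean f v)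
  => a b c; lra.
Qed.

Lemma pmean_poincare v : bnn v ->
  pmean f (fun w => v w ^+ 2) <= pmean f v ^+ 2 + pmean f (energy mu f v).
Proof.
move=> bv; have := poisson_poincare sE muW mu_slice wf f_int bv.
rewrite /pmean; move: (mass f) (fine (exp_add mu f (EFin \o (fun w => v w ^+ 2))))
  (fine (exp_add mu f (EFin \o v))) (fine (exp_add mu f (EFin \o energy mu f v))).
move=> L s2 s1 se h.
have eL : expR (- L) * expR L = 1 by rewrite -expRD addNr expR0.
have : expR (- L) ^+ 2 * (expR L * s2) <= expR (- L) ^+ 2 * (s1 ^+ 2 + expR L * se).
  exact: (ler_wpM2l (sqr_ge0 _) h).
have -> : expR (- L) ^+ 2 * (expR L * s2) = (expR (- L) * expR L) * (expR (- L) * s2) by ring.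
have -> : expR (- L) ^+ 2 * (s1 ^+ 2 + expR L * se) =
  (expR (- L) * s1) ^+ 2 + (expR (- L) * expR L) * (expR (- L) * se) by ring.
by rewrite eL !mul1r.
Qed.

End one_intensity.

(** A Poisson process of intensity f is one of intensity g plus an independent
Poisson process of intensity f - g, which is empty with probability
exp (int g - int f). On the series, this is monotonicity in the intensity. *)
Lemma pmean_minorization f g v : weight f -> weight g ->
  mu.-integrable setT (EFin \o f) -> mu.-integrable setT (EFin \o g) ->
  {ae mu, forall x, g x <= f x} -> bnn v ->
  expR (mass g - mass f) * pmean g v <= pmean f v.
Proof.
move=> wf wg f_int g_int gf bv; rewrite /pmean mulrA -expRD.
rewrite (_ : mass g - mass f + - mass g = - mass f); last by ring.
apply: (ler_wpM2l (expR_ge0 _)); apply: fine_le.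
- exact: exp_add_fin.
- exact: exp_add_fin.
- by apply: exp_add_le => //; exact: bnn_nnm.
Qed.

Lemma mass_le f g : weight f -> weight g ->
  mu.-integrable setT (EFin \o f) -> mu.-integrable setT (EFin \o g) ->
  {ae mu, forall x, g x <= f x} -> mass g <= mass f.
Proof.
move=> wf wg f_int g_int gf; rewrite -lee_fin !EFin_mass//.
apply: ae_ge0_le_integral => //.
- by move=> x _; rewrite lee_fin wg.2.
- by apply/measurable_EFinP; exact: wg.1.
- by move=> x _; rewrite lee_fin wf.2.
- by apply/measurable_EFinP; exact: wf.1.
- by apply: filterS gf => x gfx _; rewrite lee_fin.
Qed.

(** Let p1, p2 be the first moments of a probability and a1, a2 those of another
one, e times which is below the first; q0, q1, q2 are the moments of the
difference, whose mass is 1 - e. The Cauchy-Schwarz inequality q1^2 <= q0 q2 comes from the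
nonnegativity of q2 - 2 t q1 + t^2 q0 at t = q1 / q0. *)
Lemma doeblin_algebra (p1 p2 a1 a2 e c : R) : 0 <= e -> e <= 1 ->
  e * a1 <= p1 ->
  (forall t, 0 <= t -> e * (a2 - 2 * t * a1 + t ^+ 2) <= p2 - 2 * t * p1 + t ^+ 2) ->
  0 <= a2 - 2 * c * a1 + c ^+ 2 ->
  (p1 - (e * a1 + (1 - e) * c)) ^+ 2 <= (1 - e) * (p2 - 2 * c * p1 + c ^+ 2).
Proof.
move=> e0 e1 h1 h2 ac.
set q0 := 1 - e; set q1 := p1 - e * a1; set q2 := p2 - e * a2.
have q00 : 0 <= q0 by rewrite subr_ge0.
have q10 : 0 <= q1 by rewrite subr_ge0.
have pos t : 0 <= t -> 0 <= q2 - 2 * t * q1 + t ^+ 2 * q0.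
  by move=> /h2; rewrite /q0 /q1 /q2; lra.
have cs : q1 ^+ 2 <= q0 * q2.
  have [q0_eq0|q0_neq0] := eqVneq q0 0.
    have q1_eq0 : q1 = 0.
      apply/eqP; rewrite eq_le q10 andbT leNgt; apply/negP => q1gt0.
      have t0 : 0 <= (`|q2| + 1) / (2 * q1) by rewrite divr_ge0 ?addr_ge0 ?mulr_ge0// ltW.
      have := pos _ t0; rewrite q0_eq0 mulr0 addr0.
      rewrite (_ : 2 * _ * q1 = `|q2| + 1); last by field; rewrite gt_eqF.
      by have := ler_norm q2; lra.
    by rewrite q0_eq0 q1_eq0 mul0r expr0n.
  have q0gt0 : 0 < q0 by rewrite lt_neqAle eq_sym q0_neq0.
  have := pos (q1 / q0) (divr_ge0 q10 q00); rewrite -(pmulr_rge0 _ q0gt0).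
  rewrite [X in 0 <= X](_ : _ = q0 * q2 - q1 ^+ 2); first by rewrite subr_ge0.
  by field.
have -> : p1 - (e * a1 + q0 * c) = q1 - q0 * c by rewrite /q1; ring.
have key : (q1 - q0 * c) ^+ 2 <= q0 * (q2 - 2 * c * q1 + q0 * c ^+ 2).
  rewrite -subr_ge0.
  rewrite (_ : _ - _ = q0 * q2 - q1 ^+ 2); last by ring.
  by rewrite subr_ge0.
apply: le_trans key _; rewrite ler_wpM2l// -subr_ge0.
rewrite (_ : _ - _ = e * (a2 - 2 * c * a1 + c ^+ 2)); last by rewrite /q0 /q1 /q2; ring.
exact: mulr_ge0.
Qed.

(** The mean of a Poisson functional depends little on the intensity f >= g: it is
close to a constant that is the same for all of them. *)
Lemma pmean_variation f g v (e c : R) : weight f -> weight g ->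
  mu.-integrable setT (EFin \o f) -> mu.-integrable setT (EFin \o g) ->
  {ae mu, forall x, g x <= f x} -> 0 <= e -> e <= expR (mass g - mass f) ->
  bnn v -> 0 <= c ->
  (pmean f v - (e * pmean g v + (1 - e) * c)) ^+ 2 <=
  (1 - e) * (pmean f (fun w => v w ^+ 2) - 2 * c * pmean f v + c ^+ 2).
Proof.
move=> wf wg f_int g_int gf e0 ee bv c0.
have e1 : e <= 1.
  by rewrite (le_trans ee)// expR_le1 subr_le0; exact: mass_le.
have bt t : bnn (fun w => (v w - t) ^+ 2).
  split; last by move=> w; exact: sqr_ge0.
  by apply: bddX2; apply: bddB; [case: bv | exact: bdd_cst].
have minor u : bnn u -> e * pmean g u <= pmean f u.
  move=> bu; apply: le_trans (pmean_minorization wf wg f_int g_int gf bu).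
  by rewrite ler_wpM2r// pmean_ge0.
apply: doeblin_algebra e0 e1 (minor _ bv) _ _.
  have transport (a b a' b' : R) : a = a' -> b = b' -> e * a <= b -> e * a' <= b'.
    by move=> -> ->.
  move=> t t0.
  exact: (transport _ _ _ _ (pmean_sqr_shift wg g_int t0 bv)
    (pmean_sqr_shift wf f_int t0 bv) (minor _ (bt t))).
have transport (a b : R) : a = b -> 0 <= a -> 0 <= b by move=> ->.
exact: (transport _ _ (pmean_sqr_shift wg g_int c0 bv) (pmean_ge0 wg (bt c))).
Qed.

End poisson_mean.

(** * The Poincare inequality of a mixture *)

Section mixed_poincare.
Context {R : realType} (E : completeMetricType R) (T : R).
Hypothesis sE : separable E.
Local Notation ST := (space_time R E).
Local Notation config := (configuration E T).
Variable mu : {finite_measure set ST -> \bar R}.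
Hypothesis muW : mu (~` window E T) = 0%E.
Hypothesis mu_slice : forall t : R, mu (slice t) = 0%E.
Context d (Omega : measurableType d) (P : probability Omega R).
Variable lam : ST -> Omega -> R.
Hypothesis mlam : measurable_fun setT (fun z : ST * Omega => lam z.1 z.2).
Hypothesis lam0 : forall x o, 0 <= lam x o.

Local Notation mass f := (wint mu f (fun=> 1)).
Local Notation tm := (total_mass mu lam).
Local Notation nz := (normalizer mu lam).

Variables (alpha : ST -> R) (gam : R).
Hypothesis gam0 : 0 <= gam.
Hypothesis walpha : weight alpha.
Hypothesis alpha_int : mu.-integrable setT (EFin \o alpha).
Hypothesis alpha_le : {ae P, forall o, {ae mu, forall x, alpha x <= lam x o}}.
Hypothesis mass_le_gam : {ae P, forall o, (tm o <= (mass alpha + gam)%:E)%E}.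

(** The energy of v for the intensity lam at o, as an extended real number because
the intensity is integrable for almost all o only. *)
Definition added_energy (v : config -> R) (w : config) (o : Omega) : \bar R :=
  (\int[mu]_x ((lam x o)%:E * ((v (add_point w x) - v w) ^+ 2)%:E))%E.

Lemma nnm_added_energy v : measurable_fun setT v ->
  nnm (fun z : config * Omega => added_energy v z.1 z.2).
Proof.
move=> mv; apply: (nnm_integral mu (H := fun z : (config * Omega) * ST =>
  (lam z.2 z.1.2)%:E * ((v (add_point z.1.1 z.2) - v z.1.1) ^+ 2)%:E)%E).
apply: nnmM.
  apply: (nnm_comp (h := fun z : (config * Omega) * ST => (z.2, z.1.2)) _ (nnm_lam mlam lam0)).
  by apply: measurable_fun_pair => //; exact: measurableT_comp.
have mw : measurable_fun setT (fun z : (config * Omega) * ST => z.1.1).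
  exact: measurableT_comp.
apply: nnm_EFin; last by move=> z; exact: sqr_ge0.
apply: measurable_funX; apply: measurable_funB; last exact: measurableT_comp.
apply: measurableT_comp => //; exact: measurable_add_point_comp.
Qed.

Lemma normalizer_exp_add o (v : config -> R) : (tm o < +oo)%E -> bnn v ->
  (nz o * exp_add mu (lam ^~ o) (EFin \o v))%E = (pmean mu (lam ^~ o) v)%:E.
Proof.
move=> fin bv; have wl := weight_lam mlam lam0 o.
have li := lam_integrable mlam lam0 fin.
rewrite (normalizerE mlam lam0 fin) /pmean EFinM fineK//.
exact: (exp_add_fin sE wl li bv).
Qed.

Lemma normalizer_exp_add_energy o (v : config -> R) : (tm o < +oo)%E -> bnn v ->
  (nz o * exp_add mu (lam ^~ o) (added_energy v ^~ o))%E =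
  (pmean mu (lam ^~ o) (energy mu (lam ^~ o) v))%:E.
Proof.
move=> fin bv; have wl := weight_lam mlam lam0 o.
have li := lam_integrable mlam lam0 fin.
rewrite -(normalizer_exp_add fin (bnn_energy sE wl li bv)).
congr (_ * exp_add _ _ _)%E; apply/funext => w.
rewrite /energy /= EFin_wint//; first exact: wl.1.
by apply: bddX2; apply: bdd_difference; case: bv.
Qed.

Variable N : Omega -> config.
Hypothesis mN : measurable_fun setT N.
Hypothesis hcox : forall n (A : 'I_n -> set ST) (k : 'I_n -> nat),
  (forall i, measurable (A i)) -> (forall i, A i `<=` window E T) -> trivIset setT A ->
  P [set o | forall i, N o (A i) = (k i)%:R%:E] =
  (\int[P]_o \prod_(i < n) poisson_weight (\int[mu]_(x in A i) (lam x o)%:E) (k i))%E.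

Let mass_fin : {ae P, forall o, (tm o < +oo)%E}.
Proof. by apply: filterS mass_le_gam => o h; exact: le_lt_trans h (ltry _). Qed.

Local Notation M v := (wint P (fun=> 1) (v \o N)).

Let bdd_N v : bnn v -> bounded_measurable (v \o N).
Proof. by move=> [[mv [C vC]] _]; split; [exact: measurableT_comp|exists C => o; exact: vC]. Qed.

Let one_int : P.-integrable setT (EFin \o (fun=> 1 : R)).
Proof. exact: finite_measure_integrable_cst. Qed.

Let EFin_mean v : bnn v -> (M v)%:E = (\int[P]_o (v (N o))%:E)%E.
Proof.
move=> bv; rewrite (EFin_wint _ one_int (bdd_N bv))//.
by apply: eq_integral => o _; rewrite mul1e.
Qed.

Let mean_cst c : M (fun=> c) = c.
Proof.
apply: EFin_inj; rewrite (EFin_wint _ one_int (bdd_cst Omega c))//.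
under eq_integral do rewrite mul1e.
by rewrite integral_cst// [X in (_ * X)%E](_ : _ = 1%E) ?mule1//; exact: probability_setT.
Qed.

Let combine_bounds (e m b p1 p2 en U U' : R) :
  U = e * p2 + 2 * (1 - e) * m * p1 + b ^+ 2 ->
  U' = 2 * b * p1 + (1 - e) * m ^+ 2 ->
  (p1 - b) ^+ 2 <= (1 - e) * (p2 - 2 * m * p1 + m ^+ 2) ->
  p2 <= p1 ^+ 2 + en -> U <= U' + en.
Proof. by move=> -> ->; lra. Qed.

(** For almost every o, with p1 and p2 the Poisson means of v and of its square,
and with m = M v, [pmean_poincare] and [pmean_variation] give
p2 - 2 b p1 + b^2 <= (1 - e) (p2 - 2 m p1 + m^2) + energy. Averaged over o, the
left side is at least the variance of v. *)
Lemma mixed_poincare v : bnn v ->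
  ((expR (- gam) * (M (fun w => v w ^+ 2) - M v ^+ 2))%:E <=
   \int[P]_o (nz o * exp_add mu (lam ^~ o) (added_energy v ^~ o)))%E.
Proof.
move=> bv; set e := expR (- gam); have e0 : 0 <= e := expR_ge0 _.
have bv2 := bnnX2 bv.
have m0 : 0 <= M v by apply: wint_ge0 => // o; exact: bv.2.
have a0 : 0 <= pmean mu alpha v by exact: pmean_ge0.
have e1 : 1 - e >= 0 by rewrite subr_ge0 expR_le1 oppr_le0.
set b := e * pmean mu alpha v + (1 - e) * M v.
have b0 : 0 <= b by apply: addr_ge0; exact: mulr_ge0.
(* The inequality between means is written u <= u' + energy with nonnegative
   u and u', so that it can be integrated without integrability conditions. *)
pose c := 2 * (1 - e) * M v.
have c0 : 0 <= c by rewrite !mulr_ge0.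
have c'0 : 0 <= 2 * b by rewrite mulr_ge0.
have c''0 : 0 <= (1 - e) * M v ^+ 2 by rewrite mulr_ge0// sqr_ge0.
pose u1 w := e * v w ^+ 2 + c * v w; pose u w := u1 w + b ^+ 2.
pose u' w := 2 * b * v w + (1 - e) * M v ^+ 2.
have be2 := bnnZ e0 bv2; have bcv := bnnZ c0 bv; have bbv := bnnZ c'0 bv.
have bu1 : bnn u1 := bnnD be2 bcv.
have bb := @bnn_cst R E T _ (sqr_ge0 b); have bm := @bnn_cst R E T _ c''0.
have bu : bnn u := bnnD bu1 bb.
have bu' : bnn u' := bnnD bbv bm.
have Mu : M u = e * M (fun w => v w ^+ 2) + c * M v + b ^+ 2.
  have one0 : measurable_fun setT (fun _ : Omega => 1 : R) by exact: measurable_cst.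
  have p1 : forall o : Omega, 0 <= (1 : R) by [].
  apply: (etrans (wintD one0 one_int (bdd_N bu1) (bdd_N bb))).
  rewrite (wintD one0 one_int (bdd_N be2) (bdd_N bcv)).
  by rewrite (wintZ one0 one_int _ (bdd_N bv2)) (wintZ one0 one_int _ (bdd_N bv)) mean_cst.
have Mu' : M u' = 2 * b * M v + (1 - e) * M v ^+ 2.
  have one0 : measurable_fun setT (fun _ : Omega => 1 : R) by exact: measurable_cst.
  apply: (etrans (wintD one0 one_int (bdd_N bbv) (bdd_N bm))).
  by rewrite (wintZ one0 one_int _ (bdd_N bv)) mean_cst.
have nn (H : config * Omega -> \bar R) : nnm H ->
    nnm (fun o => nz o * exp_add mu (lam ^~ o) (fun w => H (w, o)))%E.
  exact: (nnm_mixture_integrand sE mu mlam lam0).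
have nnv (g : config -> R) : bnn g -> nnm (fun o => nz o * exp_add mu (lam ^~ o) (EFin \o g))%E.
  by move=> bg; apply: (nn (EFin \o g \o fst)); apply: nnm_comp => //; exact: bnn_nnm.
have nen := nn _ (nnm_added_energy bv.1.1).
set EN := (X in (_ <= X)%E).
have key : ((M u)%:E <= (M u')%:E + EN)%E.
  rewrite !EFin_mean// (mixed_poisson_law sE muW mu_slice mlam lam0 mass_fin mN hcox (bnn_nnm bu)).
  rewrite (mixed_poisson_law sE muW mu_slice mlam lam0 mass_fin mN hcox (bnn_nnm bu')).
  rewrite /mixture /EN -ge0_integralD//; last 4 first.
  - by move=> o _; exact: (nnm_ge0 o (nnv _ bu')).
  - exact: nnm_m (nnv _ bu').
  - by move=> o _; exact: (nnm_ge0 o nen).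
  - exact: nnm_m nen.
  apply: ae_ge0_le_integral => //.
  - by move=> o _; exact: (nnm_ge0 o (nnv _ bu)).
  - exact: nnm_m (nnv _ bu).
  - by move=> o _; exact: (nnm_ge0 o (nnmD (nnv _ bu') nen)).
  - exact: nnm_m (nnmD (nnv _ bu') nen).
  apply: filterS3 mass_fin alpha_le mass_le_gam => o fin al mg _.
  rewrite (normalizer_exp_add fin bu) (normalizer_exp_add fin bu').
  rewrite (normalizer_exp_add_energy fin bv) -EFinD lee_fin.
  have wl := weight_lam mlam lam0 o; have li := lam_integrable mlam lam0 fin.
  have e_le : e <= expR (mass alpha - mass (lam ^~ o)).
    rewrite ler_expR -lerN2 opprB lerBlDl opprK -lee_fin.
    by rewrite (EFin_mass wl li).
  have var := pmean_variation sE wl walpha li alpha_int al e0 e_le bv m0.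
  have poi := pmean_poincare sE muW mu_slice wl li bv.
  have uE : pmean mu (lam ^~ o) u = e * pmean mu (lam ^~ o) (fun w => v w ^+ 2) +
      c * pmean mu (lam ^~ o) v + b ^+ 2.
    apply: (etrans (pmeanD sE wl li bu1 bb)).
    apply: f_equal2; last exact: (pmean_cst T sE wl li (sqr_ge0 b)).
    apply: (etrans (pmeanD sE wl li be2 bcv)).
    by apply: f_equal2; exact: (pmeanZ sE wl li).
  have u'E : pmean mu (lam ^~ o) u' = 2 * b * pmean mu (lam ^~ o) v + (1 - e) * M v ^+ 2.
    apply: (etrans (pmeanD sE wl li bbv bm)).
    apply: f_equal2; last exact: (pmean_cst T sE wl li c''0).
    exact: (pmeanZ sE wl li).
  exact: (combine_bounds uE u'E var poi).
have : EN = EN by []; case: {2}EN => [en| |] ENE.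
- move: key; rewrite ENE -EFinD !lee_fin Mu Mu' /c.
  have alg (e' m m2 b' : R) : e' * m2 + 2 * (1 - e') * m * m + b' ^+ 2 <=
      2 * b' * m + (1 - e') * m ^+ 2 + en -> e' * (m2 - m ^+ 2) <= en.
    by move=> h; have := sqr_ge0 (m - b'); lra.
  exact: alg.
- by rewrite ENE leey.
- have : (0 <= EN)%E by apply: integral_ge0 => o _; exact: (nnm_ge0 o nen).
  by rewrite ENE.
Qed.

End mixed_poincare.

(** * The Papangelou intensity *)

Section inverse.
Context d (Z : measurableType d) {R : realType}.
Local Open Scope ereal_scope.

(** On positive reals the inverse is exp (- ln x), whose measurability is known. *)
Lemma nnm_inve (F : Z -> \bar R) : nnm F -> nnm (fun z => (F z)^-1).
Proof.
move=> [mF F0]; split; last by move=> z; rewrite inve_ge0.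
rewrite (_ : (fun z => _) = fun z => if F z == 0 then +oo else
    if F z == +oo then 0 else (expR (- ln (fine (F z))))%:E).
  apply: measurable_fun_ifT => //; first exact: measurable_fun_eqe.
  apply: measurable_fun_ifT => //; first exact: measurable_fun_eqe.
  apply/measurable_EFinP; apply: (measurableT_comp (@measurable_expR R)).
  apply: measurable_funN; apply: (measurableT_comp (@measurable_ln R)).
  exact: measurableT_comp.
apply/funext => z; have := F0 z; case: (F z) => [r| |//].
  rewrite lee_fin inver eqe; case: eqVneq => //= r0 r_ge0.
  have rgt0 : (0 < r)%R by rewrite lt_neqAle eq_sym r0.
  by rewrite -lnV// lnK// posrE invr_gt0.
by rewrite invey eqxx.
Qed.

End inverse.

Section papangelou.
Context {R : realType} (E : completeMetricType R) (T : R).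
Hypothesis sE : separable E.
Local Notation ST := (space_time R E).
Local Notation config := (configuration E T).
Local Open Scope ereal_scope.
Variable mu : {finite_measure set ST -> \bar R}.
Hypothesis muW : mu (~` window E T) = 0.
Hypothesis mu_slice : forall t : R, mu (slice t) = 0.
Context d (Omega : measurableType d) (P : probability Omega R).
Variable lam : ST -> Omega -> R.
Hypothesis mlam : measurable_fun setT (fun z : ST * Omega => lam z.1 z.2).
Hypothesis lam0 : forall x o, (0 <= lam x o)%R.

Local Notation nz := (normalizer mu lam).

(** The density at w, given lam at o, of the process with respect to the unit
intensity. *)
Definition lik (w : config) o : \bar R := nz o * (prod_weight (lam ^~ o) w)%:E.

Definition mean_lik w : \bar R := \int[P]_o lik w o.

Definition mean_lik_add p w : \bar R := \int[P]_o (lik w o * (lam p o)%:E).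

Definition papangelou p w : \bar R :=
  \int[P]_o (lik w o / mean_lik w * (lam p o)%:E).

Lemma nnm_lik : nnm (fun z : config * Omega => lik z.1 z.2).
Proof.
apply: nnmM; last exact: nnm_prod_weight_param.
exact: nnm_comp (nnm_normalizer mu mlam lam0).
Qed.

Lemma lik_ge0 w o : 0 <= lik w o. Proof. exact: (nnm_ge0 (w, o) nnm_lik). Qed.

Lemma nnm_lik_at w : nnm (lik w).
Proof. exact: (nnm_comp (pair1_measurable w) nnm_lik). Qed.

Lemma nnm_mean_lik : nnm mean_lik.
Proof. exact: (nnm_integral P nnm_lik). Qed.

Lemma nnm_lam_at p : nnm (fun o => (lam p o)%:E).
Proof. exact: (nnm_comp (pair1_measurable p) (nnm_lam mlam lam0)). Qed.

Lemma nnm_mean_lik_add : nnm (fun z : config * ST => mean_lik_add z.2 z.1).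
Proof.
apply: (nnm_integral P (H := fun z : (config * ST) * Omega =>
  lik z.1.1 z.2 * (lam z.1.2 z.2)%:E)).
apply: nnmM.
  apply: (nnm_comp (h := fun z : (config * ST) * Omega => (z.1.1, z.2)) _ nnm_lik).
  by apply: measurable_fun_pair => //; exact: measurableT_comp.
apply: (nnm_comp (h := fun z : (config * ST) * Omega => (z.1.2, z.2)) _ (nnm_lam mlam lam0)).
by apply: measurable_fun_pair => //; exact: measurableT_comp.
Qed.

Lemma papangelouE p w : papangelou p w = (mean_lik w)^-1 * mean_lik_add p w.
Proof.
have nl := nnmM (nnm_lik_at w) (nnm_lam_at p).
rewrite /papangelou /mean_lik_add -ge0_integralZl//.
- by apply: eq_integral => o _; rewrite muleAC muleC.
- exact: nnm_m nl.
- by move=> o _; exact: (nnm_ge0 o nl).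
- by rewrite inve_ge0; exact: nnm_ge0 nnm_mean_lik.
Qed.

Lemma nnm_papangelou : nnm (fun z : config * ST => papangelou z.2 z.1).
Proof.
under eq_fun do rewrite papangelouE.
apply: nnmM nnm_mean_lik_add; apply: nnm_inve.
exact: nnm_comp nnm_mean_lik.
Qed.

Lemma lik_add w p o : addable w p -> lik (add_point w p) o = lik w o * (lam p o)%:E.
Proof. by move=> wp; rewrite /lik prod_weight_add// EFinM -!muleA [X in _ * X]muleC. Qed.

(** Adding p multiplies the likelihood by the intensity at p. *)
Lemma mean_likD w p : addable w p -> mean_lik (add_point w p) = mean_lik_add p w.
Proof. by move=> wp; apply: eq_integral => o _; rewrite lik_add. Qed.

(** If the mean likelihood vanishes at w, the likelihood vanishes almost surely and
both sides are 0, in accordance with 0 / 0 = 0. An infinite mean likelihood is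
excluded, as its inverse is 0. *)
Lemma mean_lik_papangelou p w : mean_lik w < +oo ->
  mean_lik w * papangelou p w = mean_lik_add p w.
Proof.
move=> fin; have nl := nnm_lik_at w; have ml0 := nnm_ge0 w nnm_mean_lik.
rewrite papangelouE muleA; have [z|nz0] := eqVneq (mean_lik w) 0; last first.
  by rewrite [X in X * _]muleC mulVe// ?mul1e ?ge0_fin_numE.
rewrite z mul0e mul0e; apply/esym.
have : ae_eq P setT (lik w) (cst 0).
  apply/ae_eq_integral_abs => //; first exact: nnm_m nl.
  by under eq_integral do rewrite (gee0_abs (lik_ge0 _ _)).
move=> l0; rewrite /mean_lik_add -(integral0 P setT); apply: ae_eq_integral => //.
  exact: nnm_m (nnmM nl (nnm_lam_at p)).
by apply: filterS l0 => o /= -> //; rewrite mul0e.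
Qed.

(** The likelihood ratio has mean 1, or vanishes almost surely. *)
Lemma papangelou_le p w (b : R) : (0 <= b)%R -> {ae P, forall o, (lam p o <= b)%R} ->
  papangelou p w <= b%:E.
Proof.
move=> b0 lb; have nl := nnm_lik_at w; have ml0 := nnm_ge0 w nnm_mean_lik.
have le : mean_lik_add p w <= mean_lik w * b%:E.
  rewrite /mean_lik -ge0_integralZr//; last 2 first.
  - exact: nnm_m nl.
  - by move=> o _; exact: lik_ge0.
  have nll := nnmM nl (nnm_lam_at p).
  have nlb : nnm (fun o => lik w o * b%:E) by apply: nnmM => //; exact: nnm_cst.
  apply: ae_ge0_le_integral => //.
  - by move=> o _; exact: (nnm_ge0 o nll).
  - exact: nnm_m nll.
  - by move=> o _; exact: (nnm_ge0 o nlb).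
  - exact: nnm_m nlb.
  - by apply: filterS lb => o h _; rewrite lee_wpmul2l// ?lee_fin// lik_ge0.
have a0 := nnm_ge0 (w, p) nnm_mean_lik_add.
rewrite papangelouE; case: (mean_lik w) ml0 le => [r| |//] r0 le.
- have [z|nz0] := eqVneq r 0%R.
    move: le; rewrite z mul0e => le; rewrite (_ : mean_lik_add p w = 0) ?mule0 ?lee_fin//.
    by apply/eqP; rewrite eq_le le.
  have rgt0 : (0 < r)%R by rewrite lt_neqAle eq_sym nz0.
  rewrite inver (negbTE nz0); apply: le_trans (lee_wpmul2l _ le) _.
    by rewrite lee_fin invr_ge0 ltW.
  by rewrite -!EFinM lee_fin mulrA mulVf// mul1r.
- by rewrite invey mul0e lee_fin.
Qed.

End papangelou.

(** * The identity of the Papangelou intensity *)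

Section mecke_identity.
Context {R : realType} (E : completeMetricType R) (T : R).
Hypothesis sE : separable E.
Local Notation ST := (space_time R E).
Local Notation config := (configuration E T).
Local Open Scope ereal_scope.

Lemma addable_remove_self (w : config) p : supp w p -> p.1 != 0%R -> w (slice p.1) <= 1 ->
  addable (remove_point w p) p.
Proof.
move=> wp p0 w1; split => //; first exact: (supp_window sE wp).
have ms := measurable_slice p.1 : measurable (slice p.1 : set ST).
have : w (slice p.1) = w (slice p.1 `\ p) + 1.
  by rewrite (measureD1 sE w p ms) asboolT// diracE mem_set.
rewrite remove_pointE// => ws; move: w1; rewrite ws.
have [n ->] := configuration_nat w (measurableD ms (measurable_st_set1 p sE)).
by rewrite -EFinD lee_fin gerDr -(mulr0n 1%R) ler_nat leqn0 => /eqP ->.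
Qed.

Lemma addable_remove_supp (w : config) p : supp w p -> addable (remove_point w p) p.
Proof.
move=> wp; have [_ _ w0 w1 _] := configurationP w.
apply: addable_remove_self => //; last exact: w1.
by apply: (measure_slice0 sE w 0%R).1.
Qed.

Lemma add_remove_point (w : config) p : supp w p ->
  weq (add_point (remove_point w p) p) w.
Proof.
move=> wp A mA; rewrite (add_pointE sE (addable_remove_supp wp) mA) remove_pointE//.
by rewrite [RHS](measureD1 sE w p mA) asboolT.
Qed.

Variable mu : {finite_measure set ST -> \bar R}.
Hypothesis muW : mu (~` window E T) = 0.
Hypothesis mu_slice : forall t : R, mu (slice t) = 0.
Context d (Omega : measurableType d) (P : probability Omega R).
Variable lam : ST -> Omega -> R.
Hypothesis mlam : measurable_fun setT (fun z : ST * Omega => lam z.1 z.2).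
Hypothesis lam0 : forall x o, (0 <= lam x o)%R.
Hypothesis mass_fin : {ae P, forall o, total_mass mu lam o < +oo}.
Variable beta : ST -> R.
Hypothesis lam_le : {ae mu, forall x, {ae P, forall o, (lam x o <= beta x)%R}}.
Variable N : Omega -> config.
Hypothesis mN : measurable_fun setT N.
Hypothesis hcox : forall n (A : 'I_n -> set ST) (k : 'I_n -> nat),
  (forall i, measurable (A i)) -> (forall i, A i `<=` window E T) -> trivIset setT A ->
  P [set o | forall i, N o (A i) = (k i)%:R%:E] =
  \int[P]_o \prod_(i < n) poisson_weight (\int[mu]_(x in A i) (lam x o)%:E) (k i).

Local Notation nz := (normalizer mu lam).
Local Notation lik := (@lik R E T mu d Omega lam).
Local Notation mean_lik := (@mean_lik R E T mu d Omega P lam).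
Local Notation mean_lik_add := (@mean_lik_add R E T mu d Omega P lam).
Local Notation papangelou := (@papangelou R E T mu d Omega P lam).
Local Notation exp1 := (exp_add mu (fun=> 1%R)).

Let nnm_ml : nnm mean_lik := nnm_mean_lik T sE mu P mlam lam0.
Let nnm_mla : nnm_field mean_lik_add := nnm_mean_lik_add T sE mu P mlam lam0.

(** The law of N has density [mean_lik] with respect to the unit intensity. *)
Lemma law_density (F : config -> \bar R) : nnm F -> \int[P]_o F (N o) = exp1 (fun w => mean_lik w * F w).
Proof.
move=> nF; rewrite (mixed_poisson_law sE muW mu_slice mlam lam0 mass_fin mN hcox nF).
have nn := nnm_normalizer mu mlam lam0.
have nFfst : nnm (fun z : config * Omega => F z.1) by exact: nnm_comp.
apply: (etrans (exp_add_mixture sE muW mu_slice P mlam lam0 nn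
  (normalizer_fin_num mu mlam lam0) nFfst)).
congr exp_add; apply/funext => w; rewrite /mean_lik -ge0_integralZr//.
- exact: nnm_m (nnm_lik_at sE mu mlam lam0 w).
- by move=> o _; exact: lik_ge0.
- exact: nnm_ge0 nF.
Qed.

(* Configurations whose atoms avoid the null set of points where lam exceeds
   beta with positive probability; their mean likelihood is finite. *)
Let dominated (w : config) := {ae P, forall o, forall x, supp w x -> (lam x o <= beta x)%R}.

Let dominated_empty : dominated (empty_config E T).
Proof. by apply: aeW => o x; rewrite supp_empty. Qed.

Let dominated_add w : dominated w -> {ae mu, forall x, dominated (add_point w x)}.
Proof.
move=> dw; apply: filterS2 (ae_addable sE muW mu_slice w) lam_le => x wx lx.
apply: filterS2 dw lx => o dwo lxo y; rewrite supp_add_point// => -[->//|].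
exact: dwo.
Qed.

Let dominated_fin w : dominated w -> mean_lik w < +oo.
Proof.
move=> dw; pose C := prod_weight (fun x => `|beta x|%R) w.
have nC : nnm (fun _ : Omega => C%:E).
  by apply: nnm_cst; rewrite lee_fin prod_weight_ge0.
apply: (@le_lt_trans _ _ (\int[P]_o C%:E)).
  have nl := nnm_lik_at sE mu mlam lam0 w.
  apply: ae_ge0_le_integral => //.
  - by move=> o _; exact: (nnm_ge0 o nl).
  - exact: nnm_m nl.
  - by move=> o _; exact: (nnm_ge0 o nC).
  - apply: filterS dw => o dwo _; rewrite /lik -[leRHS]mul1e.
    apply: lee_pmul.
    + exact: nnm_ge0 (nnm_normalizer mu mlam lam0).
    + by rewrite lee_fin prod_weight_ge0.
    + rewrite /normalizer; case: (total_mass mu lam o) (nnm_ge0 o (nnm_total_mass mu mlam lam0)) => //= r.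
      by rewrite !lee_fin expR_le1 oppr_le0.
    + rewrite lee_fin; apply: prod_weight_le => // x wx.
      by apply: le_trans (ler_norm _); exact: dwo.
rewrite integral_cst// [X in _ * X](_ : _ = 1) ?mule1 ?ltry//; exact: probability_setT.
Qed.

Lemma papangelou_field (X : ST -> config -> \bar R) : nnm_field X ->
  \int[P]_o \int[mu]_p (X p (N o) * papangelou p (N o)) =
  exp1 (fun w => \int[mu]_p (X p w * mean_lik_add p w)).
Proof.
move=> nX; have npi : nnm_field papangelou := nnm_papangelou T sE mu P mlam lam0.
have nXp : nnm_field (fun p w => X p w * papangelou p w) := nnmM nX npi.
have nXl : nnm_field (fun p w => X p w * mean_lik_add p w) := nnmM nX nnm_mla.
rewrite (law_density (nnm_field_integral mu nXp)).
apply: (exp_add_ae sE (@weight1 R E) _ _ dominated_add _ dominated_empty).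
- exact: (nnmM nnm_ml (nnm_field_integral mu nXp)).
- exact: (nnm_field_integral mu nXl).
move=> w /dominated_fin fin; rewrite /field_integral -ge0_integralZl//.
- apply: eq_integral => p _.
  by rewrite muleCA (mean_lik_papangelou sE mlam lam0 p fin).
- exact: nnm_m (nnm_comp (pair1_measurable w) nXp).
- by move=> p _; exact: (nnm_ge0 (w, p) nXp).
- exact: nnm_ge0 nnm_ml.
Qed.

(** The formula of Mecke for the unit intensity, applied to X times the density
after the addition of the point: an atom p of w satisfies
w = (w - p) + p. *)
Theorem papangelou_identity (X : ST -> config -> \bar R) : nnm_field X ->
  \int[P]_o \int[N o]_p X p (remove_point (N o) p) =
  \int[P]_o \int[mu]_p (X p (N o) * papangelou p (N o)).
Proof.
move=> nX; rewrite papangelou_field//.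
rewrite (law_density (F := atom_sum X) (nnm_atom_sum sE nX)).
pose Y p w := X p w * mean_lik (add_point w p).
have nY : nnm_field Y.
  apply: nnmM nX _; apply: (nnm_comp (h := fun z : config * ST => add_point z.1 z.2) _ nnm_ml).
  exact: measurable_add_point_comp.
have -> : (fun w => mean_lik w * atom_sum X w) = atom_sum Y.
  apply/funext => w; rewrite !atom_sumE// ge0_mule_fsumr; last first.
    by move=> p; exact: (nnm_ge0 ((remove_point w p, p) : config * ST) nX).
  apply: eq_fsbigr => p; rewrite inE => wp.
  rewrite /Y (weq_emeasurable (nnm_m nnm_ml) (add_remove_point wp)).
  exact: muleC.
rewrite (exp_add_atom_sum sE muW mu_slice nY).
apply: (congr1 exp1); apply/funext => w.
apply: ge0_ae_eq_integral => //.
- exact: nnm_m (nnm_comp (pair1_measurable w) nY).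
- exact: nnm_m (nnm_comp (pair1_measurable w) (nnmM nX nnm_mla)).
- by move=> p _; exact: (nnm_ge0 (w, p) nY).
- by move=> p _; exact: (nnm_ge0 (w, p) (nnmM nX nnm_mla)).
- apply: filterS (ae_addable sE muW mu_slice w) => p wp _.
  by rewrite /Y mean_likD.
Qed.

(** The means of the integral of X against pi dx and against lam dx are equal. *)
Lemma papangelou_mixture (X : ST -> config -> \bar R) : nnm_field X ->
  \int[P]_o \int[mu]_p (X p (N o) * papangelou p (N o)) =
  \int[P]_o (nz o * exp_add mu (lam ^~ o) (fun w => \int[mu]_p ((lam p o)%:E * X p w))).
Proof.
move=> nX; rewrite papangelou_field//.
pose H (z : config * Omega) := \int[mu]_p ((lam p z.2)%:E * X p z.1).
have nH2 : nnm (fun z : (config * Omega) * ST => (lam z.2 z.1.2)%:E * X z.2 z.1.1).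
  apply: nnmM.
    apply: (nnm_comp (h := fun z : (config * Omega) * ST => (z.2, z.1.2)) _ (nnm_lam mlam lam0)).
    by apply: measurable_fun_pair => //; exact: measurableT_comp.
  apply: (nnm_comp (h := fun z : (config * Omega) * ST => (z.1.1, z.2)) _ nX).
  by apply: measurable_fun_pair => //; exact: measurableT_comp.
have nH : nnm H := nnm_integral mu nH2.
have nn := nnm_normalizer mu mlam lam0.
apply/esym; apply: (etrans (exp_add_mixture sE muW mu_slice P mlam lam0 nn
  (normalizer_fin_num mu mlam lam0) nH)).
congr exp_add; apply/funext => w.
have nl := nnm_lik_at sE mu mlam lam0 w.
pose K (z : Omega * ST) := lik w z.1 * ((lam z.2 z.1)%:E * X z.2 w).
have nK : nnm K.
  apply: nnmM; first exact: nnm_comp nl.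
  apply: (nnm_comp (h := fun z : Omega * ST => ((w, z.1), z.2)) _ nH2).
  by apply: measurable_fun_pair => //; apply: measurable_fun_pair.
transitivity (\int[P]_o \int[mu]_p K (o, p)).
  apply: eq_integral => o _; rewrite /H /K -ge0_integralZl//.
  - exact: nnm_m (nnm_comp (pair1_measurable (w, o)) nH2).
  - by move=> p _; exact: (nnm_ge0 ((w, o), p) nH2).
  - exact: (nnm_ge0 o nl).
rewrite (@fubini_tonelli _ _ _ _ _ P mu K (nnm_m nK) (fun z => nnm_ge0 z nK)).
apply: eq_integral => p _; rewrite /mean_lik_add muleC -ge0_integralZr//.
- by apply: eq_integral => o _; rewrite /K muleA.
- exact: nnm_m (nnmM nl (nnm_lam_at mlam lam0 p)).
- by move=> o _; exact: (nnm_ge0 o (nnmM nl (nnm_lam_at mlam lam0 p))).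
- exact: (nnm_ge0 (w, p) nX).
Qed.

End mecke_identity.

(** * Truncation of square-integrable variables *)

Section clipping.
Context {R : realType}.
Implicit Types (n : nat) (x y : R).

Definition clip n x : R := Num.max (- n%:R) (Num.min x n%:R).

Lemma clip_bound n x : - n%:R <= clip n x <= n%:R.
Proof.
have n0 : 0 <= n%:R :> R by exact: ler0n.
rewrite /clip le_max lexx/= ge_max ge_min lexx orbT andbT.
by apply: le_trans n0; rewrite oppr_le0.
Qed.

Lemma clip_norm n x : `|clip n x| <= `|x|.
Proof.
have n0 : 0 <= n%:R :> R by exact: ler0n.
have [x1 x2] : - `|x| <= x /\ x <= `|x| by rewrite ler_norm lerNl -normrN ler_norm.
have a0 := normr_ge0 x; rewrite ler_norml /clip.
move: `|x| x1 x2 a0 => a x1 x2 a0.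
by case: (leP x n%:R) => h; [case: (leP (- n%:R) x) => h'|case: (leP (- n%:R) n%:R) => h'];
  apply/andP; split; lra.
Qed.

Lemma clip_lipschitz n x y : `|clip n x - clip n y| <= `|x - y|.
Proof.
have n0 : 0 <= n%:R :> R by exact: ler0n.
wlog xy : x y / x <= y => [h|].
  by have [xy|/ltW xy] := leP x y; [exact: h|rewrite distrC [leRHS]distrC; exact: h].
rewrite [leRHS]distrC [leRHS]ger0_norm ?subr_ge0// ler_norml /clip.
by case: (leP x n%:R) => h1; case: (leP y n%:R) => h2;
  do ?[case: (leP (- n%:R) x) => h3]; do ?[case: (leP (- n%:R) y) => h4];
  do ?[case: (leP (- n%:R) n%:R) => h5]; apply/andP; split; lra.
Qed.

Lemma clip_id n x : `|x| <= n%:R -> clip n x = x.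
Proof. by rewrite ler_norml /clip => /andP[h1 h2]; rewrite min_l// max_r. Qed.

Lemma clip_cvg x : clip n x @[n --> \oo] --> x.
Proof.
apply: cvg_near_cst; exists (Num.truncn `|x|).+1 => // n /= xn; rewrite clip_id//.
by apply: le_trans (ltW (truncnS_gt _)) _; rewrite ler_nat.
Qed.

Lemma measurable_clip n : measurable_fun setT (clip n).
Proof. by apply: measurable_maxr => //; exact: measurable_minr. Qed.

End clipping.

Section variance_truncation.
Context d (Omega : measurableType d) {R : realType} (P : probability Omega R).
Variable X : Omega -> R.
Hypothesis mX : measurable_fun setT X.
Hypothesis X2_fin : (\int[P]_o ((X o) ^+ 2)%:E < +oo)%E.

Lemma integrable_sqr : P.-integrable setT (EFin \o (fun o => X o ^+ 2)).
Proof.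
apply/integrableP; split; first by apply/measurable_EFinP; exact: measurable_funX.
by under eq_integral do rewrite /= ger0_norm ?sqr_ge0//.
Qed.

Lemma integrable_of_sqr : P.-integrable setT (EFin \o X).
Proof.
have i1 : P.-integrable setT (EFin \o (fun=> 1 : R)) by exact: finite_measure_integrable_cst.
apply: (le_integrable measurableT _ _ (integrableD measurableT i1 integrable_sqr)).
  exact/measurable_EFinP.
move=> o _; rewrite /= lee_fin [leRHS]ger0_norm; last by rewrite addr_ge0// sqr_ge0.
by rewrite ler_norml; nra.
Qed.

Local Notation mean f := (\int[P]_o f o).

Lemma variance_mean : 'V_P[X] = (mean (fun o => X o ^+ 2) - mean X ^+ 2)%:E.
Proof.
have X1 : X \in Lfun P 1 by apply/Lfun1_integrable; exact: integrable_of_sqr.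
have XX : X * X \in Lfun P 1.
  apply/Lfun1_integrable; have := integrable_sqr; congr (_.-integrable _ _).
have e1 : (mean X)%:E = (\int[P]_o (X o)%:E)%E.
  by rewrite fineK//; exact: (integrable_fin_num measurableT integrable_of_sqr).
have e2 : (mean (fun o => X o ^+ 2))%:E = (\int[P]_o (X o ^+ 2)%:E)%E.
  by rewrite fineK//; exact: (integrable_fin_num measurableT integrable_sqr).
by rewrite /variance covarianceE// EFinB e2 expr2 [((mean X) * _)%:E]EFinM e1 !unlock.
Qed.

(** Dominated convergence, with the square and the absolute value as bounds. *)
Lemma variance_truncation :
  mean (fun o => clip n (X o) ^+ 2) - mean (fun o => clip n (X o)) ^+ 2 @[n --> \oo] -->
  mean (fun o => X o ^+ 2) - mean X ^+ 2.
Proof.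
have mc n : measurable_fun setT (fun o => clip n (X o)).
  by apply: measurableT_comp => //; exact: measurable_clip.
have fin_sqr := integrable_fin_num measurableT integrable_sqr.
have fin := integrable_fin_num measurableT integrable_of_sqr.
have sqr_cvg : mean (fun o => clip n (X o) ^+ 2) @[n --> \oo] --> mean (fun o => X o ^+ 2).
  apply: fine_cvg; rewrite fineK//.
  have [|||||_ _ //] := @dominated_convergence _ _ _ P setT measurableT
    (fun n o => (clip n (X o) ^+ 2)%:E) (fun o => (X o ^+ 2)%:E) (fun o => (X o ^+ 2)%:E).
  - by move=> n; apply/measurable_EFinP; exact: measurable_funX.
  - by apply/measurable_EFinP; exact: measurable_funX.
  - apply: aeW => o _; apply: cvg_EFin; first exact: nearW.
    by under eq_fun do rewrite /= expr2; rewrite expr2; apply: cvgM; exact: clip_cvg.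
  - exact: integrable_sqr.
  - apply: aeW => o n _; rewrite abse_EFin lee_fin ger0_norm ?sqr_ge0//.
    by rewrite -real_normK ?num_real// -[leRHS]real_normK ?num_real// lerXn2r ?nnegrE// clip_norm.
have mean_cvg : mean (fun o => clip n (X o)) @[n --> \oo] --> mean X.
  apply: fine_cvg; rewrite fineK//.
  have [|||||_ _ //] := @dominated_convergence _ _ _ P setT measurableT
    (fun n o => (clip n (X o))%:E) (fun o => (X o)%:E) (fun o => `|X o|%:E).
  - by move=> n; apply/measurable_EFinP.
  - exact/measurable_EFinP.
  - by apply: aeW => o _; apply: cvg_EFin; [exact: nearW|exact: clip_cvg].
  - exact: (integrable_abse integrable_of_sqr).
  - by apply: aeW => o n _; rewrite abse_EFin lee_fin clip_norm.
by apply: cvgB => //; under eq_fun do rewrite expr2; rewrite expr2; exact: cvgM.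
Qed.

End variance_truncation.

(** * The variance bound for square-integrable functionals *)

Section square_integrable_poincare.
Context {R : realType} (E : completeMetricType R) (T : R).
Hypothesis sE : separable E.
Local Notation ST := (space_time R E).
Local Notation config := (configuration E T).
Variable mu : {finite_measure set ST -> \bar R}.
Hypothesis muW : mu (~` window E T) = 0%E.
Hypothesis mu_slice : forall t : R, mu (slice t) = 0%E.
Context d (Omega : measurableType d) (P : probability Omega R).
Variable lam : ST -> Omega -> R.
Hypothesis mlam : measurable_fun setT (fun z : ST * Omega => lam z.1 z.2).
Hypothesis lam0 : forall x o, 0 <= lam x o.
Variables (alpha beta : ST -> R) (gam : R).
Hypothesis gam0 : 0 <= gam.
Hypothesis walpha : weight alpha.
Hypothesis alpha_int : mu.-integrable setT (EFin \o alpha).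
Hypothesis alpha_le : {ae P, forall o, {ae mu, forall x, alpha x <= lam x o}}.
Hypothesis mass_le_gam : {ae P, forall o,
  (total_mass mu lam o <= (wint mu alpha (fun=> 1) + gam)%:E)%E}.
Hypothesis lam_le : {ae mu, forall x, {ae P, forall o, lam x o <= beta x}}.
Variable N : Omega -> config.
Hypothesis mN : measurable_fun setT N.
Hypothesis hcox : forall n (A : 'I_n -> set ST) (k : 'I_n -> nat),
  (forall i, measurable (A i)) -> (forall i, A i `<=` window E T) -> trivIset setT A ->
  P [set o | forall i, N o (A i) = (k i)%:R%:E] =
  (\int[P]_o \prod_(i < n) poisson_weight (\int[mu]_(x in A i) (lam x o)%:E) (k i))%E.

Local Notation papangelou := (@papangelou R E T mu d Omega P lam).

Definition sqr_cost (G : config -> R) (p : ST) (w : config) : \bar R :=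
  ((G (add_point w p) - G w) ^+ 2)%:E.

Lemma nnm_sqr_cost G : measurable_fun setT G -> nnm_field (sqr_cost G).
Proof.
move=> mG; apply: nnm_EFin; last by move=> z; exact: sqr_ge0.
apply: measurable_funX; apply: measurable_funB; last exact: measurableT_comp.
by apply: measurableT_comp => //; exact: measurable_add_point_comp.
Qed.

(** Truncation is 1-Lipschitz, so it decreases the energy, and the variances of the
truncated functionals tend to that of G. *)
Theorem square_integrable_poincare (G : config -> R) : measurable_fun setT G ->
  (\int[P]_o ((G (N o)) ^+ 2)%:E < +oo)%E ->
  ((expR (- gam))%:E * 'V_P[G \o N] <=
   \int[P]_o \int[mu]_p (sqr_cost G p (N o) * papangelou p (N o)))%E.
Proof.
move=> mG G2; set EN := (X in (_ <= X)%E).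
have mass_fin : {ae P, forall o, (total_mass mu lam o < +oo)%E}.
  by apply: filterS mass_le_gam => o h; exact: le_lt_trans h (ltry _).
have mGN : measurable_fun setT (G \o N) by exact: measurableT_comp.
have nGp := nnmM (nnm_sqr_cost mG) (nnm_papangelou T sE mu P mlam lam0).
have trunc n : ((expR (- gam) * (\int[P]_o (clip n ((G \o N) o) ^+ 2) -
    (\int[P]_o clip n ((G \o N) o)) ^+ 2))%:E <= EN)%E.
  (* Shifting by n makes the truncation nonnegative and changes neither the
     variance nor the energy. *)
  pose u w := clip n (G w); pose v w := u w + n%:R.
  have mu' : measurable_fun setT u by apply: measurableT_comp => //; exact: measurable_clip.
  have bu : bounded_measurable u.
    by split => //; exists n%:R => w; rewrite ler_norml clip_bound.
  have bv : bnn v.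
    split; first by apply: bddD => //; exact: bdd_cst.
    by move=> w; rewrite -lerBlDr sub0r; case/andP: (clip_bound n (G w)).
  have := mixed_poincare sE muW mu_slice mlam lam0 gam0 walpha alpha_int alpha_le
    mass_le_gam mN hcox bv.
  have -> : wint P (fun=> 1) ((fun w => v w ^+ 2) \o N) - wint P (fun=> 1) (v \o N) ^+ 2 =
      \int[P]_o (clip n ((G \o N) o) ^+ 2) - (\int[P]_o clip n ((G \o N) o)) ^+ 2.
    have one_m : measurable_fun setT (fun _ : Omega => 1 : R) by exact: measurable_cst.
    have one_int : P.-integrable setT (EFin \o (fun=> 1 : R)).
      exact: finite_measure_integrable_cst.
    have bun : bounded_measurable (u \o N).
      by have [_ [C uC]] := bu; split; [exact: measurableT_comp|exists C => o; exact: uC].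
    have IE f : \int[P]_o f o = wint P (fun=> 1) f.
      by apply: eq_Rintegral => o _; rewrite mul1r.
    have cstE c : wint P (fun=> 1) (fun=> c) = c.
      by rewrite -IE Rintegral_cst// [X in fine X](_ : _ = 1%E) ?mulr1//; exact: probability_setT.
    rewrite !IE; have bc := bdd_cst Omega (n%:R : R).
    have -> : wint P (fun=> 1) (v \o N) = wint P (fun=> 1) (u \o N) + n%:R.
      by rewrite -[X in _ + X]cstE; exact: (wintD one_m one_int bun bc).
    have -> : wint P (fun=> 1) ((fun w => v w ^+ 2) \o N) =
        wint P (fun=> 1) (fun o => u (N o) ^+ 2) + 2 * n%:R * wint P (fun=> 1) (u \o N) + n%:R ^+ 2.
      rewrite -[X in _ + X]cstE -(wintZ one_m one_int (2 * n%:R) bun).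
      rewrite -(wintD one_m one_int (bddX2 bun) (bddZ _ bun)).
      rewrite -(wintD one_m one_int (bddD (bddX2 bun) (bddZ _ bun)) (bdd_cst Omega _)).
      by congr wint; apply/funext => o; rewrite /v /=; ring.
    have alg (a b c : R) : a + 2 * c * b + c ^+ 2 - (b + c) ^+ 2 = a - b ^+ 2 by ring.
    exact: alg.
  move/le_trans; apply.
  rewrite -(papangelou_mixture sE muW mu_slice mlam lam0 mass_fin lam_le mN hcox (nnm_sqr_cost bv.1.1)).
  have nvp := nnmM (nnm_sqr_cost bv.1.1) (nnm_papangelou T sE mu P mlam lam0).
  have at_N (F : config * ST -> \bar R) : nnm F -> nnm (fun o => \int[mu]_p F (N o, p))%E.
    by move=> nF; exact: (nnm_comp mN (nnm_integral mu nF)).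
  apply: ge0_le_integral => //.
  - by move=> o _; exact: (nnm_ge0 o (at_N _ nvp)).
  - exact: (nnm_m (at_N _ nvp)).
  - exact: (nnm_m (at_N _ nGp)).
  move=> o _; apply: ge0_le_integral => //.
  - by move=> p _; exact: (nnm_ge0 ((N o, p) : config * ST) nvp).
  - exact: (nnm_m (nnm_comp (pair1_measurable (N o)) nvp)).
  - exact: (nnm_m (nnm_comp (pair1_measurable (N o)) nGp)).
  move=> p _; apply: lee_wpmul2r; first exact: (nnm_ge0 ((N o, p) : config * ST)
    (nnm_papangelou T sE mu P mlam lam0)).
  rewrite lee_fin /v (_ : _ + _ - _ = u (add_point (N o) p) - u (N o)); last by ring.
  rewrite -real_normK ?num_real// -[leRHS]real_normK ?num_real//.
  by rewrite lerXn2r ?nnegrE// clip_lipschitz.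
have : EN = EN by []; case: {2}EN => [r| |] ENE.
- rewrite ENE (variance_mean mGN G2) -EFinM lee_fin.
  pose V n := expR (- gam) * (\int[P]_o (clip n ((G \o N) o) ^+ 2) -
    (\int[P]_o clip n ((G \o N) o)) ^+ 2).
  have cv : V n @[n --> \oo] --> expR (- gam) * (\int[P]_o ((G \o N) o ^+ 2) -
      (\int[P]_o (G \o N) o) ^+ 2).
    exact: (cvgM (cvg_cst _) (variance_truncation mGN G2)).
  rewrite -(cvg_lim (@Rhausdorff R) cv); apply: limr_le; first exact: (cvgP _ cv).
  by apply: nearW => n; rewrite -lee_fin -ENE; exact: trunc.
- by rewrite ENE leey.
- have : (0 <= EN)%E.
    by apply: integral_ge0 => o _; apply: integral_ge0 => p _; exact: (nnm_ge0 ((N o, p) : config * ST) nGp).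
  by rewrite ENE.
Qed.

End square_integrable_poincare.

(** * Null sets of a product measure *)

Section null_sections.
Context d1 d2 (X : measurableType d1) (Y : measurableType d2) {R : realType}.
Local Open Scope ereal_scope.

Lemma ae_xsection0 (m1 : {measure set X -> \bar R}) (m2 : {sigma_finite_measure set Y -> \bar R})
    (B : set (X * Y)) : measurable B -> (m1 \x m2) B = 0 ->
  {ae m1, forall x, m2 (xsection B x) = 0}.
Proof.
move=> mB B0; have : ae_eq m1 setT (m2 \o xsection B) (cst 0).
  apply/ae_eq_integral_abs => //; first exact: measurable_fun_xsection.
  by rewrite -B0; apply: eq_integral => x _; rewrite gee0_abs.
by apply: filterS => x; exact.
Qed.

(** The hypothesis on the sections, unlike nullity for the product, passes at once
from a measure to its restrictions. *)
Lemma ae_ysection0 (m1 : {sigma_finite_measure set X -> \bar R})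
    (m2 : {sigma_finite_measure set Y -> \bar R}) (B : set (X * Y)) : measurable B ->
  {ae m1, forall x, m2 (xsection B x) = 0} -> {ae m2, forall y, m1 (ysection B y) = 0}.
Proof.
move=> mB B0; have : (m1 \x m2) B = 0.
  rewrite -(integral0 m1 setT); apply: ge0_ae_eq_integral => //.
  - exact: measurable_fun_xsection.
  - by apply: filterS B0 => x + _.
rewrite (product_measure_unique (m' := m1 \x^ m2) (product_measure2E m1 m2) mB) => B0'.
have : ae_eq m2 setT (m1 \o ysection B) (cst 0).
  apply/ae_eq_integral_abs => //; first exact: measurable_fun_ysection.
  by rewrite -B0'; apply: eq_integral => x _; rewrite gee0_abs.
by apply: filterS => x; exact.
Qed.

Lemma ae_of_null (m : {measure set X -> \bar R}) (B : set X) (Q : X -> Prop) :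
  measurable B -> m B = 0 -> (forall x, ~ B x -> Q x) -> {ae m, forall x, Q x}.
Proof.
by move=> mB B0 BQ; exists B; split => // x /= nQ; apply: contrapT => /BQ.
Qed.

End null_sections.

(** * The reference measure restricted to the window *)

Section reference_measure.
Context {R : realType} (E : completeMetricType R) (T : R).
Variable nu : {finite_measure set (borel E) -> \bar R}.
Local Notation ST := (space_time R E).
Local Notation W := (window E T).
Local Notation ref := (ref_measure nu).
Local Open Scope ereal_scope.

Lemma ref_window_lty : ref W < +oo.
Proof.
rewrite (_ : ref W = lebesgue_measure `[0%R, T]%classic * nu setT); last first.
  exact: product_measure1E.
rewrite lebesgue_measure_itv/= lte_fin.
have nuT : nu setT < +oo by exact: fin_num_fun_lty.
case: ifP => T0; last by rewrite mul0e.
by rewrite oppr0 adde0 lte_mul_pinfty// lee_fin ltW.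
Qed.

Definition window_measure : {finite_measure set ST -> \bar R} :=
  mfrestr (measurable_window T : measurable (window E T)) ref_window_lty.

Local Notation mu := window_measure.

Lemma window_measureE A : mu A = ref (A `&` W). Proof. by []. Qed.

Lemma window_measure_setC : mu (~` W) = 0.
Proof. by rewrite window_measureE setICl measure0. Qed.

Lemma window_measure_null A : measurable A -> ref A = 0 -> mu A = 0.
Proof.
move=> mA; have mAW := measurableI _ _ mA (measurable_window T).
exact: (subset_measure0 mAW mA (@subIsetl _ _ _)).
Qed.

Lemma window_measure_slice t : mu (slice t) = 0.
Proof.
apply: window_measure_null; first exact: measurable_slice.
rewrite (_ : ref _ = lebesgue_measure [set t] * nu setT); last exact: product_measure1E.
by rewrite lebesgue_measure_set1 mul0e.
Qed.

Lemma ae_window (Q : ST -> Prop) : {ae ref, forall x, Q x} -> {ae mu, forall x, Q x}.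
Proof. by move=> [B [mB B0 BQ]]; exists B; split => //; exact: window_measure_null. Qed.

Lemma integral_window_sub (A : set ST) (f : ST -> \bar R) : A `<=` W ->
  \int[ref]_(p in A) f p = \int[mu]_(p in A) f p.
Proof.
move=> AW; apply: eq_measure_integral => B mB BA.
by change (ref B = ref (B `&` W)); rewrite setIidl// => p /BA /AW.
Qed.

Lemma integral_window (f : ST -> \bar R) :
  \int[ref]_(p in W) f p = \int[mu]_p (f \_ W) p.
Proof. by rewrite integral_window_sub// integral_mkcond. Qed.

End reference_measure.

(** * Extension by zero outside the window *)

Section extension_from_window.
Context {R : realType} (E : completeMetricType R) (T : R).
Local Notation ST := (space_time R E).
Local Notation W := (window E T).

Definition on_window {V : nmodType} (f : ST -> V) (x : ST) : V :=
  if x \in W then f x else 0.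

Lemma on_windowT {V : nmodType} (f : ST -> V) x : W x -> on_window f x = f x.
Proof. by move=> Wx; rewrite /on_window mem_set. Qed.

Lemma on_windowC {V : nmodType} (f : ST -> V) x : ~ W x -> on_window f x = 0.
Proof. by move=> Wx; rewrite /on_window memNset. Qed.

Lemma measurable_if_window d d' (Y : measurableType d) (V : measurableType d')
    (f : ST -> Y -> V) (v0 : V) :
  measurable_fun (W `*` [set: Y]) (fun z : ST * Y => f z.1 z.2) ->
  measurable_fun setT (fun z : ST * Y => if z.1 \in W then f z.1 z.2 else v0).
Proof.
move=> mf; apply: measurable_fun_if => //.
  apply: (measurable_fun_bool true); rewrite setTI.
  rewrite (_ : _ @^-1` _ = fst @^-1` W).
    rewrite -[X in measurable X]setTI; apply: measurable_fst => //.
    exact: measurable_window.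
  by apply/seteqP; split => z /=; [exact: set_mem|exact: mem_set].
rewrite setTI (_ : _ @^-1` _ = W `*` [set: Y])//.
by apply/seteqP; split => [z /set_mem Wz|z [/mem_set]//]; split.
Qed.

Variable nu : {finite_measure set (borel E) -> \bar R}.
Local Notation mu := (window_measure T nu).
Local Notation ref := (ref_measure nu).

Lemma integral_on_windowe (f : ST -> \bar R) :
  (\int[ref]_(p in W) f p = \int[mu]_p on_window f p)%E.
Proof. by rewrite integral_window; apply: eq_integral => p _; rewrite patchE. Qed.

Lemma integral_on_window (f : ST -> R) :
  (\int[ref]_(p in W) (f p)%:E = \int[mu]_p (on_window f p)%:E)%E.
Proof.
rewrite integral_on_windowe; apply: eq_integral => p _.
by rewrite /on_window; case: ifP.
Qed.

Variable f : ST -> R.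
Hypothesis f0 : forall x, W x -> 0 <= f x.
Hypothesis f_int : ref.-integrable W (EFin \o f).

Lemma weight_on_window : weight (on_window f).
Proof.
split; last by move=> x; rewrite /on_window; case: ifPn => //; rewrite inE; exact: f0.
have /measurable_int/measurable_EFinP mf := f_int.
rewrite (_ : on_window f = f \_ W); first exact/(measurable_restrictT _ (measurable_window T)).
by apply/funext => x; rewrite patchE.
Qed.

Lemma on_window_integrable : mu.-integrable setT (EFin \o on_window f).
Proof.
have [mf _] := weight_on_window; apply/integrableP; split; first exact/measurable_EFinP.
have /integrableP[_] := f_int; rewrite integral_on_windowe; apply: le_lt_trans.
rewrite le_eqVlt; apply/orP; left; apply/eqP; apply: eq_integral => x _.
by rewrite /= /on_window; case: ifP; rewrite ?normr0.
Qed.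

Lemma mass_on_window : wint mu (on_window f) (fun=> 1) = \int[ref]_(p in W) `|f p|.
Proof.
apply: EFin_inj; apply: (etrans (EFin_mass weight_on_window on_window_integrable)).
rewrite fineK; last exact: (integrable_fin_num (measurable_window T) (integrable_abse f_int)).
rewrite integral_on_windowe; apply: eq_integral => x _.
by rewrite /on_window; case: ifPn => //; rewrite inE => Wx; rewrite ger0_norm ?f0.
Qed.

End extension_from_window.

(** * The Cox process on the window *)

Section cox_on_window.
Context {R : realType} (E : completeMetricType R) (T : R).
Hypothesis sE : separable E.
Variable nu : {finite_measure set (borel E) -> \bar R}.
Context d (Omega : measurableType d) (P : probability Omega R).
Variable lambda : space_time R E -> Omega -> R.
Local Notation ST := (space_time R E).
Local Notation config := (configuration E T).
Local Notation W := (window E T).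
Local Notation mu := (window_measure T nu).
Local Notation ref := (ref_measure nu).
Hypothesis lambda0 : forall p o, W p -> 0 <= lambda p o.
Hypothesis mlambda : measurable_fun (W `*` [set: Omega])
  (fun z : ST * Omega => lambda z.1 z.2).

(** The intensity is only given on the window. *)
Definition lam x o : R := on_window T (lambda ^~ o) x.

Lemma measurable_lam : measurable_fun setT (fun z : ST * Omega => lam z.1 z.2).
Proof. exact: measurable_if_window. Qed.

Lemma lam_ge0 x o : 0 <= lam x o.
Proof.
by rewrite /lam /on_window; case: ifPn => //; rewrite inE; exact: lambda0.
Qed.

Lemma cumulative_intensity_part o (A : set ST) : A `<=` W ->
  cumulative_intensity nu lambda o A = (\int[mu]_(x in A) (lam x o)%:E)%E.
Proof.
move=> AW; rewrite /cumulative_intensity (integral_window_sub nu _ AW).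
by apply: eq_integral => x; rewrite inE => /AW Wx; rewrite /lam on_windowT.
Qed.

Lemma cumulative_intensity_window o :
  cumulative_intensity nu lambda o W = total_mass mu lam o.
Proof. exact: integral_on_window. Qed.

Lemma likelihoodE (w : config) o : likelihood nu lambda w o = lik mu lam w o.
Proof.
rewrite /likelihood /lik /normalizer cumulative_intensity_window; congr (_ * _%:E)%E.
by apply: eq_prod_weight => x /(supp_window sE) Wx; rewrite /lam on_windowT.
Qed.

Lemma cox_papangelouE p (w : config) : W p ->
  cox_papangelou nu P lambda p w = papangelou mu P lam p w.
Proof.
move=> Wp; have lE : likelihood nu lambda w = lik mu lam w.
  by apply/funext => o; exact: likelihoodE.
have pE : lambda p = lam p by apply/funext => o; rewrite /lam on_windowT.
by rewrite /cox_papangelou /likelihood_ratio lE pE.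
Qed.

Variables alpha beta : ST -> R.
Hypothesis bounds : {ae (ref \x P)%E, forall z : ST * Omega,
  W z.1 -> alpha z.1 <= lambda z.1 z.2 <= beta z.1}.

Lemma ae_bounds_field :
  {ae ref, forall x, {ae P, forall o, W x -> alpha x <= lambda x o <= beta x}}.
Proof.
have [B [mB B0 BQ]] := bounds.
apply: filterS (ae_xsection0 mB B0) => x x0.
apply: (ae_of_null _ x0); first exact: measurable_xsection.
move=> o nB Wx; apply: contrapT => nQ; apply: nB; apply: mem_set.
by apply: (BQ (x, o)) => /= /(_ Wx).
Qed.

Lemma ae_bounds_path : {ae P, forall o, {ae mu, forall x,
  on_window T alpha x <= lam x o <= on_window T beta x}}.
Proof.
have [B [mB B0 BQ]] := bounds.
have mu0 : {ae mu, forall x, P (xsection B x) = 0%E} := ae_window T (ae_xsection0 mB B0).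
apply: filterS (ae_ysection0 mB mu0) => o o0.
apply: (ae_of_null _ o0); first exact: measurable_ysection.
move=> x nB; have [Wx|Wx] := pselect (W x); last by rewrite /lam !on_windowC// lexx.
rewrite /lam !on_windowT//; apply: contrapT => nQ; apply: nB; apply: mem_set.
by apply: (BQ (x, o)) => /= /(_ Wx).
Qed.

(** For almost every x, some value of the intensity at x lies between the bounds. *)
Lemma ae_bounds_functions : {ae mu, forall x, on_window T alpha x <= on_window T beta x}.
Proof.
have PP : ProperFilter (almost_everywhere P).
  apply: ae_properfilter_algebraOfSetsType.
  by rewrite [ltRHS](_ : _ = 1%E) ?lte01//; exact: probability_setT.
apply: filterS (ae_window T ae_bounds_field) => x /filter_ex[ o].
have [Wx|Wx] := pselect (W x); last by rewrite !on_windowC.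
by move=> /(_ Wx)/andP[al lb]; rewrite !on_windowT//; exact: (le_trans al lb).
Qed.

Lemma ae_lam_le : {ae mu, forall x, {ae P, forall o, lam x o <= on_window T beta x}}.
Proof.
apply: filterS (ae_window T ae_bounds_field) => x; apply: filterS => o.
have [Wx|Wx] := pselect (W x); last by rewrite /lam !on_windowC.
by rewrite /lam !on_windowT// => /(_ Wx)/andP[].
Qed.

Variable N : Omega -> config.
Hypothesis cox : is_cox_process nu P lambda N.

Lemma cox_counts n (A : 'I_n -> set ST) (k : 'I_n -> nat) :
  (forall i, measurable (A i)) -> (forall i, A i `<=` W) -> trivIset setT A ->
  P [set o | forall i, N o (A i) = (k i)%:R%:E] =
  (\int[P]_o \prod_(i < n) poisson_weight (\int[mu]_(x in A i) (lam x o)%:E) (k i))%E.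
Proof.
move=> mA WA tA.
have sT : <<s intensity_events T lambda >> [set: Omega].
  by move=> S [[S0 SC _] _]; have := SC _ S0; rewrite setD0.
have := cox k mA WA tA sT; rewrite setTI => ->.
by apply: eq_integral => o _; apply: eq_bigr => i _; rewrite cumulative_intensity_part.
Qed.

End cox_on_window.

(** * The variance bound for a Cox process *)

Theorem corollary3p6 (R : realType) (E : completeMetricType R)
  (hE : separable E) (T : R) (hT : 0 <= T)
  (nu : {finite_measure set (borel E) -> \bar R})
  (d : measure_display) (Omega : measurableType d) (P : probability Omega R)
  (lambda : space_time R E -> Omega -> R)
  (hlambda0 : forall p o, window E T p -> 0 <= lambda p o)
  (hlambda : measurable_fun (window E T `*` [set: Omega])
     (fun z : space_time R E * Omega => lambda z.1 z.2))
  (N : Omega -> configuration E T) (hN : measurable_fun [set: Omega] N)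
  (hcox : is_cox_process nu P lambda N)
  (alpha beta : space_time R E -> R)
  (halpha0 : forall p, window E T p -> 0 <= alpha p)
  (hbeta0 : forall p, window E T p -> 0 <= beta p)
  (halpha : (ref_measure nu).-integrable (window E T) (EFin \o alpha))
  (hbeta : (ref_measure nu).-integrable (window E T) (EFin \o beta))
  (hbounds : {ae (ref_measure nu \x P)%E, forall z : space_time R E * Omega,
     window E T z.1 -> alpha z.1 <= lambda z.1 z.2 <= beta z.1})
  (gamma : R)
  (hgamma : gamma = \int[ref_measure nu]_(p in window E T) `|beta p|
                    - \int[ref_measure nu]_(p in window E T) `|alpha p|)
  (hgamma1 : gamma < 1) :
  let pi := cox_papangelou nu P lambda in
  [/\ is_papangelou nu P N pi,
      forall G : configuration E T -> R,
        measurable_fun [set: configuration E T] G ->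
        ('E_P[(fun o => G (N o) ^+ 2)%R] < +oo)%E ->
        ('V_P[(fun o => G (N o))%R] <=
         ((1 - Num.sqrt gamma) ^- 2)%:E *
         \int[P]_o \int[ref_measure nu]_(p in window E T)
           (pi p (N o) * (`|add_one_cost G p (N o)| ^+ 2)%:E))%E
    & {ae (ref_measure nu \x P)%E, forall z : space_time R E * Omega,
        window E T z.1 -> (pi z.1 (N z.2) <= (beta z.1)%:E)%E}].
Proof.
move=> pi; pose W := window E T; pose mu := window_measure T nu.
have mW : measurable W := measurable_window T.
have muW : mu (~` W) = 0%E := window_measure_setC T nu.
have mu_slice t : mu (slice t) = 0%E := window_measure_slice T nu t.
have mlam := measurable_lam hlambda; have lam0 := lam_ge0 hlambda0.
have counts := cox_counts hcox.
have wa := weight_on_window halpha0 halpha; have ia := on_window_integrable halpha0 halpha.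
have wb := weight_on_window hbeta0 hbeta; have ib := on_window_integrable hbeta0 hbeta.
have gammaE : wint mu (on_window T beta) (fun=> 1) =
    wint mu (on_window T alpha) (fun=> 1) + gamma.
  rewrite hgamma -(mass_on_window halpha0 halpha) -(mass_on_window hbeta0 hbeta).
  by rewrite addrC subrK.
(* The bounds enclose the intensity, hence alpha <= beta almost everywhere. *)
have gamma0 : 0 <= gamma.
  rewrite -(lerD2l (wint mu (on_window T alpha) (fun=> 1))) addr0 -gammaE.
  exact: (mass_le wb wa ib ia (ae_bounds_functions hbounds)).
have path := ae_bounds_path hbounds.
have alpha_le : {ae P, forall o, {ae mu, forall x, on_window T alpha x <= lam T lambda x o}}.
  by apply: filterS path => o; apply: filterS => x /andP[].
have mass_le_gam : {ae P, forall o, (total_mass mu (lam T lambda) o <=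
    (wint mu (on_window T alpha) (fun=> 1%R) + gamma)%:E)%E}.
  apply: filterS path => o bo; rewrite -gammaE (EFin_mass wb ib).
  apply: ae_ge0_le_integral => //.
  - by move=> x _; rewrite lee_fin.
  - by apply/measurable_EFinP; exact: (weight_lam mlam lam0 o).1.
  - by move=> x _; rewrite lee_fin; exact: wb.2.
  - by apply/measurable_EFinP; exact: wb.1.
  - by apply: filterS bo => x /andP[_ lb] _; rewrite lee_fin.
have mass_fin : {ae P, forall o, (total_mass mu (lam T lambda) o < +oo)%E}.
  by apply: filterS mass_le_gam => o h; exact: le_lt_trans h (ltry _).
have lam_le := ae_lam_le hbounds.
have piE p w : W p -> pi p w = papangelou mu P (lam T lambda) p w.
  by move=> Wp; exact: (cox_papangelouE hE nu P lambda w Wp).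
have npi : nnm_field (@papangelou R E T mu d Omega P (lam T lambda)).
  exact: (nnm_papangelou T hE mu P mlam lam0).
have swap_m : measurable_fun setT
    (fun z : space_time R E * configuration E T => (z.2, z.1)).
  exact: measurable_fun_pair.
split.
- split.
  + by move=> p w Wp; rewrite piE//; exact: (nnm_ge0 ((w, p) : configuration E T * space_time R E) npi).
  + apply: (eq_measurable_fun (fun z => papangelou mu P (lam T lambda) z.1 z.2)).
      by move=> [p w] /set_mem[Wp _] /=; rewrite piE.
    by apply: measurable_funTS; exact: (nnm_m (nnm_comp swap_m npi)).
  move=> X X0 mX; pose Y p w := if p \in W then X p w else 0%E.
  have nY : nnm_field Y.
    split; last by move=> [w p]; rewrite /Y /=; case: ifPn => //; rewrite inE => /X0.
    have swap_m' : measurable_fun setT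
        (fun z : configuration E T * space_time R E => (z.2, z.1)).
      exact: measurable_fun_pair.
    exact: (measurableT_comp (measurable_if_window (0%E : \bar R) mX) swap_m').
  have YE p w : W p -> Y p w = X p w by move=> Wp; rewrite /Y mem_set.
  have := papangelou_identity hE muW mu_slice mlam lam0 mass_fin lam_le hN counts nY.
  rewrite (_ : (\int[P]_o \int[N o]_(p in _) _)%E =
      (\int[P]_o \int[N o]_p Y p (remove_point (N o) p))%E); last first.
    apply: eq_integral => o _; rewrite [LHS]integral_mkcond; apply: eq_integral => p _.
    by rewrite patchE /Y; case: ifP.
  move=> ->; apply: eq_integral => o _; rewrite [RHS]integral_on_windowe.
  apply: eq_integral => p _; rewrite /on_window /Y; case: ifPn => [|_]; last by rewrite mul0e.
  by rewrite inE => Wp; rewrite piE.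
- move=> G mG; rewrite unlock => G2.
  have nGp := nnmM (nnm_sqr_cost hE mG) npi.
  have gap := square_integrable_poincare hE muW mu_slice mlam lam0 gamma0 wa ia alpha_le
    mass_le_gam lam_le hN counts mG G2.
  have -> : (\int[P]_o \int[ref_measure nu]_(p in window E T)
        (pi p (N o) * (`|add_one_cost G p (N o)| ^+ 2)%:E))%E =
      (\int[P]_o \int[mu]_p (sqr_cost G p (N o) *
        papangelou mu P (lam T lambda) p (N o)))%E.
    apply: eq_integral => o _; rewrite integral_on_windowe; apply: eq_integral => p _.
    have [Wp|nWp] := pselect (W p).
      by rewrite on_windowT// piE// muleC /sqr_cost real_normK ?num_real.
    (* Adding a point outside of the window changes nothing. *)
    rewrite on_windowC// /sqr_cost add_point_id//; last by case.
    by rewrite subrr expr0n mul0e.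
  have mGN : measurable_fun setT (G \o N) by exact: measurableT_comp.
  have := variance_ge0 P (G \o N); move: gap.
  rewrite -[X in _ -> _ -> ('V_P[X] <= _)%E]/(G \o N) (variance_mean mGN G2).
  move: (_ - _) => V; set EN := integral _ _ _ => gap V0.
  have : (0 <= EN)%E.
    apply: integral_ge0 => o _; apply: integral_ge0 => p _.
    exact: (nnm_ge0 ((N o, p) : configuration E T * space_time R E) nGp).
  have s1 : Num.sqrt gamma < 1 by rewrite -sqrtr1 ltr_sqrt.
  have c0 : 0 < (1 - Num.sqrt gamma) ^+ 2 by rewrite exprn_gt0// subr_gt0.
  (* exp (- gamma) >= 1 - gamma = (1 - s) (1 + s) >= (1 - s)^2 for
     s = sqrt gamma. *)
  have ce : (1 - Num.sqrt gamma) ^+ 2 <= expR (- gamma).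
    apply: le_trans (expR_ge1Dx _); have := sqr_sqrtr gamma0.
    by have := sqrtr_ge0 gamma; move: (Num.sqrt gamma) s1 => s s1 s0 ssq; nra.
  case: EN gap => [r| |//] gap r0; last by rewrite gt0_muley ?leey// lte_fin invr_gt0.
  move: gap; rewrite -!EFinM !lee_fin => gap; rewrite mulrC ler_pdivlMr//.
  by apply: (le_trans _ gap); rewrite mulrC ler_wpM2r.
- have [B [mB B0 BQ]] := ae_bounds_field hbounds.
  (* The exceptional set of x is the one of the bounds on the intensity: outside
     of it, the inequality holds for all configurations. *)
  exists (B `*` [set: Omega]); split; first exact: measurableX.
    rewrite (_ : (ref_measure nu \x P)%E _ = (ref_measure nu B * P setT)%E); last first.
      exact: product_measure1E.
    by rewrite B0 mul0e.
  move=> [p o] /= nle; split => //=; apply: BQ => /= bp; apply: nle => Wp.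
  rewrite piE//; apply: (papangelou_le hE mu mlam lam0); first exact: hbeta0.
  by apply: filterS bp => o' /(_ Wp)/andP[_]; rewrite /lam on_windowT.
Qed.
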